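(* Let $\rho^{A_1\ldots A_mE}$ be an $(m+1)$-partite quantum state (finite-dimensional). For each legitimate player $j\in[m]$ let $\mathcal{E}^{(j)}=\{\mathcal{E}^{(j)}_{x_j}\}_{x_j\in\mathcal{X}_j}$ be a quantum instrument, i.e. a finite family of completely positive maps $\mathcal{E}^{(j)}_{x_j}:A_j\to A_j'$ whose sum is trace preserving. Define the classical-quantum state $$\omega^{X_1A_1'\ldots X_mA_m'E}=\sum_{x_1,\ldots,x_m}|x_1\rangle\langle x_1|^{X_1}\otimes\cdots\otimes|x_m\rangle\langle x_m|^{X_m}\otimes(\mathcal{E}^{(1)}_{x_1}\otimes\cdots\otimes\mathcal{E}^{(m)}_{x_m}\otimes\mathrm{id}_E)\rho^{A_1\ldots A_mE}.$$ Let $\mathcal{R}_{\mathrm{cq}}$ be the set of rate tuples $R_{[m]}=(R_1,\ldots,R_m)$ of nonnegative reals such that for every $j\in[m]$ and every $J\subseteq[m]\setminus\{j\}$, $$\sum_{i\in J}R_i\ \ge\ S(X_J\,|\,X_{[m]\setminus J},A_j')_\omega,$$ and let $R^{\mathrm{cq}}_{\mathrm{CO}}=\min_{R_{[m]}\in\mathcal{R}_{\mathrm{cq}}}\sum_{j=1}^m R_j$. Then $$K_{\mathrm{n.i.}}(\rho)\ \ge\ S(X_{[m]}\,|\,E)_\omega-R^{\mathrm{cq}}_{\mathrm{CO}}.$$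
   Context: Notation: $[m]=\{1,\ldots,m\}$; for $J\subseteq[m]$, $X_J=(X_j:j\in J)$. $S$ denotes von Neumann entropy and $S(A|B)_\sigma=S(AB)_\sigma-S(B)_\sigma$ the conditional entropy of a state $\sigma$; classical registers are treated as diagonal quantum systems. $\log$ is base 2. Non-interactive secret key agreement: $m$ legitimate players and an eavesdropper share $n$ copies $\rho^{\otimes n}$, player $j$ holding $A_j^n$ and the eavesdropper $E^n$. A protocol consists of (1) for each player $j$ an instrument $\{\mathcal{E}^{(j)}_{\ell_j}\}_{\ell_j\in\mathcal{L}_j}$ of completely positive maps $A_j^n\to A_j'$ summing to a trace-preserving map, with $|\mathcal{L}_j|\le 2^{nR_j}$ for some constants $R_j$; player $j$ applies it and publicly broadcasts $\ell_j$ (the eavesdropper receives a copy of all messages); (2) for each $j$ and each tuple $\ell_{[m]}$ a POVM $(D^{(j,\ell_{[m]})}_{k_j})_{k_j\in\mathcal{K}}$ on $A_j'$, whose outcome $k_j$ is player $j$'s key. The resulting state is $$\Omega^{K_1\ldots K_mL_{[m]}E^n}=\sum_{k_{[m]},\ell_{[m]}}|k_1\rangle\langle k_1|\otimes\cdots\otimes|k_m\rangle\langle k_m|\otimes|\ell_{[m]}\rangle\langle\ell_{[m]}|\otimes\mathrm{Tr}_{A'_{[m]}}\Big[\big((\textstyle\bigotimes_j\mathcal{E}^{(j)}_{\ell_j})\otimes\mathrm{id}_{E^n}\big)(\rho^{\otimes n})\,\big(\textstyle\bigotimes_j D^{(j,\ell_{[m]})}_{k_j}\otimes\mathbb{1}_{E^n}\big)\Big].$$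 It is an $(n,\varepsilon)$-protocol if $\Pr\{K_1=\cdots=K_m\}\ge1-\varepsilon$ and $\frac12\|\Omega^{K_1L_{[m]}E^n}-u_{K_1}\otimes\tau_0^{L_{[m]}E^n}\|_1\le\varepsilon$ for some fixed state $\tau_0$, where $u_{K_1}=\frac1{|\mathcal{K}|}\sum_{k}|k\rangle\langle k|$. $R$ is achievable if for all $n$ there are $(n,\varepsilon_n)$-protocols with $\varepsilon_n\to0$ and $\frac1n\log|\mathcal{K}|\to R$. The non-interactive secret-key capacity is $K_{\mathrm{n.i.}}(\rho)=\sup\{R: R\text{ achievable}\}$. *)

(* Defs.v *)
From mathcomp Require Import all_boot all_order all_algebra.
From mathcomp Require Import complex.
From mathcomp Require Import all_classical all_reals all_analysis.
Set Implicit Arguments. Unset Strict Implicit. Unset Printing Implicit Defensive.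
Import Order.TTheory GRing.Theory Num.Theory.
Import numFieldNormedType.Exports.
Local Open Scope ring_scope.
Local Open Scope classical_set_scope.

Section Quantum.
Variable R : realType.
Local Notation C := (R[i]).
Definition rc (x : R) : C := Complex x 0.

Definition Op (T : finType) := T -> T -> C.
Definition Map (S S' : finType) := Op S -> Op S'.

Definition tr (T : finType) (X : Op T) : C := \sum_(t : T) X t t.
Definition idop (T : finType) : Op T := fun i j => (i == j)%:R.
Definition matunit (T : finType) (a a' : T) : Op T :=
  fun i j => ((i == a) && (j == a'))%:R.

(* positive semidefinite (over C this implies Hermitian) *)
Definition psd (T : finType) (X : Op T) : Prop :=
  forall v : T -> C, 0 <= \sum_(i : T) \sum_(j : T) (v i)^* * X i j * v j.
Definition hermitian (T : finType) (X : Op T) : Prop :=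
  forall i j, X j i = (X i j)^*.
Definition is_state (T : finType) (X : Op T) : Prop := psd X /\ tr X = 1.

Definition unitary (T : finType) (U : Op T) : Prop :=
  forall i j, \sum_(k : T) U i k * (U j k)^* = (i == j)%:R.
Definition is_spec (T : finType) (X : Op T) (p : Op T * (T -> R)) : Prop :=
  unitary p.1 /\
  forall i j, X i j = \sum_(k : T) p.1 i k * rc (p.2 k) * (p.1 j k)^*.

(* sum of f over the eigenvalues (with multiplicity) of a Hermitian X;
   well defined because the spectrum of X is unique. *)
Definition spec_sum (T : finType) (f : R -> R) (X : Op T) : R :=
  match pselect (exists p, is_spec X p) with
  | left h => \sum_(k : T) f ((projT1 (cid h)).2 k)
  | right _ => 0
  end.

Definition log2 (x : R) : R := ln x / ln 2.
(* von Neumann entropy S(rho) = - Tr rho log rho (with 0 log 0 = 0) *)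
Definition entropy (T : finType) (X : Op T) : R :=
  spec_sum (fun x => - (x * log2 x)) X.
Definition trnorm (T : finType) (X : Op T) : R := spec_sum (fun x => `|x|) X.

Definition linmap (S S' : finType) (F : Map S S') : Prop :=
  forall (a : C) (X Y : Op S) i j,
    F (fun k l => a * X k l + Y k l) i j = a * F X i j + F Y i j.
Definition ampl (S S' : finType) (F : Map S S') (r : nat)
  (Y : Op (S * 'I_r)%type) : Op (S' * 'I_r)%type :=
  fun p q => F (fun a a' => Y (a, p.2) (a', q.2)) p.1 q.1.
Definition completely_positive (S S' : finType) (F : Map S S') : Prop :=
  linmap F /\ forall (r : nat) (Y : Op (S * 'I_r)%type), psd Y -> psd (ampl F Y).
Definition trace_preserving (S S' : finType) (F : Map S S') : Prop :=
  forall X : Op S, tr (F X) = tr X.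
Definition instrument (L S S' : finType) (F : L -> Map S S') : Prop :=
  (forall x, completely_positive (F x)) /\
  trace_preserving (fun X i j => \sum_(x : L) F x X i j).
Definition povm (K S : finType) (D : K -> Op S) : Prop :=
  (forall k, psd (D k)) /\ forall i j, \sum_(k : K) D k i j = idop i j.

Definition apply_multi (m : nat) (S S' : 'I_m -> finType) (E : finType)
  (F : forall j : 'I_m, Map (S j) (S' j))
  (X : Op ({dffun forall j : 'I_m, S j} * E)%type) :
  Op ({dffun forall j : 'I_m, S' j} * E)%type :=
  fun p q => \sum_(a : {dffun forall j : 'I_m, S j})
             \sum_(a' : {dffun forall j : 'I_m, S j})
             X (a, p.2) (a', q.2) *
             \prod_(j < m) F j (matunit (a j) (a' j)) (p.1 j) (q.1 j).

Section Marg.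
Variables (L : finType) (Sys : L -> finType).
Definition restr (K : {set L}) (t : {dffun forall l : L, Sys l}) :
  {dffun forall s : {l : L | l \in K}, Sys (val s)} :=
  @finfun _ (fun s : {l : L | l \in K} => Sys (val s)) (fun s => t (val s)).
Definition marg (K : {set L}) (X : Op {dffun forall l : L, Sys l}) :
  Op {dffun forall s : {l : L | l \in K}, Sys (val s)} :=
  fun a a' => \sum_(t : {dffun forall l : L, Sys l})
              \sum_(t' : {dffun forall l : L, Sys l})
     ((@restr K t == a) && (@restr K t' == a')
       && (@restr (~: K) t == @restr (~: K) t'))%:R * X t t'.
Definition condS (K1 K2 : {set L}) (X : Op {dffun forall l : L, Sys l}) : R :=
  entropy (@marg (K1 :|: K2) X) - entropy (@marg K2 X).
End Marg.

Definition Lab (m : nat) : finType := (('I_m + 'I_m) + unit)%type.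
Definition LX (m : nat) (j : 'I_m) : Lab m := inl (inl j).
Definition LA (m : nat) (j : 'I_m) : Lab m := inl (inr j).
Definition LE (m : nat) : Lab m := inr tt.
Definition Sys (m : nat) (dX dA' : 'I_m -> nat) (dE : nat) (l : Lab m) : finType :=
  match l with
  | inl (inl j) => 'I_(dX j)
  | inl (inr j) => 'I_(dA' j)
  | inr _ => 'I_dE
  end.
Definition XS (m : nat) (J : {set 'I_m}) : {set Lab m} := [set LX j | j in J].

Definition omega (m : nat) (dA dX dA' : 'I_m -> nat) (dE : nat)
  (rho : Op ({dffun forall j : 'I_m, 'I_(dA j)} * 'I_dE)%type)
  (F : forall j : 'I_m, 'I_(dX j) -> Map 'I_(dA j) 'I_(dA' j)) :
  Op {dffun forall l : Lab m, Sys dX dA' dE l} :=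
  fun t t' =>
    [forall j : 'I_m, t (LX j) == t' (LX j) :> 'I_(dX j)]%:R *
    apply_multi (fun j : 'I_m => F j (t (LX j)))
      rho (@finfun _ (fun j : 'I_m => 'I_(dA' j)) (fun j => t (LA j)), t (LE m))
          (@finfun _ (fun j : 'I_m => 'I_(dA' j)) (fun j => t' (LA j)), t' (LE m)).

Definition Rcq (m : nat) (dX dA' : 'I_m -> nat) (dE : nat)
  (w : Op {dffun forall l : Lab m, Sys dX dA' dE l}) (Rt : 'I_m -> R) : Prop :=
  (forall i, 0 <= Rt i) /\
  forall (j : 'I_m) (J : {set 'I_m}), j \notin J ->
    condS (XS J) (XS (~: J) :|: [set LA j]) w <= \sum_(i in J) Rt i.
Definition RCO (m : nat) (dX dA' : 'I_m -> nat) (dE : nat)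
  (w : Op {dffun forall l : Lab m, Sys dX dA' dE l}) : \bar R :=
  ereal_inf [set (\sum_(i < m) Rt i)%:E | Rt in Rcq w].

(* rho^{(x)n}, registers regrouped as A_1^n ... A_m^n E^n *)
Definition rho_n (m : nat) (dA : 'I_m -> nat) (dE : nat)
  (rho : Op ({dffun forall j : 'I_m, 'I_(dA j)} * 'I_dE)%type) (n : nat) :
  Op ({dffun forall j : 'I_m, {ffun 'I_n -> 'I_(dA j)}} * {ffun 'I_n -> 'I_dE})%type :=
  fun p q => \prod_(i < n)
    rho (@finfun _ (fun j : 'I_m => 'I_(dA j)) (fun j => p.1 j i), p.2 i)
        (@finfun _ (fun j : 'I_m => 'I_(dA j)) (fun j => q.1 j i), q.2 i).

Record protocol (m : nat) (dA : 'I_m -> nat) (n : nat) := Protocol {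
  nlab : 'I_m -> nat;
  dout : 'I_m -> nat;
  nkey : nat;
  inst : forall j : 'I_m, 'I_(nlab j) -> Map {ffun 'I_n -> 'I_(dA j)} 'I_(dout j);
  dec : forall j : 'I_m, {dffun forall i : 'I_m, 'I_(nlab i)} -> 'I_nkey -> Op 'I_(dout j)
}.
Arguments nlab {m dA n} p _.
Arguments dout {m dA n} p _.
Arguments nkey {m dA n} p.
Arguments inst {m dA n} p j _ _ _ _.
Arguments dec {m dA n} p j _ _ _ _.

Section Proto.
Variables (m : nat) (dA : 'I_m -> nat) (dE : nat) (n : nat).
Variable P : protocol dA n.
Local Notation Lt := {dffun forall i : 'I_m, 'I_(nlab P i)}.
Local Notation En := {ffun 'I_n -> 'I_dE}.

Definition valid_protocol : Prop :=
  (forall j, instrument (inst P j)) /\ (forall j l, povm (dec P j l)).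

Definition sigma (rho : Op ({dffun forall j : 'I_m, 'I_(dA j)} * 'I_dE)%type)
  (k : {ffun 'I_m -> 'I_(nkey P)}) (l : Lt) : Op En :=
  fun e e' =>
    let M := apply_multi (fun j => inst P j (l j)) (@rho_n m dA dE rho n) in
    \sum_(b : {dffun forall j : 'I_m, 'I_(dout P j)})
    \sum_(b' : {dffun forall j : 'I_m, 'I_(dout P j)})
      M (b, e) (b', e') * \prod_(j < m) dec P j l (k j) (b' j) (b j).

Definition prob_agree rho : C :=
  \sum_(k : {ffun 'I_m -> 'I_(nkey P)} | [forall i, forall j, k i == k j])
  \sum_(l : Lt) tr (sigma rho k l).

(* Omega^{K_1 L E^n}, player 1 being j1 *)
Definition Omega1 (j1 : 'I_m) rho : Op ('I_(nkey P) * (Lt * En))%type :=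
  fun p q => ((p.1 == q.1) && (p.2.1 == q.2.1))%:R *
    \sum_(k : {ffun 'I_m -> 'I_(nkey P)} | k j1 == p.1) sigma rho k p.2.1 p.2.2 q.2.2.

Definition unif_tensor (tau : Op (Lt * En)%type) : Op ('I_(nkey P) * (Lt * En))%type :=
  fun p q => (p.1 == q.1)%:R / (nkey P)%:R * tau p.2 q.2.

Definition good_protocol (j1 : 'I_m) rho (eps : R) : Prop :=
  valid_protocol /\
  rc (1 - eps) <= prob_agree rho /\
  exists tau : Op (Lt * En)%type, is_state tau /\
    trnorm (fun p q => Omega1 j1 rho p q - unif_tensor tau p q) / 2 <= eps.
End Proto.

Definition achievable (m : nat) (dA : 'I_m -> nat) (dE : nat) (j1 : 'I_m)
  (rho : Op ({dffun forall j : 'I_m, 'I_(dA j)} * 'I_dE)%type) (r : R) : Prop :=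
  exists (Rc : 'I_m -> R) (eps : nat -> R) (P : forall n : nat, protocol dA n),
    (eps @ \oo --> 0) /\
    (forall n, good_protocol (P n) j1 rho (eps n)) /\
    (forall n j, (nlab (P n) j)%:R <= 2 `^ (n%:R * Rc j)) /\
    ((fun n : nat => log2 (nkey (P n))%:R / n%:R) @ \oo --> r).

Definition Kni (m : nat) (dA : 'I_m -> nat) (dE : nat) (j1 : 'I_m)
  (rho : Op ({dffun forall j : 'I_m, 'I_(dA j)} * 'I_dE)%type) : \bar R :=
  ereal_sup [set r%:E | r in achievable j1 rho].

End Quantum.

(* Main.v *)
(* Every player applies the given instrument to each of its n systems,
   broadcasts a random bin of its outcome string, and tries to recover the whole
   tuple x of outcome strings; the key is a random function of x.

   Decoding.  Let om x be the unnormalised state of A_j' given x.  For a set S of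
   players the marginal on X_S A_j' is block diagonal with blocks the sums of
   om y over the y that agree with x on S, so all the entropies in the rate
   region are read off the spectra of these blocks.  Player j tests the pairs
   (x, k), k an eigenvector of om x, one after the other by rank one
   projections.  A wrong candidate that agrees with the truth exactly on S must
   be rejected for each S at its own rate; this is achieved at one stroke by
   adding a flag register labelled by (S, class of x modulo agreement on S), and
   by choosing the flag amplitudes with Moebius inversion, so that the test for
   y sees a state x through e_y - W_S e_y, where S is the set on which x and y
   agree and W_S projects on the too large eigenvalues of the S-block.  A
   non-commutative union bound for sequential measurements then leaves
   sum_S 2^(n S(X_(~S) | X_S A_j')) / prod_(i notin S) N_i on average over the
   bins, and one choice of bins serves all the players.

   Secrecy.  The second moment over the random function bounds the distance of
   key, messages and E^n from the ideal state as soon as the number of keys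
   times the number of messages is at most 2^(n S(X | E)). *)
From HB Require Import structures.
Require Import Defs.
From mathcomp Require Import all_boot all_order all_algebra.
From mathcomp Require Import complex spectral sesquilinear.
From mathcomp Require Import all_classical all_reals all_analysis.
From mathcomp Require Import ring lra.
Set Implicit Arguments. Unset Strict Implicit. Unset Printing Implicit Defensive.
Import Order.TTheory GRing.Theory Num.Theory.
Import numFieldNormedType.Exports.
Local Open Scope ring_scope.

(** * Complex numbers, vectors and spectra *)

(** The [W_S] for different [S] do not commute, and a test cannot know on which set its candidate
    agrees with the truth; cutting with one [W_S] after another would spoil the estimates for the
    others. The flags decouple the cuts: the state is tilted into them with amplitude [u], and the
    compensating components of the tests carry [1 / u]. In squared norm the state moves by [M u^2]
    and a test by at most [M^2 / u^2] times the mass cut off, where [M = 2^m] counts the sets [S].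
    Comparing amplitudes costs another [1 / u], whence the powers [u] and [u^-3] in the decoding
    error. Typicality is Chebyshev only, so the mass cut off is of order [1 / n], which a slowly
    decreasing [u] absorbs.

    The secrecy estimate holds for every fixed message function. Hence the bins can be fixed by
    decoding alone, the key function is chosen afterwards for these bins, and the decoders come
    last.

    Rates are handled in nats. Each block entropy is the mean of [- ln q] when the given state is
    measured in the eigenbasis of the block, so that one law of large numbers covers the classical
    and the quantum part together. *)

Lemma eq_ler (R : numDomainType) (x y : R) : x = y -> x <= y.
Proof. by move->. Qed.

Section Complex.
Variable R : realType.
Local Notation C := (R[i]).
Local Notation Re := (@complex.Re R).
Local Notation Im := (@complex.Im R).

Lemma rc_zmod : zmod_morphism (@rc R).
Proof. by move=> x y; rewrite /rc; simpc. Qed.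
Lemma rc_monoid : monoid_morphism (@rc R).
Proof. by split=> // x y; rewrite /rc; simpc. Qed.
HB.instance Definition _ := GRing.isZmodMorphism.Build R C (@rc R) rc_zmod.
HB.instance Definition _ := GRing.isMonoidMorphism.Build R C (@rc R) rc_monoid.

Lemma Re_rc (x : R) : Re (rc x) = x. Proof. by []. Qed.
Lemma le_rc (x y : R) : (rc x <= rc y) = (x <= y). Proof. exact: lecR. Qed.
Lemma conj_rc (x : R) : (rc x)^* = rc x. Proof. exact: conjc_real. Qed.
Lemma rc_inj : injective (@rc R). Proof. exact: complexI. Qed.

Lemma rcM (x y : R) : rc (x * y) = rc x * rc y. Proof. exact: rmorphM. Qed.
Lemma rcD (x y : R) : rc (x + y) = rc x + rc y. Proof. exact: rmorphD. Qed.
Lemma rcB (x y : R) : rc (x - y) = rc x - rc y. Proof. exact: rmorphB. Qed.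
Lemma rc0 : rc 0 = 0 :> C. Proof. by []. Qed.
Lemma rc1 : rc 1 = 1 :> C. Proof. by []. Qed.
Lemma rc_nat n : rc (n%:R : R) = n%:R. Proof. exact: rmorph_nat. Qed.
Lemma rc_sum I (r : seq I) (P : pred I) (F : I -> R) :
  rc (\sum_(i <- r | P i) F i) = \sum_(i <- r | P i) rc (F i).
Proof. exact: rmorph_sum. Qed.
Lemma rc_prod I (r : seq I) (P : pred I) (F : I -> R) :
  rc (\prod_(i <- r | P i) F i) = \prod_(i <- r | P i) rc (F i).
Proof. exact: rmorph_prod. Qed.
Lemma conjM (x y : C) : (x * y)^* = x^* * y^*. Proof. exact: rmorphM. Qed.
Lemma conjD (x y : C) : (x + y)^* = x^* + y^*. Proof. exact: rmorphD. Qed.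
Lemma conjB (x y : C) : (x - y)^* = x^* - y^*. Proof. exact: rmorphB. Qed.
Lemma conjK (x : C) : x^*^* = x. Proof. exact: conjCK. Qed.
Lemma conj0 : (0 : C)^* = 0. Proof. exact: rmorph0. Qed.
Lemma conj1 : (1 : C)^* = 1. Proof. exact: rmorph1. Qed.
Lemma conj_nat n : (n%:R : C)^* = n%:R. Proof. exact: rmorph_nat. Qed.
Lemma conj_sum I (r : seq I) (P : pred I) (F : I -> C) :
  (\sum_(i <- r | P i) F i)^* = \sum_(i <- r | P i) (F i)^*.
Proof. exact: rmorph_sum. Qed.
Lemma conj_prod I (r : seq I) (P : pred I) (F : I -> C) :
  (\prod_(i <- r | P i) F i)^* = \prod_(i <- r | P i) (F i)^*.
Proof. exact: rmorph_prod. Qed.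

Lemma ReM_rc (x : R) (z : C) : Re (rc x * z) = x * Re z.
Proof. by case: z => a b /=; rewrite mul0r subr0. Qed.
Lemma Re_conj (z : C) : Re z^* = Re z. Proof. by case: z. Qed.
Lemma ge0_rcRe (z : C) : 0 <= z -> z = rc (Re z).
Proof. by case: z => a b; rewrite lecE /= => /andP[/eqP -> _]. Qed.
Lemma le_Re (z w : C) : z <= w -> Re z <= Re w.
Proof. by rewrite lecE => /andP[]. Qed.
Lemma conj_id_rc (z : C) : z^* = z -> z = rc (Re z).
Proof.
case: z => a b /= [] /esym/eqP; rewrite -addr_eq0 -mulr2n mulrn_eq0 /= => /eqP ->.
by [].
Qed.

Definition n2 (z : C) : R := Re z ^+ 2 + Im z ^+ 2.

Lemma n2_ge0 z : 0 <= n2 z. Proof. by rewrite addr_ge0 // sqr_ge0. Qed.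
Lemma rc_n2 z : rc (n2 z) = z^* * z.
Proof. by case: z => a b; rewrite /rc /n2; simpc => /=; congr Complex; ring. Qed.
Lemma n2M z w : n2 (z * w) = n2 z * n2 w.
Proof. by case: z w => a b [c d]; rewrite /n2; simpc => /=; ring. Qed.
Lemma n2_conj z : n2 z^* = n2 z.
Proof. by case: z => a b; rewrite /n2 /= sqrrN. Qed.
Lemma n2_rc x : n2 (rc x) = x ^+ 2.
Proof. by rewrite /n2 /= expr0n addr0. Qed.
Lemma n2_0 : n2 0 = 0. Proof. by rewrite /n2 /= !expr0n addr0. Qed.
Lemma n2_nat n : n2 (n%:R : C) = n%:R ^+ 2.
Proof. by rewrite -(rmorph_nat (@rc R)) n2_rc. Qed.
Lemma n2_bool (b : bool) : n2 (b%:R : C) = b%:R.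
Proof. by rewrite n2_nat; case: b; rewrite ?expr1n ?expr0n. Qed.
Lemma Re_le_n2 z : 2 * Re z - 1 <= n2 z.
Proof.
case: z => a b; rewrite /n2 /= -subr_ge0.
have -> : a ^+ 2 + b ^+ 2 - (2 * a - 1) = (a - 1) ^+ 2 + b ^+ 2 by ring.
by rewrite addr_ge0 ?sqr_ge0.
Qed.
Lemma n2_add_le z w : n2 (z + w) <= 2 * (n2 z + n2 w).
Proof.
case: z w => a b [c d]; rewrite /n2 /= -subr_ge0.
have -> : 2 * (a ^+ 2 + b ^+ 2 + (c ^+ 2 + d ^+ 2)) -
  ((a + c) ^+ 2 + (b + d) ^+ 2) = (a - c) ^+ 2 + (b - d) ^+ 2 by ring.
by rewrite addr_ge0 ?sqr_ge0.
Qed.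
Lemma n2_add3_le x y z : n2 (x + y + z) <= 3 * (n2 x + n2 y + n2 z).
Proof.
case: x y z => a b [c d] [e f]; rewrite /n2 /= -subr_ge0.
have -> : 3 * (a ^+ 2 + b ^+ 2 + (c ^+ 2 + d ^+ 2) + (e ^+ 2 + f ^+ 2)) -
  ((a + c + e) ^+ 2 + (b + d + f) ^+ 2) =
  (a - c) ^+ 2 + (a - e) ^+ 2 + (c - e) ^+ 2 + (b - d) ^+ 2 + (b - f) ^+ 2 +
  (d - f) ^+ 2 by ring.
by rewrite !addr_ge0 // sqr_ge0.
Qed.
Lemma n2_sum_le (I : finType) (z : I -> C) :
  n2 (\sum_i z i) <= #|I|%:R * \sum_i n2 (z i).
Proof.
have cs (a : I -> R) : (\sum_i a i) ^+ 2 <= #|I|%:R * \sum_i a i ^+ 2.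
  have : 0 <= \sum_i \sum_j (a i - a j) ^+ 2.
    by apply: sumr_ge0 => i _; apply: sumr_ge0 => j _; rewrite sqr_ge0.
  have -> : \sum_i \sum_j (a i - a j) ^+ 2 =
    2 * (#|I|%:R * \sum_i a i ^+ 2) - 2 * (\sum_i a i) ^+ 2.
    transitivity (\sum_i (#|I|%:R * a i ^+ 2 + \sum_j a j ^+ 2
                  - 2 * (a i * \sum_j a j))).
      apply: eq_bigr => i _; rewrite mulr_natl -sumr_const !mulr_sumr.
      rewrite -big_split -sumrB; apply: eq_bigr => j _ /=; ring.
    rewrite sumrB big_split /= sumr_const -!mulr_sumr -mulr_suml -expr2.
    by rewrite -(mulr_natl (\sum_j _) #|I|); ring.
  by rewrite subr_ge0 ler_pM2l.
rewrite /n2 !raddf_sum big_split mulrDr lerD //; exact: cs.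
Qed.

End Complex.

Section Vectors.
Variable R : realType.
Local Notation C := (R[i]).
Local Notation Re := (@complex.Re R).
Local Notation Im := (@complex.Im R).
Implicit Type T : finType.

Definition ip T (u v : T -> C) : C := \sum_t (u t)^* * v t.
Definition vn T (v : T -> C) : R := \sum_t n2 (v t).
Definition quad T (X : Op R T) (v : T -> C) : C :=
  \sum_i \sum_j (v i)^* * X i j * v j.
Definition basisv T (i : T) : T -> C := fun t => (t == i)%:R.

Lemma vn_ge0 T (v : T -> C) : 0 <= vn v.
Proof. by apply: sumr_ge0 => t _; exact: n2_ge0. Qed.
Lemma eq_vn T (u v : T -> C) : u =1 v -> vn u = vn v.
Proof. by move=> uv; apply: eq_bigr => t _; rewrite uv. Qed.
Lemma rc_vn T (v : T -> C) : rc (vn v) = ip v v.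
Proof. by rewrite rc_sum; apply: eq_bigr => t _; rewrite rc_n2. Qed.
Lemma ip_conj T (u v : T -> C) : (ip u v)^* = ip v u.
Proof.
rewrite conj_sum; apply: eq_bigr => t _.
by rewrite conjM conjK mulrC.
Qed.
Lemma ip_sumr T (I : finType) (u : T -> C) (c : I -> C) (v : I -> T -> C) :
  ip u (fun t => \sum_k c k * v k t) = \sum_k c k * ip u (v k).
Proof.
under [RHS]eq_bigr do rewrite mulr_sumr.
rewrite exchange_big; apply: eq_bigr => t _ /=.
by rewrite mulr_sumr; apply: eq_bigr => k _; rewrite mulrCA.
Qed.
Lemma ip_Br T (u v w : T -> C) a :
  ip u (fun t => v t - a * w t) = ip u v - a * ip u w.
Proof.
rewrite /ip mulr_sumr -sumrB; apply: eq_bigr => t _.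
by rewrite mulrBr mulrCA.
Qed.
Lemma ip_Bl T (u v w : T -> C) a :
  ip (fun t => v t - a * w t) u = ip v u - a^* * ip w u.
Proof. by rewrite -ip_conj ip_Br conjB conjM !ip_conj. Qed.
Lemma ip_Zl T (u v : T -> C) a : ip (fun t => a * u t) v = a^* * ip u v.
Proof.
by rewrite /ip mulr_sumr; apply: eq_bigr => t _; rewrite conjM mulrA.
Qed.
Lemma ip_Zr T (u v : T -> C) a : ip u (fun t => a * v t) = a * ip u v.
Proof. by rewrite -ip_conj ip_Zl conjM ip_conj conjK. Qed.
Lemma n2_ipC T (u v : T -> C) : n2 (ip u v) = n2 (ip v u).
Proof. by rewrite -ip_conj n2_conj. Qed.
Lemma vnZ T (u : T -> C) a : vn (fun t => a * u t) = n2 a * vn u.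
Proof. by rewrite /vn mulr_sumr; apply: eq_bigr => t _; rewrite n2M. Qed.
Lemma vnC T (u v : T -> C) : vn (fun t => u t - v t) = vn (fun t => v t - u t).
Proof.
apply: eq_bigr => t _; rewrite -opprB -mulN1r n2M.
by rewrite -(rmorph1 (@rc R)) -rmorphN n2_rc sqrrN expr1n mul1r.
Qed.

Lemma vnB T (u v : T -> C) :
  vn (fun t => u t - v t) = vn u + vn v - 2 * Re (ip u v).
Proof.
rewrite /ip raddf_sum mulr_sumr -big_split -sumrB; apply: eq_bigr => t _ /=.
by rewrite /n2; case: (u t) (v t) => a b [c d] /=; ring.
Qed.
Lemma vnB_proj T (u v : T -> C) a :
  vn (fun t => v t - a * u t) = vn v - 2 * Re (a^* * ip u v) + n2 a * vn u.
Proof.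
rewrite vnB vnZ addrAC; congr (_ - _ * _ + _).
by rewrite ip_Zr -ip_conj -(Re_conj (_ * _)) conjM conjK.
Qed.

(** Expansion of the squared norm of [c * u - v]. The weight [c] stays free because later trade-offs
    between an error and a norm or a dimension are made by choosing it. *)
Lemma Re_ip_le T (u v : T -> C) (c : R) : 0 < c ->
  2 * Re (ip u v) <= c * vn u + vn v / c.
Proof.
move=> c0; have := vn_ge0 (fun t => rc c * u t - v t).
rewrite vnB vnZ ip_Zl conj_rc ReM_rc n2_rc => h.
rewrite -(ler_pM2l c0) mulrDr [c * (_ / c)]mulrC divfK ?gt_eqF //; lra.
Qed.

(** [unitary] gives orthonormal rows; for square matrices a right inverse is also a left inverse,
    which gives the columns. *)
Lemma unitary_cols T (U : Op R T) : unitary U ->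
  forall k l, \sum_i (U i k)^* * U i l = (k == l)%:R.
Proof.
move=> hU k l.
pose M := \matrix_(i < #|T|, j < #|T|) U (enum_val i) (enum_val j).
pose N := \matrix_(i < #|T|, j < #|T|) (U (enum_val j) (enum_val i))^*.
have MN : M *m N = 1%:M.
  apply/matrixP => i j; rewrite !mxE -(inj_eq enum_val_inj) -hU.
  rewrite (reindex (@enum_val T T)) /=; last exact/onW_bij/enum_val_bij.
  by apply: eq_bigr => t _; rewrite !mxE.
have /matrixP/(_ (enum_rank k) (enum_rank l)) := mulmx1C MN.
rewrite !mxE (inj_eq enum_rank_inj) => <-.
rewrite (reindex (@enum_val T T)) /=; last exact/onW_bij/enum_val_bij.
by apply: eq_bigr => t _; rewrite !mxE !enum_rankK.
Qed.

Lemma parseval T (U : Op R T) (v : T -> C) : unitary U ->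
  \sum_k n2 (ip (U^~ k) v) = vn v.
Proof.
move=> hU; apply: rc_inj; rewrite rc_sum rc_vn /=.
under eq_bigr => k _.
  rewrite rc_n2 ip_conj /ip big_distrl /=.
  under eq_bigr do rewrite mulr_sumr.
  over.
rewrite exchange_big /=.
under eq_bigr do rewrite exchange_big /=.
apply: eq_bigr => i _.
under eq_bigr => j _.
  rewrite (eq_bigr (fun k => (v i)^* * v j * (U i k * (U j k)^*))); last first.
    by move=> k _; ring.
  rewrite -mulr_sumr hU.
  over.
rewrite (bigD1 i) //= eqxx mulr1 big1 ?addr0 // => j /negPf.
by rewrite eq_sym => ->; rewrite mulr0.
Qed.

Lemma vn_col T (U : Op R T) k : unitary U -> vn (U^~ k) = 1.
Proof.
by move=> /unitary_cols h; apply: rc_inj; rewrite rc_vn /ip h eqxx rmorph1.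
Qed.

Lemma ip_col T (U : Op R T) k l : unitary U -> ip (U^~ k) (U^~ l) = (k == l)%:R.
Proof. by move=> /unitary_cols h; rewrite /ip h. Qed.

(** Polarisation: the form is real on [e_i], [e_j], [e_i + e_j] and [e_i + i e_j], which forces the
    two off-diagonal entries to be conjugate. *)
Lemma psd_hermitian T (X : Op R T) : psd X -> Defs.hermitian X.
Proof.
move=> hX i j.
pose v a b : T -> C := fun t => a * basisv i t + b * basisv j t.
have E a b : quad X (v a b) = a^* * a * X i i + a^* * b * X i j +
    b^* * a * X j i + b^* * b * X j j.
  have B k l : \sum_s \sum_t (basisv k s)^* * X s t * basisv l t = X k l.
    rewrite (bigD1 k) //= [X in _ + X]big1 ?addr0; last first.
      by move=> s /negPf sk; apply: big1 => t _; rewrite /basisv sk rmorph0 !mul0r.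
    rewrite (bigD1 l) //= [X in _ + X]big1 ?addr0; last first.
      by move=> s /negPf sk; rewrite /basisv sk mulr0.
    by rewrite /basisv !eqxx rmorph1 mul1r mulr1.
  rewrite -(B i i) -(B i j) -(B j i) -(B j j) !mulr_sumr -!big_split.
  apply: eq_bigr => s _ /=; rewrite !mulr_sumr -!big_split.
  apply: eq_bigr => t _ /=; rewrite /v rmorphD !rmorphM /=; ring.
have Q a b : Im (a^* * a * X i i + a^* * b * X i j +
    b^* * a * X j i + b^* * b * X j j) = 0.
  by have := hX (v a b); rewrite -/(quad X (v a b)) E lecE => /andP[/eqP ->].
have := Q 1 0; have := Q 0 1; have := Q 1 1; have := Q 1 (Complex 0 1).
case: (X i i) (X i j) (X j i) (X j j) => [a1 b1] [a2 b2] [a3 b3] [a4 b4] /=.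
rewrite !(oppr0, mul0r, mul1r, mulr0, mulr1, add0r, addr0, subr0, mulN1r, opprK).
move=> h1 h2 h3 h4; apply/eqP; rewrite eq_complex /=.
by apply/andP; split; apply/eqP; lra.
Qed.

Lemma hermitian_spec T (X : Op R T) : Defs.hermitian X -> exists p, is_spec X p.
Proof.
move=> hX.
pose A := \matrix_(i < #|T|, j < #|T|) X (enum_val i) (enum_val j).
have hA : A \is hermsymmx.
  apply/is_hermitianmxP; rewrite expr0 scale1r.
  by apply/matrixP => i j; rewrite !mxE hX.
have /orthomx_spectralP EA := hermitian_normalmx hA.
have /mxOverP rD := hermitian_spectral_diag_real hA.
set P := spectralmx A in EA; set D := spectral_diag A in EA rD.
have uP : P \is unitarymx by exact: spectral_unitarymx.
exists ((fun i k => (P (enum_rank k) (enum_rank i))^*), fun k => Re (D 0 (enum_rank k))).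
split=> [i j|i j] /=.
  have /unitarymxP := uP; move/mulmx1C => /matrixP/(_ (enum_rank i) (enum_rank j)).
  rewrite !mxE (inj_eq enum_rank_inj) => <-.
  rewrite (reindex (@enum_rank T)) /=; last exact/onW_bij/enum_rank_bij.
  by apply: eq_bigr => t _; rewrite !mxE conjK.
transitivity (A (enum_rank i) (enum_rank j)); first by rewrite mxE !enum_rankK.
rewrite EA invmx_unitary // mul_mx_diag mxE.
rewrite (reindex (@enum_rank T)) /=; last exact/onW_bij/enum_rank_bij.
apply: eq_bigr => k _; rewrite !mxE conjK; congr (_ * _ * _).
by apply: conj_id_rc; apply/CrealP/rD.
Qed.

Lemma spec_eigen T (X : Op R T) p : is_spec X p ->
  forall i k, \sum_j X i j * p.1 j k = rc (p.2 k) * p.1 i k.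
Proof.
move=> [hU hX] i k; have hc := unitary_cols hU.
under eq_bigr do rewrite hX big_distrl /=.
rewrite exchange_big /=.
under eq_bigr => l _.
  rewrite (eq_bigr (fun j => p.1 i l * rc (p.2 l) * ((p.1 j l)^* * p.1 j k))); last first.
    by move=> j _; ring.
  rewrite -mulr_sumr hc.
  over.
rewrite (bigD1 k) //= eqxx mulr1 mulrC big1 ?addr0 // => l /negPf ->.
by rewrite mulr0.
Qed.

Lemma quad_spec T (X : Op R T) p v : is_spec X p ->
  quad X v = rc (\sum_k p.2 k * n2 (ip (p.1^~ k) v)).
Proof.
move=> [_ hX]; rewrite rc_sum /= /quad.
under [LHS]eq_bigr => i _.
  under eq_bigr do rewrite hX mulr_sumr mulr_suml.
  rewrite exchange_big /=.
  over.
rewrite exchange_big; apply: eq_bigr => k _ /=.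
rewrite rcM rc_n2 ip_conj /ip big_distrl mulr_sumr /=; apply: eq_bigr => i _.
by rewrite !mulr_sumr; apply: eq_bigr => j _; ring.
Qed.

Lemma spec_ge0 T (X : Op R T) p k : psd X -> is_spec X p -> 0 <= p.2 k.
Proof.
move=> hX hp; have := hX (p.1^~ k); rewrite -/(quad X _) (quad_spec _ hp).
rewrite -(rc0 R) le_rc (bigD1 k) //= [X in _ + X]big1.
  by rewrite addr0 (ip_col _ _ hp.1) eqxx n2_bool mulr1.
by move=> l /negPf lk; rewrite (ip_col _ _ hp.1) lk n2_0 mulr0.
Qed.

Lemma tr_spec T (X : Op R T) p : is_spec X p -> tr X = rc (\sum_k p.2 k).
Proof.
move=> [hU hX]; rewrite /tr rc_sum /=; under eq_bigr do rewrite hX.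
rewrite exchange_big; apply: eq_bigr => k _ /=.
rewrite (eq_bigr (fun i => rc (p.2 k) * ((p.1 i k)^* * p.1 i k))); last by move=> i _; ring.
by rewrite -mulr_sumr unitary_cols // eqxx mulr1.
Qed.

(* Both sides count the spectrum of [X]: the overlap of an eigenvector of [X]
   for [a] with one for [b] vanishes unless [a = b], so it can be weighted by
   either [f a] or [f b]. *)
Lemma spec_sum_frame T (Z : finType) (X : Op R T) (f : R -> R)
    (w : Z -> R) (F : Z -> T -> C) (q : Z -> R) :
  Defs.hermitian X ->
  (forall i j, \sum_z rc (w z) * F z i * (F z j)^* = (i == j)%:R) ->
  (forall z, vn (F z) = 1) ->
  (forall z i, \sum_j X i j * F z j = rc (q z) * F z i) ->
  spec_sum f X = \sum_z w z * f (q z).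
Proof.
move=> hX hF nF eF; rewrite /spec_sum; case: pselect => [ex|]; last first.
  by case; exact: hermitian_spec.
case: (cid ex) => p hp /=.
have hk k : \sum_z w z * n2 (ip (F z) (p.1^~ k)) = 1.
  rewrite -(vn_col k hp.1); apply: rc_inj; rewrite rc_sum rc_vn /=.
  under eq_bigr => z _.
    rewrite rcM rc_n2 ip_conj /ip big_distrl mulr_sumr /=.
    under eq_bigr do rewrite !mulr_sumr.
    over.
  rewrite exchange_big; apply: eq_bigr => i _ /=.
  rewrite exchange_big (bigD1 i) //= [X in _ + X]big1 ?addr0.
    transitivity ((p.1 i k)^* * p.1 i k * (i == i)%:R); last by rewrite eqxx mulr1.
    by rewrite -hF mulr_sumr; apply: eq_bigr => z _; ring.
  move=> j /negPf ji; transitivity ((p.1 i k)^* * p.1 j k * (i == j)%:R).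
    by rewrite -hF mulr_sumr; apply: eq_bigr => z _; ring.
  by rewrite eq_sym ji mulr0.
have ov k z : f (p.2 k) * n2 (ip (F z) (p.1^~ k)) = f (q z) * n2 (ip (F z) (p.1^~ k)).
  have [->//|ne] := eqVneq (p.2 k) (q z).
  suff -> : ip (F z) (p.1^~ k) = 0 by rewrite n2_0 !mulr0.
  have E : rc (p.2 k) * ip (F z) (p.1^~ k) = rc (q z) * ip (F z) (p.1^~ k).
    rewrite -ip_Zr -[in RHS](conj_rc (q z)) -ip_Zl /ip.
    under eq_bigr do rewrite -(spec_eigen hp) mulr_sumr.
    rewrite exchange_big; apply: eq_bigr => j _ /=.
    rewrite -eF conj_sum big_distrl /=; apply: eq_bigr => i _.
    by rewrite conjM -hX; ring.
  apply/eqP; move/eqP: E; rewrite -subr_eq0 -mulrBl mulf_eq0 => /orP[|//].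
  by rewrite -rcB -(rc0 R) (inj_eq (@rc_inj R)) subr_eq0 (negPf ne).
under eq_bigr => k _ do rewrite -[f _]mulr1 -(hk k) mulr_sumr.
rewrite exchange_big; apply: eq_bigr => z _ /=.
under eq_bigr => k _ do rewrite mulrCA ov.
rewrite -mulr_sumr -mulr_sumr.
under eq_bigr do rewrite n2_ipC.
by rewrite parseval ?nF ?mulr1 //; exact: hp.1.
Qed.

(** The trace norm in dual form, tested by all orthonormal bases and all weights of modulus at most
    1. Unlike the spectral definition of [trnorm], such bounds add up under sums of operators. *)
Definition tnb T (X : Op R T) (b : R) := forall U (s : T -> R),
  unitary U -> (forall k, `|s k| <= 1) -> \sum_k s k * Re (quad X (U^~ k)) <= b.

(** An eigenbasis weighted by the signs of the eigenvalues attains the trace norm. [0 <= b] covers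
    the default value 0 of [spec_sum] when there is no spectral decomposition. *)
Lemma trnorm_le T (X : Op R T) (b : R) : 0 <= b -> tnb X b -> trnorm X <= b.
Proof.
move=> b0 h; rewrite /trnorm /spec_sum; case: pselect => [ex|//].
case: (cid ex) => p hp /=.
have := h p.1 (fun k => Num.sg (p.2 k)) hp.1.
have sg1 k : `|Num.sg (p.2 k)| <= 1 :> R by rewrite normr_sg; case: (_ != _).
move=> /(_ sg1); apply: le_trans; apply: ler_sum => k _.
rewrite (quad_spec _ hp) Re_rc (bigD1 k) //= [X in _ + X]big1.
  by rewrite addr0 (ip_col _ _ hp.1) eqxx n2_bool mulr1 normrEsg.
by move=> l /negPf lk; rewrite (ip_col _ _ hp.1) lk n2_0 mulr0.
Qed.

End Vectors.

(** * Decoding by sequential measurement *)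

Section SequentialMeasurement.
Variable R : realType.
Local Notation C := (R[i]).
Local Notation Re := (@complex.Re R).
Variables (T Z : finType) (phi : Z -> T -> C).
Implicit Types (u v w : T -> C) (zs : seq Z).

(* Rank one tests [phi z] applied in turn: [run zs v] is the amplitude of
   rejecting all of them and [ip (amp zs z) v] that of accepting [z] first. *)
Definition step (f v : T -> C) : T -> C := fun t => v t - ip f v * f t.

Fixpoint run zs v : T -> C :=
  if zs is z :: zs' then run zs' (step (phi z) v) else v.

Fixpoint amp zs (z : Z) : T -> C :=
  if zs is z0 :: zs' then
    if z == z0 then phi z0 else step (phi z0) (amp zs' z)
  else fun=> 0.

Lemma ip_subr u v w : ip u (fun t => v t - w t) = ip u v - ip u w.
Proof. by rewrite /ip -sumrB; apply: eq_bigr => t _; rewrite mulrBr. Qed.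
Lemma ip_subl u v w : ip (fun t => v t - w t) u = ip v u - ip w u.
Proof. by rewrite -ip_conj ip_subr conjB !ip_conj. Qed.

Lemma step_adj f u v : ip (step f u) v = ip u (step f v).
Proof. by rewrite /step ip_Bl ip_Br ip_conj mulrC [ip f v * _]mulrC mulrC. Qed.

(** The tests may be shorter than unit vectors, so [step] need not be a projection; rejection and
    acceptance still share at most the whole squared norm. *)
Lemma vn_step f v : vn f <= 1 -> vn (step f v) + n2 (ip f v) <= vn v.
Proof.
move=> f1; rewrite /step vnB_proj -rc_n2 Re_rc.
have := n2_ge0 (ip f v); nra.
Qed.

Lemma step_sub f v w : step f (fun t => v t - w t) =
  fun t => step f v t - step f w t.
Proof. by apply/funext => t; rewrite /step ip_subr; ring. Qed.

Lemma run_sub zs v w : run zs (fun t => v t - w t) =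
  fun t => run zs v t - run zs w t.
Proof. by elim: zs v w => //= z zs IH v w; rewrite step_sub IH. Qed.

Hypothesis phi1 : forall z, vn (phi z) <= 1.

Lemma vn_run zs v : vn (run zs v) <= vn v.
Proof.
elim: zs v => //= z zs IH v; apply: le_trans (IH _) _.
by have := vn_step v (phi1 z); have := n2_ge0 (ip (phi z) v); lra.
Qed.

(** The acceptance probabilities telescope through [vn_step]. This is what makes the rank one
    operators on the vectors [amp zs z] sum to at most the identity. *)
Lemma amp_bessel zs v : uniq zs ->
  \sum_(z <- zs) n2 (ip (amp zs z) v) <= vn v.
Proof.
elim: zs v => [|z0 zs IH] v /=; first by rewrite big_nil vn_ge0.
move=> /andP[nz uz]; rewrite big_cons eqxx.
apply: le_trans (vn_step v (phi1 z0)); rewrite addrC lerD2r.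
apply: le_trans (IH (step (phi z0) v) uz).
apply: eq_ler; apply: eq_big_seq => z zin.
case: eqVneq => [E|_]; first by rewrite -E zin in nz.
by rewrite step_adj.
Qed.

(** [ys] consists of the tests that precede [z]: the amplitude of accepting [z] first is the overlap
    of [phi z] with what survives them. *)
Lemma amp_run zs z : z \in zs -> uniq zs -> exists ys,
  [/\ uniq ys, {subset ys <= zs}, z \notin ys &
      forall v, ip (amp zs z) v = ip (phi z) (run ys v)].
Proof.
elim: zs => //= z0 zs IH; rewrite in_cons => zin /andP[nz uz].
have [->|ne] := eqVneq z z0; first by exists [::]; split.
move: zin; rewrite (negPf ne) /= => /IH/(_ uz)[ys [uy sy zy hy]].
exists (z0 :: ys); split.
- by rewrite /= uy andbT; apply: contra nz; exact: sy.
- by move=> y; rewrite !in_cons => /orP[->//|/sy ->]; rewrite orbT.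
- by rewrite in_cons negb_or ne.
- by move=> v; rewrite step_adj hy.
Qed.

Lemma Re_mul_le (a b : C) (c : R) : 0 < c ->
  2 * Re (a * b) <= c * n2 a + n2 b / c.
Proof.
move=> c0; have := @Re_ip_le R unit (fun=> a^*) (fun=> b) c c0.
by rewrite /ip /vn !big_const !card_unit /= !addr0 conjK n2_conj.
Qed.

(* Non-commutative union bound; the quadratic potential [vn chi] absorbs the
   amplitudes lost along the run. *)
Lemma run_drift zs (psi chi : T -> C) (c : R) : 0 < c ->
  2 * Re (ip psi chi) - 2 * Re (ip psi (run zs chi)) <=
  c * (\sum_(z <- zs) n2 (ip (phi z) psi)) + (vn chi - vn (run zs chi)) / c.
Proof.
move=> c0; elim: zs chi => [|z zs IH] chi /=.
  by rewrite big_nil !subrr mulr0 mul0r addr0.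
rewrite big_cons.
have E : 2 * Re (ip psi chi) - 2 * Re (ip psi (step (phi z) chi)) <=
    c * n2 (ip (phi z) psi) + (vn chi - vn (step (phi z) chi)) / c.
  have -> : 2 * Re (ip psi chi) - 2 * Re (ip psi (step (phi z) chi)) =
     2 * Re (ip (phi z) chi * ip psi (phi z)).
    by rewrite /step ip_Br raddfB /=; ring.
  have n : n2 (ip (phi z) chi) / c <= (vn chi - vn (step (phi z) chi)) / c.
    by rewrite ler_pM2r ?invr_gt0 //; have := vn_step chi (phi1 z); lra.
  by have := Re_mul_le (ip psi (phi z)) (ip (phi z) chi) c0; rewrite (n2_ipC psi) [ip psi _ * _]mulrC; lra.
by have := IH (step (phi z) chi); rewrite mulrDr !mulrBl; move: E; rewrite mulrBl; lra.
Qed.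

(** The drift bound at [chi = psi]: the squared distance is at most twice the loss of overlap with
    [psi], because [run] does not increase norms. *)
Lemma run_close zs psi (c : R) : 0 < c ->
  vn (fun t => run zs psi t - psi t) <=
  c * (\sum_(z <- zs) n2 (ip (phi z) psi)) + vn psi / c.
Proof.
move=> c0; have := run_drift zs psi psi c0; have := vn_run zs psi.
rewrite vnC vnB -rc_vn Re_rc mulrBl.
have : 0 <= vn (run zs psi) / c by rewrite divr_ge0 ?vn_ge0 // ltW.
lra.
Qed.

(** Both vectors are expanded around the unit vector [psi]. The two linear terms are split with
    weights [t] and [1 / t], which yields [2 * t] and the factor [1 / t]; the product of the two
    deviations yields the 1 in [1 + t^-1]. *)
Lemma overlap_ge (psi f chi : T -> C) (t : R) : 0 < t -> vn psi = 1 ->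
  1 - n2 (ip f chi) <= 2 * t + (1 + t^-1) *
    (vn (fun x => f x - psi x) + vn (fun x => chi x - psi x)).
Proof.
move=> t0 p1; set a := fun x => f x - psi x; set b := fun x => chi x - psi x.
have E : ip f chi = ip psi psi + ip psi b + ip a psi + ip a b.
  by rewrite /a /b !ip_subl !ip_subr; ring.
have lo (x y : T -> C) d : 0 < d -> - (d * vn x + vn y / d) <= 2 * Re (ip x y).
  move=> d0; have := Re_ip_le x (fun s => -1 * y s) d0.
  rewrite vnZ ip_Zr -(rc1 R) -rmorphN n2_rc sqrrN expr1n mul1r ReM_rc; lra.
apply: le_trans (_ : 1 - (2 * Re (ip f chi) - 1) <= _).
  by rewrite lerD2l lerN2 Re_le_n2.
rewrite E -rc_vn p1 rc1 !raddfD /=.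
have := lo psi b _ t0; have := lo a b _ ltr01; rewrite divr1 p1.
have ti : 0 < t^-1 by rewrite invr_gt0.
by have := lo a psi _ ti; rewrite invrK p1; lra.
Qed.

(** The union bound is applied to a substitute state [psi'], on which the wrong tests have small
    overlap. Since [run] is a contraction, going from [psi] to [psi'] and back costs their squared
    distance twice; the 3 comes from the triangle inequality with three terms. *)
Lemma amp_error zs z (psi psi' : T -> C) (t c : R) :
  0 < t -> 0 < c -> z \in zs -> uniq zs -> vn psi = 1 ->
  1 - n2 (ip (amp zs z) psi) <= 2 * t + (1 + t^-1) *
   (vn (fun x => phi z x - psi x) +
    3 * (2 * vn (fun x => psi' x - psi x) +
     c * (\sum_(y <- zs | y != z) n2 (ip (phi y) psi')) + vn psi' / c)).
Proof.
move=> t0 c0 zin uz p1; have [ys [uy sy zy ->]] := amp_run zin uz.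
apply: le_trans (overlap_ge _ _ t0 p1) _.
have t1 : 0 < 1 + t^-1 by rewrite addr_gt0 // invr_gt0.
rewrite lerD2l ler_pM2l // lerD2l.
set chi := run ys psi; set chi' := run ys psi'.
apply: le_trans (_ : 3 * (vn (fun x => chi x - chi' x) +
    vn (fun x => chi' x - psi' x) + vn (fun x => psi' x - psi x)) <= _).
  rewrite /vn -!big_split mulr_sumr; apply: ler_sum => x _ /=.
  apply: le_trans (n2_add3_le _ _ _); rewrite le_eqVlt; apply/orP; left.
  by apply/eqP; congr n2; ring.
rewrite ler_pM2l //.
have h1 : vn (fun x => chi x - chi' x) <= vn (fun x => psi' x - psi x).
  by rewrite vnC [X in _ <= X]vnC -run_sub; apply: le_trans (vn_run _ _) _; rewrite vnC.
have h2 := run_close ys psi' c0.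
have h3 : \sum_(y <- ys) n2 (ip (phi y) psi') <= \sum_(y <- zs | y != z) n2 (ip (phi y) psi').
  rewrite -[X in _ <= X]big_filter.
  rewrite (big_uniq _ uy) (big_uniq _ (filter_uniq _ uz)) /=.
  rewrite [X in _ <= X](bigID (mem ys)) /=.
  rewrite -[X in X <= _]addr0 lerD ?sumr_ge0 //; last by move=> *; exact: n2_ge0.
  apply: eq_ler; apply: eq_bigl => y.
  case yin: (y \in ys); rewrite ?andbF // andbT mem_filter sy // andbT.
  by apply/esym; apply: contraNneq zy => <-.
by have := ler_wpM2l (ltW c0) h3; rewrite -/chi' in h2; lra.
Qed.

End SequentialMeasurement.

Section Povm.
Variable R : realType.
Local Notation C := (R[i]).
Local Notation Re := (@complex.Re R).

Definition tens_at (T O : finType) (o : O) (v : T -> C) : T * O -> C :=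
  fun p => v p.1 * (p.2 == o)%:R.

Lemma ip_tens_at (T O : finType) (o : O) (a : T * O -> C) (v : T -> C) :
  ip a (tens_at o v) = ip (fun t => a (t, o)) v.
Proof.
transitivity (\sum_t \sum_p (a (t, p))^* * tens_at o v (t, p)).
  by rewrite pair_bigA; apply: eq_bigr => -[].
apply: eq_bigr => t _; rewrite /tens_at /=.
rewrite (bigD1 o) //= eqxx mulr1 big1 ?addr0 // => p /negPf ->.
by rewrite !mulr0.
Qed.

Lemma vn_tens_at (T O : finType) (o : O) (v : T -> C) : vn (tens_at o v) = vn v.
Proof.
apply: rc_inj; rewrite !rc_vn ip_tens_at /ip; apply: eq_bigr => t _.
by rewrite /tens_at eqxx mulr1.
Qed.

Lemma quad_rank1 (T : finType) (a v : T -> C) :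
  quad (fun i j => a i * (a j)^*) v = rc (n2 (ip a v)).
Proof.
rewrite rc_n2 ip_conj /ip big_distrl; apply: eq_bigr => i _ /=.
by rewrite mulr_sumr; apply: eq_bigr => j _; ring.
Qed.

Lemma quad_sum (T I : finType) (P : pred I) (X : I -> Op R T) v :
  quad (fun i j => \sum_(k | P k) X k i j) v = \sum_(k | P k) quad (X k) v.
Proof.
rewrite /quad [RHS]exchange_big; apply: eq_bigr => i _ /=.
rewrite [RHS]exchange_big; apply: eq_bigr => j _ /=.
by rewrite mulr_sumr mulr_suml.
Qed.

Lemma quadD (T : finType) (X Y : Op R T) v :
  quad (fun i j => X i j + Y i j) v = quad X v + quad Y v.
Proof.
rewrite /quad -big_split; apply: eq_bigr => i _ /=.
by rewrite -big_split; apply: eq_bigr => j _ /=; ring.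
Qed.

Lemma quadB (T : finType) (X Y : Op R T) v :
  quad (fun i j => X i j - Y i j) v = quad X v - quad Y v.
Proof.
rewrite /quad -sumrB; apply: eq_bigr => i _ /=.
by rewrite -sumrB; apply: eq_bigr => j _ /=; ring.
Qed.

Lemma quadZ (T : finType) (X : Op R T) a v :
  quad (fun i j => a * X i j) v = a * quad X v.
Proof.
rewrite /quad mulr_sumr; apply: eq_bigr => i _ /=.
by rewrite mulr_sumr; apply: eq_bigr => j _ /=; ring.
Qed.

Lemma quad_id (T : finType) (v : T -> C) : quad (@idop R T) v = rc (vn v).
Proof.
rewrite rc_vn /quad; apply: eq_bigr => i _.
rewrite (bigD1 i) //= /idop eqxx mulr1 big1 ?addr0 // => j /negPf.
by rewrite eq_sym => ->; rewrite mulr0 mul0r.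
Qed.

(** Preparing the flag in the fixed state [o] compresses the sequential measurement to a measurement
    on [T] alone. Candidates with the same value of [g] are merged, and the probability of rejecting
    all of them, nonnegative by [amp_bessel], is given to [k0]. *)
Lemma seq_povm (T O Z K : finType) (o : O) (phi : Z -> T * O -> C)
    (zs : seq Z) (g : Z -> K) (k0 : K) :
  (forall z, vn (phi z) <= 1) -> uniq zs ->
  exists D : K -> Op R T, povm D /\
    forall z v, z \in zs ->
      n2 (ip (amp phi zs z) (tens_at o v)) <= Re (quad (D (g z)) v).
Proof.
move=> phi1 uz.
pose a z : T -> C := fun t => amp phi zs z (t, o).
pose M z : Op R T := fun i j => a z i * (a z j)^*.
pose N : Op R T := fun i j => \sum_(z | z \in zs) M z i j.
pose D k : Op R T := fun i j => \sum_(z | (z \in zs) && (g z == k)) M z i j +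
  (k == k0)%:R * (@idop R T i j - N i j).
have QM z v : quad (M z) v = rc (n2 (ip (a z) v)) by exact: quad_rank1.
have QD k v : quad (D k) v = rc (\sum_(z | (z \in zs) && (g z == k)) n2 (ip (a z) v)
   + (k == k0)%:R * (vn v - \sum_(z | z \in zs) n2 (ip (a z) v))).
  rewrite /D quadD quad_sum quadZ quadB quad_id quad_sum rcD rcM rcB !rc_sum rc_nat.
  by congr (_ + _ * (_ - _)); apply: eq_bigr => z _.
have bess v : 0 <= vn v - \sum_(z | z \in zs) n2 (ip (a z) v).
  have := amp_bessel phi1 (tens_at o v) uz; rewrite vn_tens_at (big_uniq _ uz).
  rewrite subr_ge0; under eq_bigr do rewrite ip_tens_at; exact.
have pos k v : 0 <= (k == k0)%:R * (vn v - \sum_(z | z \in zs) n2 (ip (a z) v)).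
  by rewrite mulr_ge0 // ler0n.
exists D; split; first split.
- move=> k v; rewrite -/(quad _ _) QD -(rc0 R) le_rc addr_ge0 //.
  by apply: sumr_ge0 => z _; exact: n2_ge0.
- move=> i j; rewrite /D big_split /= -mulr_suml.
  have -> : \sum_(k : K) (k == k0)%:R = 1 :> C.
    rewrite (bigD1 k0) //= eqxx big1 ?addr0 // => k /negPf -> //.
  rewrite mul1r.
  have -> : \sum_(k : K) \sum_(z | (z \in zs) && (g z == k)) M z i j = N i j.
    by rewrite /N (partition_big g predT).
  by rewrite addrC subrK.
- move=> z v zin; rewrite QD Re_rc ip_tens_at -/(a z).
  rewrite (bigD1 z) /=; last by rewrite zin eqxx.
  rewrite -addrA lerDl addr_ge0 //.
  by apply: sumr_ge0 => y _; exact: n2_ge0.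
Qed.

End Povm.

(** * Moebius-weighted flags and the error of one decoder *)

Section Agree.
Variables (m : nat) (A : 'I_m -> finType).
Local Notation X := {dffun forall j : 'I_m, A j}.
Implicit Types (x y : X) (S : {set 'I_m}).

Definition agree x y : {set 'I_m} := [set i | x i == y i].
(** An equivalence class serves as its own label, so the flag register is a finite type and equality
    of flags means agreement on [S]. *)
Definition cls S x : {set X} := [set y | S \subset agree x y].

Lemma agreexx x : agree x x = [set: 'I_m].
Proof. by apply/setP => i; rewrite !inE eqxx. Qed.
Lemma agreeC x y : agree x y = agree y x.
Proof. by apply/setP => i; rewrite !inE eq_sym. Qed.
Lemma agree_trans S x y z : S \subset agree x y -> S \subset agree y z ->
  S \subset agree x z.
Proof.
move=> /fintype.subsetP h1 /fintype.subsetP h2; apply/fintype.subsetP => i iS.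
by have := h1 i iS; have := h2 i iS; rewrite !inE => /eqP <- /eqP ->.
Qed.
Lemma agree_setT x y : ([set: 'I_m] \subset agree x y) = (x == y).
Proof.
apply/idP/eqP => [/fintype.subsetP h|->]; last by rewrite agreexx.
by apply/ffunP => i; have := h i; rewrite !inE => /(_ isT) => /eqP.
Qed.

Lemma cls_eq S x y : (cls S x == cls S y) = (S \subset agree x y).
Proof.
apply/eqP/idP => [/setP/(_ y)|h]; first by rewrite !inE agreexx finset.subsetT.
apply/setP => z; rewrite !inE; apply/idP/idP; last exact: agree_trans.
by apply: agree_trans; rewrite agreeC.
Qed.

End Agree.

Section Moebius.
Variable R : comPzRingType.
Variable I : finType.
Implicit Types S B : {set I}.

(* [mu B S] is [(-1) ^ #|S :\: B|] if [B] is included in [S] and [0] otherwise. *)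
Definition mu B S : R :=
  \prod_i (if i \in S then if i \in B then 1 else -1 else (i \notin B)%:R).

(** Written as a product, [mu] lets the sum over [S] factorise over coordinates. The factor at [i]
    vanishes exactly when [i] lies in one of [B] and [D] but not in the other. *)
Lemma mu_sum B (D : {set I}) : \sum_(S : {set I} | S \subset D) mu B S = (B == D)%:R.
Proof.
have E (S : {set I}) : (S \subset D)%:R = \prod_i (if i \in S then (i \in D)%:R else 1) :> R.
  case: (boolP (S \subset D)) => [/fintype.subsetP h|/subsetPn [i iS iD]].
    by rewrite big1 // => i _; case: ifP => // /h ->.
  by rewrite (bigD1 i) //= iS (negPf iD) mul0r.
transitivity (\sum_(S : {set I}) \prod_i
   (if i \in S then (i \in D)%:R * (if i \in B then 1 else -1) else (i \notin B)%:R) : R).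
  rewrite big_mkcond; apply: eq_bigr => S _.
  transitivity ((S \subset D)%:R * mu B S); first by case: ifP; rewrite ?mul1r ?mul0r.
  by rewrite E -big_split; apply: eq_bigr => i _ /=; case: ifP => // _; rewrite mul1r.
transitivity (\prod_i ((i \in D)%:R * (if i \in B then 1 else -1) + (i \notin B)%:R) : R).
  by rewrite bigA_distr; apply: eq_bigl => S; rewrite inE.
have [->|/eqP ne] := eqVneq B D.
  by apply: big1 => i _; case: (i \in D); rewrite /= ?mul1r ?mul0r ?add0r ?addr0.
have [i hi] : exists i, (i \in B) != (i \in D).
  by apply/existsP; apply: contra_notT ne => /existsPn h; apply/setP => i; apply/eqP; have := h i; rewrite negbK.
rewrite (bigD1 i) //=; move: hi; case: (i \in B); case: (i \in D) => //= _.
  by rewrite !mul0r addr0 mul0r.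
by rewrite mul1r addNr mul0r.
Qed.

End Moebius.

Lemma n2_mu (R : realType) (I : finType) (B S : {set I}) : n2 (mu R[i] B S) <= 1.
Proof.
rewrite /mu; elim/big_ind: _ => [|x y hx hy|i _].
- by rewrite (n2_bool R true).
- by rewrite n2M mulr_ile1 // n2_ge0.
- case: ifP => _; last by rewrite n2_bool; case: (i \notin B).
  case: ifP => _; first by rewrite (n2_bool R true).
  by rewrite -(rc1 R) -rmorphN n2_rc sqrrN expr1n.
Qed.

Lemma big_option (V : nmodType) (I : finType) (F : option I -> V) :
  \sum_o F o = F None + \sum_i F (Some i).
Proof.
rewrite (bigD1 None) //=; congr (_ + _).
rewrite (reindex_omap Some id) /=; last by case.
by apply: eq_bigl => i; rewrite eqxx.
Qed.

Section Decoder.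
Variable R : realType.
Local Notation C := (R[i]).
Variables (m : nat) (A : 'I_m -> finType) (T : finType).
Local Notation X := {dffun forall j : 'I_m, A j}.
Local Notation O := (option ({set 'I_m} * {set X})).
Local Notation M := (#|{set 'I_m}|%:R : R).
Variables (e : X -> T -> T -> C) (w : {set 'I_m} -> X -> T -> T -> C).
Hypothesis e_orth : forall x k l, ip (e x k) (e x l) = (k == l)%:R.
Variable s : R.
Hypothesis s0 : 0 < s.
Implicit Types (x y : X) (S : {set 'I_m}) (k l : T).

(* [O] is the flag register.  The point of the flag amplitudes is [ip_testv_tiltv]:
   the test for [x] meets the tilted state of [y] with [w S x] removed, for the
   set [S] of agreement of [x] and [y] only. *)
Definition dualv S x k : T -> C :=
  fun t => - (rc s)^-1 * \sum_B mu C B S * w B x k t.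
Definition testv x k : T * O -> C := fun p =>
  match p.2 with
  | None => e x k p.1
  | Some q => (q.2 == cls q.1 x)%:R * dualv q.1 x k p.1
  end.
Definition tiltv x k : T * O -> C := fun p =>
  match p.2 with
  | None => e x k p.1
  | Some q => (q.2 == cls q.1 x)%:R * (rc s * e x k p.1)
  end.

Lemma vn_e x k : vn (e x k) = 1.
Proof. by apply: rc_inj; rewrite rc_vn e_orth eqxx. Qed.

Lemma dualv_sum (D : {set 'I_m}) x k t :
  \sum_(S : {set 'I_m} | S \subset D) rc s * dualv S x k t = - w D x k t.
Proof.
have sC : rc s != 0 :> C by rewrite -(rc0 R) (inj_eq (@rc_inj R)) gt_eqF.
rewrite /dualv; under eq_bigr do rewrite mulNr mulrN mulrA mulfV // mul1r.
rewrite sumrN exchange_big /=; congr (- _).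
under eq_bigr do rewrite -mulr_suml mu_sum.
by rewrite (bigD1 D) //= eqxx mul1r big1 ?addr0 // => B /negPf ->; rewrite mul0r.
Qed.

Lemma pair_sum_split (V : nmodType) (f : T * O -> V) :
  \sum_p f p = \sum_t f (t, None) +
    \sum_S \sum_(c : {set X}) \sum_t f (t, Some (S, c)).
Proof.
transitivity (\sum_t \sum_o f (t, o)); first by rewrite pair_bigA; apply: eq_bigr => -[].
under eq_bigr do rewrite big_option.
rewrite big_split /=; congr (_ + _).
rewrite exchange_big /= [RHS]pair_bigA /=.
by apply: eq_bigr => -[].
Qed.

(** The flags at [S] overlap only when [S] is included in [agree x y]. Summing the dual vectors over
    these [S] is a Moebius inversion and leaves the single term [w (agree x y)]. *)
Lemma ip_testv_tiltv x k y l :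
  ip (testv x k) (tiltv y l) =
  ip (fun t => e x k t - w (agree x y) x k t) (e y l).
Proof.
rewrite {1}/ip pair_sum_split /testv /tiltv /=.
have -> : \sum_S \sum_(c : {set X}) \sum_t
    ((c == cls S x)%:R * dualv S x k t)^* * ((c == cls S y)%:R * (rc s * e y l t)) =
    \sum_(S : {set 'I_m} | S \subset agree x y) \sum_t (rc s * dualv S x k t)^* * e y l t.
  rewrite [RHS]big_mkcond; apply: eq_bigr => S _.
  rewrite (bigD1 (cls S x)) //= [X in _ + X]big1 ?addr0; last first.
    by move=> c /negPf ->; apply: big1 => t _; rewrite mul0r conj0 mul0r.
  rewrite eqxx (cls_eq S x y); case: ifP => _.
    by apply: eq_bigr => t _; rewrite !mul1r conjM conj_rc; ring.
  by apply: big1 => t _; rewrite mul0r mulr0.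
rewrite exchange_big /= -big_split; apply: eq_bigr => t _ /=.
by rewrite -mulr_suml -conj_sum dualv_sum -mulrDl -conjD.
Qed.

Definition beta x k : R := \sum_S vn (dualv S x k).

Lemma beta_ge0 x k : 0 <= beta x k.
Proof. by apply: sumr_ge0 => S _; exact: vn_ge0. Qed.

Lemma class_sum (V : nmodType) (F : {set 'I_m} -> V) (f : T * O -> V) x :
  (forall S c, c != cls S x -> \sum_t f (t, Some (S, c)) = 0) ->
  (forall S, \sum_t f (t, Some (S, cls S x)) = F S) ->
  \sum_p f p = \sum_t f (t, None) + \sum_S F S.
Proof.
move=> h0 hF; rewrite pair_sum_split; congr (_ + _); apply: eq_bigr => S _.
by rewrite (bigD1 (cls S x)) //= hF big1 ?addr0 // => c; exact: h0.
Qed.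

(** The two coefficients serve two purposes: [b = 0] gives the norm of the rescaled test, [b = 1]
    its distance from the untilted eigenvector. *)
Lemma vn_testv_sub x k (a b : C) :
  vn (fun p => a * testv x k p - b * tens_at None (e x k) p) = n2 (a - b) + n2 a * beta x k.
Proof.
rewrite [LHS](class_sum (x := x) (F := fun S => n2 a * vn (dualv S x k))).
- rewrite -mulr_sumr; congr (_ + _).
  rewrite -[RHS]mulr1 -(vn_e x k) -vnZ; apply: eq_bigr => t _.
  by rewrite /testv /tens_at /= ?eqxx !mulr1 mulrBl.
- move=> S c /negPf cS; apply: big1 => t _.
  by rewrite /testv /tens_at /= cS mul0r !mulr0 subrr n2_0.
- move=> S; rewrite -vnZ; apply: eq_bigr => t _.
  by rewrite /testv /tens_at /= eqxx mul1r !mulr0 subr0.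
Qed.

Lemma vn_tiltv_sub x k (b : C) :
  vn (fun p => tiltv x k p - b * tens_at None (e x k) p) = n2 (1 - b) + s ^+ 2 * M.
Proof.
rewrite [LHS](class_sum (x := x) (F := fun S => s ^+ 2)).
- rewrite sumr_const mulr_natr; congr (_ + _).
  rewrite -[RHS]mulr1 -(vn_e x k) -vnZ; apply: eq_bigr => t _.
  by rewrite /tiltv /tens_at /= ?eqxx !mulr1 mulrBl mul1r.
- move=> S c /negPf cS; apply: big1 => t _.
  by rewrite /tiltv /tens_at /= cS mul0r !mulr0 subrr n2_0.
- move=> S; rewrite -[RHS]mulr1 -(vn_e x k) -n2_rc -vnZ; apply: eq_bigr => t _.
  by rewrite /tiltv /tens_at /= eqxx mul1r !mulr0 subr0.
Qed.

(** One factor [M] comes from Cauchy-Schwarz in the sum over [B], the other from the sum over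
    [S]. *)
Lemma beta_le x k : beta x k <= M ^+ 2 / s ^+ 2 * \sum_S vn (w S x k).
Proof.
have h S : vn (dualv S x k) <= M / s ^+ 2 * \sum_B vn (w B x k).
  rewrite /dualv vnZ -(rmorphV (@rc R)) ?unitfE ?gt_eqF // -rmorphN n2_rc sqrrN exprVn.
  rewrite mulrC mulrAC ler_pM2r ?invr_gt0 ?exprn_gt0 //.
  rewrite /vn exchange_big mulr_sumr /=; apply: ler_sum => t _.
  apply: le_trans (n2_sum_le _) _; rewrite ler_wpM2l ?ler0n //.
  apply: ler_sum => B _; rewrite n2M -[X in _ <= X]mul1r ler_wpM2r ?n2_ge0 //.
  exact: n2_mu.
apply: le_trans (ler_sum _ (fun S _ => h S)) _.
rewrite sumr_const -(mulr_natl _ #|{set 'I_m}|) le_eqVlt; apply/orP; left.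
by apply/eqP; rewrite expr2; ring.
Qed.

(** [testv] has squared norm [1 + beta], too long for a sequential test. Dividing by [1 + beta]
    instead of its square root avoids roots, and the squared distance from the eigenvector becomes
    [1 - 1 / (1 + beta)]. *)
Definition ntestv (z : X * T) : T * O -> C :=
  fun p => rc (1 + beta z.1 z.2)^-1 * testv z.1 z.2 p.

Lemma vn_ntestv z : vn (ntestv z) <= 1.
Proof.
have b0 := beta_ge0 z.1 z.2.
have := vn_testv_sub z.1 z.2 (rc (1 + beta z.1 z.2)^-1) 0.
rewrite (@eq_vn R _ _ (ntestv z)) => [|p]; last by rewrite mul0r subr0.
rewrite subr0 n2_rc => ->.
have b1 : 0 < 1 + beta z.1 z.2 by lra.
rewrite -[X in X + _]mulr1 -mulrDr exprVn expr2 invfM -mulrA mulVf ?gt_eqF // mulr1.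
by rewrite invf_le1 //; lra.
Qed.

Lemma vn_ntestv_sub z :
  vn (fun p => ntestv z p - tens_at None (e z.1 z.2) p) <= beta z.1 z.2.
Proof.
have b0 := beta_ge0 z.1 z.2; set b := beta _ _ in b0 *.
have := vn_testv_sub z.1 z.2 (rc (1 + b)^-1) 1.
rewrite (@eq_vn R _ _ (fun p => ntestv z p - tens_at None (e z.1 z.2) p)) => [|p]; last first.
  by rewrite mul1r.
rewrite -(rc1 R) -rcB !n2_rc -/b => ->.
have b1 : 0 < 1 + b by lra.
have c1 : (1 + b)^-1 * (1 + b) = 1 by rewrite mulVf ?gt_eqF.
set c := (1 + b)^-1 in c1 *.
have c0 : 0 < c by rewrite /c invr_gt0.
have -> : (c - 1) ^+ 2 + c ^+ 2 * b = 1 - c by rewrite -[in RHS]c1; nra.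
nra.
Qed.

Lemma n2_ip_ntestv z y l :
  n2 (ip (ntestv z) (tiltv y l)) <=
  n2 (ip (fun t => e z.1 z.2 t - w (agree z.1 y) z.1 z.2 t) (e y l)).
Proof.
rewrite /ntestv ip_Zl conj_rc n2M n2_rc ip_testv_tiltv.
rewrite -[X in _ <= X]mul1r ler_wpM2r ?n2_ge0 //.
have b0 := beta_ge0 z.1 z.2.
by rewrite exprn_ile1 ?invr_ge0 ?invf_le1 //; lra.
Qed.

End Decoder.

Lemma decoder_arith (R : realType) (u M om Y Y' b : R) :
  0 < u -> u <= 1 -> 0 <= M -> 0 <= om -> 0 <= Y' -> Y <= Y' ->
  b <= M ^+ 2 / u ^+ 2 * om ->
  2 * u + (1 + u^-1) * (b + 3 * (2 * (u ^+ 2 * M) + (u ^+ 2)^-1 * Y +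
    (1 + u ^+ 2 * M) / (u ^+ 2)^-1)) <=
  (8 + 18 * M) * u + (2 * M ^+ 2 * om + 6 * Y') / u ^+ 3.
Proof.
move=> u0 u1 M0 om0 Y'0 hY hb; rewrite invrK.
have u0' := ltW u0.
have un : u != 0 by rewrite gt_eqF.
have c0 : 0 <= (u ^+ 2)^-1 by rewrite invr_ge0 exprn_ge0.
have ui : 1 <= u^-1 by rewrite invf_ge1.
have u2 : u ^+ 2 <= 1 by rewrite exprn_ile1.
have s1 : 0 <= 1 + u^-1 by lra.
have s2 : 1 + u^-1 <= 2 * u^-1 by lra.
set Q := b + _.
have hQ : Q <= M ^+ 2 / u ^+ 2 * om + 3 * (2 * (u ^+ 2 * M) + Y' / u ^+ 2 + (1 + M) * u ^+ 2).
  rewrite /Q lerD // ler_pM2l // !lerD //.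
    by rewrite mulrC ler_wpM2r.
  by rewrite ler_wpM2r ?sqr_ge0 // lerD2l -[X in _ <= X]mul1r ler_wpM2r.
have Q0 : 0 <= M ^+ 2 / u ^+ 2 * om + 3 * (2 * (u ^+ 2 * M) + Y' / u ^+ 2 + (1 + M) * u ^+ 2).
  by rewrite addr_ge0 ?mulr_ge0 ?addr_ge0 ?sqr_ge0 ?mulr_ge0 ?sqr_ge0 ?exprn_ge0 // addr_ge0.
apply: le_trans (_ : 2 * u + (2 * u^-1) * (M ^+ 2 / u ^+ 2 * om + 3 * (2 * (u ^+ 2 * M) + Y' / u ^+ 2 + (1 + M) * u ^+ 2)) <= _).
  rewrite lerD2l; apply: le_trans (ler_wpM2l s1 hQ) _.
  by rewrite ler_wpM2r.
apply: eq_ler; field.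
exact: un.
Qed.

Section DecoderBound.
Variable R : realType.
Local Notation C := (R[i]).
Local Notation Re := (@complex.Re R).
Variables (m : nat) (A : 'I_m -> finType) (T : finType).
Local Notation X := {dffun forall j : 'I_m, A j}.
Local Notation M := (#|{set 'I_m}|%:R : R).

(** [amp_error] with tilt and [t] equal to [u] and [c = u^-2]. Tilt and potential then contribute
    order [u^2], which the prefactor [1 + 1 / u] turns into order [u]; the genuine errors keep a
    factor [u^-3]. *)
Lemma decoder (K : finType) (k0 : K) (e : X -> T -> T -> C)
    (w : {set 'I_m} -> X -> T -> T -> C) (u : R) (g : X -> K) (zs : seq (X * T)) :
  (forall x k l, ip (e x k) (e x l) = (k == l)%:R) ->
  0 < u <= 1 -> uniq zs ->
  exists D : K -> Op R T, povm D /\ forall z, z \in zs ->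
    1 - Re (quad (D (g z.1)) (e z.1 z.2)) <=
    (8 + 18 * M) * u + (2 * M ^+ 2 * (\sum_S vn (w S z.1 z.2)) +
     6 * \sum_(y <- zs | y != z)
       n2 (ip (fun t => e y.1 y.2 t - w (agree y.1 z.1) y.1 y.2 t) (e z.1 z.2))) / u ^+ 3.
Proof.
move=> e_orth /andP[u0 u1] uz.
have phi1 := @vn_ntestv R m A T e w e_orth u.
have [D [pD hD]] := @seq_povm R T _ _ K None (ntestv e w u) zs (fun z => g z.1) k0 phi1 uz.
exists D; split=> // z zin.
apply: le_trans (_ : 1 - n2 (ip (amp (ntestv e w u) zs z) (tens_at None (e z.1 z.2))) <= _).
  by rewrite lerD2l lerN2 hD.
have c0 : 0 < (u ^+ 2)^-1 by rewrite invr_gt0 exprn_gt0.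
have p1 : vn (tens_at (None : option ({set 'I_m} * {set X})) (e z.1 z.2)) = 1.
  by rewrite vn_tens_at (vn_e e_orth).
apply: le_trans (amp_error phi1 (tiltv e u z.1 z.2) u0 c0 zin uz p1) _.
have -> : vn (fun x => tiltv e u z.1 z.2 x - tens_at None (e z.1 z.2) x) = u ^+ 2 * M.
  have := vn_tiltv_sub e_orth u z.1 z.2 1; rewrite subrr n2_0 add0r => <-.
  by apply: eq_bigr => t _; rewrite mul1r.
have -> : vn (tiltv e u z.1 z.2) = 1 + u ^+ 2 * M.
  have := vn_tiltv_sub e_orth u z.1 z.2 0; rewrite subr0 (n2_bool R true) => <-.
  by apply: eq_bigr => t _; rewrite mul0r subr0.
have h1 := le_trans (@vn_ntestv_sub R m A T e w e_orth u z) (beta_le w u0 z.1 z.2).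
apply: decoder_arith => //.
- by apply: sumr_ge0 => S _; exact: vn_ge0.
- by apply: sumr_ge0 => y _; exact: n2_ge0.
- by apply: ler_sum => y _; exact: n2_ip_ntestv.
Qed.

End DecoderBound.

(** Passing to [fprod] reduces this to distributivity for functions into the tagged union of the
    [T_ i]. *)
Lemma dffun_distr (R : comPzSemiRingType) (I : finType) (T_ : I -> finType)
    (F : forall i, T_ i -> R) :
  \sum_(f : {dffun forall i, T_ i}) \prod_i F i (f i) = \prod_i \sum_(y : T_ i) F i y.
Proof.
rewrite (reindex (@dffun_of_fprod I T_)); last exact/onW_bij/dffun_of_fprod_bij.
transitivity (\sum_(t : fprod T_) \prod_(i in I) [ffun y => F i y] (t i)).
  by apply: eq_bigr => t _; apply: eq_bigr => i _; rewrite !ffunE.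
rewrite (@big_fprod R 0 1 *%R +%R I T_ (fun i => [ffun y => F i y])).
rewrite -(bigA_distr_big_dep _ (fun i j => untag 0 [ffun y => F i y] j)).
apply: eq_bigr => i _; rewrite (big_tag (fun i y => F i y)).
by apply: eq_bigr => -[j y] _; rewrite /untag; case: eqP => // E; rewrite ffunE.
Qed.

(** * Random functions *)

Section Slice.
Variables (J : finType) (n : nat) (B : J -> finType).

(** Registers are grouped by player, whereas the source is independent over time. [slice] reads off
    all players at one time and so exposes the product structure. *)
Definition slice (x : {dffun forall j, {ffun 'I_n -> B j}}) (i : 'I_n) :
  {dffun forall j, B j} := @finfun _ B (fun j => x j i).
Definition slices (x : {dffun forall j, {ffun 'I_n -> B j}}) :
  {ffun 'I_n -> {dffun forall j, B j}} := [ffun i => slice x i].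
Definition unslices (z : {ffun 'I_n -> {dffun forall j, B j}}) :
  {dffun forall j, {ffun 'I_n -> B j}} :=
  @finfun _ (fun j => {ffun 'I_n -> B j}) (fun j => [ffun i => z i j]).

Lemma slicesK : cancel slices unslices.
Proof.
by move=> x; apply/ffunP => j; rewrite ffunE; apply/ffunP => i; rewrite !ffunE.
Qed.
Lemma unslicesK : cancel unslices slices.
Proof.
by move=> z; apply/ffunP => i; rewrite ffunE; apply/ffunP => j; rewrite !ffunE.
Qed.

Lemma slice_distr (R : comPzSemiRingType) (F : 'I_n -> {dffun forall j, B j} -> R) :
  \sum_(x : {dffun forall j, {ffun 'I_n -> B j}}) \prod_i F i (slice x i) =
  \prod_i \sum_(y : {dffun forall j, B j}) F i y.
Proof.
rewrite bigA_distr_bigA /= (reindex slices) /=; last first.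
  by apply: onW_bij; exists unslices; [exact: slicesK | exact: unslicesK].
by apply: eq_bigr => x _; apply: eq_bigr => i _; rewrite ffunE.
Qed.

End Slice.

Section Average.
Variable R : realType.

Lemma sum_cst (V : pzSemiRingType) (Y : finType) (a : V) :
  \sum_(y : Y) a = #|Y|%:R * a.
Proof. by rewrite sumr_const mulr_natl. Qed.

Definition avg (Y : finType) (F : Y -> R) : R := (\sum_y F y) / #|Y|%:R.

Lemma avg_sum (Y I : finType) (P : pred I) (F : I -> Y -> R) :
  avg (fun y => \sum_(i | P i) F i y) = \sum_(i | P i) avg (F i).
Proof. by rewrite /avg exchange_big /= mulr_suml. Qed.
Lemma avgZ (Y : finType) (a : R) (F : Y -> R) : avg (fun y => a * F y) = a * avg F.
Proof. by rewrite /avg -mulr_sumr mulrA. Qed.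
Lemma avgD (Y : finType) (F G : Y -> R) : avg (fun y => F y + G y) = avg F + avg G.
Proof. by rewrite /avg big_split mulrDl. Qed.
Lemma avg_cst (Y : finType) (a : R) : (0 < #|Y|)%N -> avg (fun _ : Y => a) = a.
Proof.
move=> Y0; rewrite /avg sum_cst mulrAC mulfV ?mul1r //.
by rewrite pnatr_eq0 -lt0n.
Qed.
Lemma eq_avg (Y : finType) (F G : Y -> R) : F =1 G -> avg F = avg G.
Proof. by move=> h; congr (_ / _); apply: eq_bigr. Qed.

Lemma ex_le_avg (Y : finType) (F : Y -> R) : (0 < #|Y|)%N -> exists y, F y <= avg F.
Proof.
move=> Y0; apply/not_existsP => h.
have : \sum_(y : Y) avg F < \sum_y F y.
  have /card_gt0P[y0 _] := Y0; apply: ltr_sum; first by apply/hasP; exists y0.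
  by move=> y _; rewrite ltNge; apply/negP.
rewrite sum_cst /avg mulrC divfK ?ltxx //.
by rewrite pnatr_eq0 -lt0n.
Qed.

Lemma avg_dffun (I : finType) (T_ : I -> finType) (F : forall i, T_ i -> R) :
  avg (fun f : {dffun forall i, T_ i} => \prod_i F i (f i)) = \prod_i avg (F i).
Proof.
rewrite /avg dffun_distr prodf_div; congr (_ / _).
rewrite -natr_prod; congr (_%:R).
have E : \sum_(f : {dffun forall i, T_ i}) 1%N = (\prod_i \sum_(y : T_ i) 1)%N.
  rewrite -(@dffun_distr nat I T_ (fun _ _ => 1%N)); apply: eq_bigr => f _.
  by rewrite big1_eq.
by rewrite -sum1_card [LHS]E; apply: eq_bigr => i _; exact: sum1_card.
Qed.

Lemma avg_pair (X Y : finType) (x x' : X) (h h' : Y -> R) : (0 < #|Y|)%N ->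
  x != x' -> avg (fun g : {ffun X -> Y} => h (g x) * h' (g x')) = avg h * avg h'.
Proof.
move=> Y0 ne; have ne' : x' != x by rewrite eq_sym.
pose F z y := if z == x then h y else if z == x' then h' y else 1.
have := @avg_dffun X (fun=> Y) F.
rewrite [RHS](bigD1 x) //= (bigD1 x') //= big1 ?mulr1; last first.
  move=> z /andP[/negPf zx /negPf zx']; rewrite /F zx zx' avg_cst //.
have -> : avg (F x) = avg h by apply: eq_avg => y; rewrite /F eqxx.
have -> : avg (F x') = avg h' by apply: eq_avg => y; rewrite /F (negPf ne') eqxx.
move=> <-; apply: eq_avg => g.
rewrite (bigD1 x) //= (bigD1 x') //= big1 ?mulr1; last first.
  by move=> z /andP[/negPf zx /negPf zx']; rewrite /F zx zx'.
by rewrite /F !eqxx (negPf ne').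
Qed.

Lemma avg_single (X Y : finType) (x : X) (h : Y -> R) : (0 < #|Y|)%N ->
  avg (fun g : {ffun X -> Y} => h (g x)) = avg h.
Proof.
move=> Y0.
pose F z y := if z == x then h y else 1.
have := @avg_dffun X (fun=> Y) F.
rewrite [RHS](bigD1 x) //= big1 ?mulr1; last first.
  by move=> z /negPf zx; rewrite /F zx avg_cst.
have -> : avg (F x) = avg h by apply: eq_avg => y; rewrite /F eqxx.
move=> <-; apply: eq_avg => g; rewrite (bigD1 x) //= big1 ?mulr1.
  by rewrite /F !eqxx.
by move=> z /negPf zx; rewrite /F zx.
Qed.

Lemma avg_collision (X Y : finType) (x x' : X) : (0 < #|Y|)%N -> x != x' ->
  avg (fun g : {ffun X -> Y} => (g x == g x')%:R) = #|Y|%:R^-1.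
Proof.
move=> Y0 ne.
rewrite (@eq_avg _ _ (fun g : {ffun X -> Y} => \sum_y (g x == y)%:R * (g x' == y)%:R)).
  rewrite avg_sum (eq_bigr (fun=> #|Y|%:R^-1 * #|Y|%:R^-1)).
    rewrite sum_cst mulrA mulfV ?mul1r //.
    by rewrite pnatr_eq0 -lt0n.
  move=> y _; rewrite (avg_pair (fun z => (z == y)%:R) (fun z => (z == y)%:R)) //.
  by rewrite /avg (bigD1 y) //= eqxx big1 ?addr0 ?mul1r // => z /negPf ->.
move=> g; rewrite (bigD1 (g x)) //= eqxx mul1r eq_sym big1 ?addr0 // => z /negPf.
by rewrite eq_sym => ->; rewrite mul0r.
Qed.

(** The bins of different players are independent: a player on whom the strings agree collides
    surely, any other with probability [1 / N j]. *)
Lemma avg_codes (m : nat) (A : 'I_m -> finType) (N : 'I_m -> nat)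
    (S : {set 'I_m}) (x y : {dffun forall j, A j}) :
  (forall j, (0 < N j)%N) -> S = agree x y ->
  avg (fun f : {dffun forall j, {ffun A j -> 'I_(N j)}} =>
    ([forall j, f j (x j) == f j (y j)])%:R) = \prod_(j in ~: S) (N j)%:R^-1.
Proof.
move=> N0 ->.
rewrite (@eq_avg _ _ (fun f : {dffun forall j, {ffun A j -> 'I_(N j)}} =>
   \prod_j (f j (x j) == f j (y j))%:R)).
  rewrite (@avg_dffun _ (fun j => {ffun A j -> 'I_(N j)}) (fun j g => (g (x j) == g (y j))%:R)).
  rewrite [RHS]big_mkcond; apply: eq_bigr => j _.
  rewrite !inE; have [->|ne] /= := eqVneq (x j) (y j).
    rewrite (@eq_avg _ _ (fun=> 1)) ?avg_cst // => [|g]; last by rewrite eqxx.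
    by rewrite card_ffun expn_gt0 !card_ord N0.
  by rewrite avg_collision ?card_ord.
move=> f; case: (boolP [forall _, _]) => [/forallP h|].
  by rewrite big1 // => j _; rewrite h.
by rewrite negb_forall => /existsP[j /negPf h]; rewrite (bigD1 j) //= h mul0r.
Qed.

(** The values of a random function at distinct points are independent and [h] has mean zero, so the
    cross terms vanish. *)
Lemma avg_sqr (X Y : finType) (h : Y -> R) (a : X -> R) : (0 < #|Y|)%N -> avg h = 0 ->
  avg (fun g : {ffun X -> Y} => (\sum_x h (g x) * a x) ^+ 2) =
  avg (fun y => h y ^+ 2) * \sum_x a x ^+ 2.
Proof.
move=> Y0 h0.
rewrite (@eq_avg _ _ (fun g : {ffun X -> Y} =>
   \sum_x \sum_y (a x * a y) * (h (g x) * h (g y)))); last first.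
  move=> g; rewrite expr2 mulr_suml; apply: eq_bigr => x _.
  by rewrite mulr_sumr; apply: eq_bigr => y _; ring.
rewrite avg_sum mulr_sumr; apply: eq_bigr => x _.
rewrite avg_sum (bigD1 x) //= avgZ big1 ?addr0.
  rewrite (@avg_single _ _ x (fun y => h y * h y)) // mulrC -expr2; congr (_ * _).
move=> y ne; rewrite avgZ avg_pair ?h0 ?mul0r ?mulr0 // eq_sym //.
Qed.

End Average.

(** * Privacy amplification *)

Section Projection.
Variable R : realType.
Local Notation C := (R[i]).
Variables (T : finType) (b : T -> T -> C).
Hypothesis b_orth : forall k l, ip (b k) (b l) = (k == l)%:R.

Lemma vn_comb (a : T -> C) : vn (fun t => \sum_k a k * b k t) = \sum_k n2 (a k).
Proof.
apply: rc_inj; rewrite rc_vn ip_sumr rc_sum; apply: eq_bigr => k _.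
rewrite -ip_conj ip_sumr (bigD1 k) //= b_orth eqxx mulr1 big1 ?addr0.
  by rewrite rc_n2 mulrC.
by move=> l /negPf lk; rewrite b_orth eq_sym lk mulr0.
Qed.

Lemma b_unitary : unitary (fun i k => b k i).
Proof.
pose M := \matrix_(i < #|T|, j < #|T|) (b (enum_val i) (enum_val j))^*.
pose N := \matrix_(i < #|T|, j < #|T|) b (enum_val j) (enum_val i).
have MN : M *m N = 1%:M.
  apply/matrixP => i j; rewrite !mxE -(inj_eq enum_val_inj) -b_orth.
  rewrite /ip [RHS](reindex (@enum_val T T)) /=; last exact/onW_bij/enum_val_bij.
  by apply: eq_bigr => t _; rewrite !mxE.
move=> i j; have /matrixP/(_ (enum_rank i) (enum_rank j)) := mulmx1C MN.
rewrite !mxE (inj_eq enum_rank_inj) => <-.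
rewrite [LHS](reindex (@enum_val T T)) /=; last exact/onW_bij/enum_val_bij.
by apply: eq_bigr => t _; rewrite !mxE !enum_rankK.
Qed.

Lemma b_parseval v : \sum_k n2 (ip (b k) v) = vn v.
Proof. exact: (parseval v b_unitary). Qed.

Variable G : pred T.
Definition proj (v : T -> C) : T -> C :=
  fun t => \sum_k ((G k)%:R * ip (b k) v) * b k t.

Lemma ip_b_proj k v : ip (b k) (proj v) = (G k)%:R * ip (b k) v.
Proof.
rewrite ip_sumr (bigD1 k) //= b_orth eqxx mulr1 big1 ?addr0 //.
by move=> l /negPf lk; rewrite b_orth eq_sym lk mulr0.
Qed.
Lemma proj_adj u v : ip (proj u) v = ip u (proj v).
Proof.
rewrite -ip_conj !ip_sumr conj_sum; apply: eq_bigr => k _.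
by rewrite !conjM conj_nat !ip_conj; ring.
Qed.
Lemma vn_proj v : vn (proj v) = \sum_(k | G k) n2 (ip (b k) v).
Proof.
rewrite vn_comb [RHS]big_mkcond; apply: eq_bigr => k _.
by rewrite n2M n2_bool; case: (G k); rewrite ?mul1r ?mul0r.
Qed.
Lemma vn_proj_le v : vn (proj v) <= vn v.
Proof.
rewrite vn_proj -(b_parseval v) [X in _ <= X](bigID G) lerDl /=.
by apply: sumr_ge0 => k _; exact: n2_ge0.
Qed.
Lemma ip_b_sub_proj k v :
  ip (b k) (fun t => v t - proj v t) = (~~ G k)%:R * ip (b k) v.
Proof.
rewrite ip_subr ip_b_proj; case: (G k); rewrite /= ?mul1r ?mul0r ?subrr ?subr0 //.
Qed.
Lemma vn_sub_proj v :
  vn (fun t => v t - proj v t) = \sum_(k | ~~ G k) n2 (ip (b k) v).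
Proof.
rewrite -b_parseval [RHS]big_mkcond; apply: eq_bigr => k _.
by rewrite ip_b_sub_proj n2M n2_bool; case: (G k); rewrite /= ?mul1r ?mul0r.
Qed.

End Projection.

Lemma ip_addl (R : realType) (T : finType) (u v w : T -> R[i]) :
  ip (fun t => v t + w t) u = ip v u + ip w u.
Proof. by rewrite /ip -big_split; apply: eq_bigr => t _ /=; rewrite conjD mulrDl. Qed.

(** The difference of squares is the real part of [(a + b)^* (a - b)], to which the weighted
    inequality applies with either sign. *)
Lemma n2_diff_le (R : realType) (a b : R[i]) (u : R) : 0 < u ->
  `|n2 a - n2 b| <= (u * n2 (a + b) + n2 (a - b) / u) / 2.
Proof.
move=> u0; have E : n2 a - n2 b = complex.Re ((a + b)^* * (a - b)).
  by case: a b => a1 a2 [b1 b2]; rewrite /n2 /=; ring.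
have E' : - (n2 a - n2 b) = complex.Re ((a + b)^* * (- (a - b))).
  by rewrite mulrN E raddfN.
have h1 := Re_mul_le ((a + b)^*) (a - b) u0.
have h2 := Re_mul_le ((a + b)^*) (- (a - b)) u0.
have n2N z : n2 (- z) = n2 z :> R by case: z => x y; rewrite /n2 /= !sqrrN.
rewrite n2_conj in h1; rewrite n2_conj n2N in h2.
by rewrite ler_norml; apply/andP; split; lra.
Qed.

Section PrivacyAmplification.
Variable R : realType.
Local Notation C := (R[i]).
Local Notation Re := (@complex.Re R).
Variables (X T L : finType) (K : nat).
Variables (om : X -> Op R T) (e : X -> T -> T -> C) (p : X -> T -> R).
Variables (typ : X -> pred T) (b : T -> T -> C) (G : pred T) (f : X -> L).
Variables (tau u N : R).
Hypothesis K0 : (0 < K)%N.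
Hypothesis omE : forall x i j, om x i j = \sum_k rc (p x k) * e x k i * (e x k j)^*.
Hypothesis e_orth : forall x k l, ip (e x k) (e x l) = (k == l)%:R.
Hypothesis b_orth : forall k l, ip (b k) (b l) = (k == l)%:R.
Hypothesis p0 : forall x k, 0 <= p x k.
Hypothesis p1 : \sum_x \sum_k p x k = 1.
Hypothesis typP : forall x k, typ x k -> p x k <= tau.
Hypothesis tau0 : 0 <= tau.
Hypothesis u0 : 0 < u.
Hypothesis N0 : 0 < N.
Hypothesis GN : #|G|%:R * K%:R * #|L|%:R <= N.
Hypothesis Nu : N * tau <= u ^+ 2.
Implicit Types (g : {ffun X -> 'I_K}) (k : 'I_K) (l : L) (x : X) (v : 'I_K * (L * T) -> C).
Local Notation P := (proj b G).

(** The indicator of the key value, centred: its mean over a uniform key is zero, as the second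
    moment computation requires. *)
Definition hcoef k (y : 'I_K) : R := (y == k)%:R - K%:R^-1.
Definition ccoef g x k l : R := (f x == l)%:R * hcoef k (g x).
(* The difference of the real and ideal states: the sum over [x] of
   (|g x><g x| - 1/K) (x) |f x><f x| (x) [om x]. *)
Definition leak g : Op R ('I_K * (L * T))%type := fun r s =>
  ((r.1 == s.1) && (r.2.1 == s.2.1))%:R *
  \sum_x rc (ccoef g x r.1 r.2.1) * om x r.2.2 s.2.2.
Definition sl k l v : T -> C := fun t => v (k, (l, t)).

Lemma sum_triple (V : nmodType) (F : 'I_K * (L * T) -> V) :
  \sum_r F r = \sum_k \sum_l \sum_t F (k, (l, t)).
Proof.
transitivity (\sum_k \sum_(q : L * T) F (k, q)).
  by rewrite pair_bigA; apply: eq_bigr => -[].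
by apply: eq_bigr => k _; rewrite pair_bigA; apply: eq_bigr => -[].
Qed.

Lemma quad_leak g v :
  quad (leak g) v = \sum_k \sum_l \sum_x rc (ccoef g x k l) * quad (om x) (sl k l v).
Proof.
rewrite /quad sum_triple; apply: eq_bigr => k _; apply: eq_bigr => l _.
under [RHS]eq_bigr do rewrite mulr_sumr.
rewrite [RHS]exchange_big; apply: eq_bigr => i _ /=.
rewrite sum_triple (bigD1 k) //= [X in _ + X]big1 ?addr0; last first.
  move=> k' /negPf kk; apply: big1 => l' _; apply: big1 => j _.
  by rewrite /leak /= eq_sym kk mul0r mulr0 mul0r.
rewrite (bigD1 l) //= [X in _ + X]big1 ?addr0; last first.
  move=> l' /negPf ll; apply: big1 => j _.
  by rewrite /leak /= eqxx eq_sym ll mul0r mulr0 mul0r.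
under [RHS]eq_bigr do rewrite mulr_sumr.
rewrite [RHS]exchange_big; apply: eq_bigr => j _ /=.
rewrite /leak /= !eqxx mul1r mulr_sumr mulr_suml; apply: eq_bigr => x _.
by rewrite /sl; ring.
Qed.

Lemma quad_om x w : Re (quad (om x) w) = \sum_j p x j * n2 (ip (e x j) w).
Proof.
rewrite (_ : om x = fun i j => \sum_k rc (p x k) * (e x k i * (e x k j)^*)).
  rewrite quad_sum raddf_sum; apply: eq_bigr => j _ /=.
  by rewrite quadZ quad_rank1 ReM_rc Re_rc.
by apply/funext => i; apply/funext => j; rewrite omE; under eq_bigr do rewrite -mulrA.
Qed.

Lemma vn_e1 x (k : T) : vn (e x k) = 1.
Proof. by apply: rc_inj; rewrite rc_vn e_orth eqxx. Qed.

(** Padding [y] with zeros outside the block of [k] and [l] turns this into Parseval in the whole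
    space. *)
Lemma sl_parseval U y k l : unitary U -> \sum_r n2 (ip y (sl k l (U^~ r))) = vn y.
Proof.
move=> hU; pose y' : 'I_K * (L * T) -> C :=
  fun r => ((r.1 == k) && (r.2.1 == l))%:R * y r.2.2.
have S (w : 'I_K * (L * T) -> C) : ip y' w = ip y (sl k l w).
  rewrite /ip sum_triple (bigD1 k) //= [X in _ + X]big1 ?addr0; last first.
    move=> k' /negPf kk; apply: big1 => l' _; apply: big1 => j _.
    by rewrite /y' /= kk mul0r conj0 mul0r.
  rewrite (bigD1 l) //= [X in _ + X]big1 ?addr0; last first.
    by move=> l' /negPf ll; apply: big1 => j _; rewrite /y' /= ll andbF mul0r conj0 mul0r.
  by apply: eq_bigr => j _; rewrite /y' /= !eqxx mul1r.
have -> : vn y = vn y'.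
  apply: rc_inj; rewrite !rc_vn S /ip; apply: eq_bigr => j _.
  by rewrite /sl /y' /= !eqxx mul1r.
rewrite -(parseval y' hU); apply: eq_bigr => r _.
by rewrite -S n2_ipC.
Qed.

(** Only the typical eigenvectors are kept. The projection on [G] is left to the test vectors, so
    that the second moment of [tmat] can use the orthonormality of the [e x]. *)
Definition tmat g k l : Op R T := fun i j =>
  \sum_x rc (ccoef g x k l) * \sum_(h | typ x h) rc (p x h) * (e x h i * (e x h j)^*).
Definition hs g : R := \sum_k \sum_l \sum_i \sum_j n2 (tmat g k l i j).

Lemma quad_tmat g k l w : Re (quad (tmat g k l) w) =
  \sum_x \sum_h (typ x h)%:R * (ccoef g x k l * p x h * n2 (ip (e x h) w)).
Proof.
rewrite /tmat quad_sum raddf_sum; apply: eq_bigr => x _ /=.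
rewrite quadZ quad_sum ReM_rc raddf_sum mulr_sumr /= [LHS]big_mkcond.
apply: eq_bigr => h _ /=.
rewrite quadZ quad_rank1 ReM_rc Re_rc.
by case: (typ x h); rewrite ?mul1r ?mul0r // mulrA.
Qed.

(** Trace norm against Hilbert-Schmidt norm. Over all test vectors the projected slices have total
    squared norm [#|G|] for each key and message, which accounts for the dimension term; their
    images under [tmat] are bounded by [hs g]. *)
Lemma tmat_part g (U : Op R ('I_K * (L * T))%type) (s : 'I_K * (L * T) -> R) a :
  unitary U -> (forall r, `|s r| <= 1) -> 0 < a ->
  \sum_r s r * \sum_k \sum_l Re (quad (tmat g k l) (P (sl k l (U^~ r)))) <=
  (a * (#|G|%:R * K%:R * #|L|%:R) + hs g / a) / 2.
Proof.
move=> hU s1 a0.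
pose w r k l := P (sl k l (U^~ r)).
pose M k l (v : T -> C) : T -> C := fun i => \sum_j tmat g k l i j * v j.
have Q r k l : 2 * (s r * Re (quad (tmat g k l) (w r k l))) <=
    a * vn (w r k l) + vn (M k l (w r k l)) / a.
  have -> : quad (tmat g k l) (w r k l) = ip (w r k l) (M k l (w r k l)).
    apply: eq_bigr => i _; rewrite /M mulr_sumr; apply: eq_bigr => j _.
    by rewrite mulrA.
  rewrite -ReM_rc -{1}(conj_rc (s r)) -ip_Zl.
  apply: le_trans (Re_ip_le _ _ a0) _; rewrite lerD2r ler_pM2l //.
  rewrite vnZ n2_rc -[X in _ <= X]mul1r ler_wpM2r ?vn_ge0 //.
  by rewrite -real_normK ?num_real // exprn_ile1.
have S1 k l : \sum_r vn (w r k l) = #|G|%:R.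
  under eq_bigr do rewrite vn_proj //.
  rewrite exchange_big /= (eq_bigr (fun=> 1)) ?sumr_const // => h _.
  by rewrite sl_parseval //; apply: rc_inj; rewrite rc_vn b_orth eqxx.
have S2 k l : \sum_r vn (M k l (w r k l)) <= \sum_i \sum_j n2 (tmat g k l i j).
  rewrite /vn exchange_big; apply: ler_sum => i _ /=.
  pose row j := (tmat g k l i j)^*.
  have E r : M k l (w r k l) i = ip (P row) (sl k l (U^~ r)).
    by rewrite proj_adj; apply: eq_bigr => j _; rewrite /row conjK.
  under eq_bigr do rewrite E.
  rewrite sl_parseval //; apply: le_trans (vn_proj_le b_orth G _) _.
  by apply: ler_sum => j _; rewrite /row n2_conj.
rewrite ler_pdivlMr // mulrC mulr_sumr.
apply: le_trans (_ : \sum_r \sum_k \sum_l (a * vn (w r k l) + vn (M k l (w r k l)) / a) <= _).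
  apply: ler_sum => r _; rewrite !mulr_sumr; apply: ler_sum => k _.
  by rewrite !mulr_sumr; apply: ler_sum => l _; exact: Q.
rewrite exchange_big /=; under eq_bigr do rewrite exchange_big /=.
rewrite /hs mulr_suml.
have -> : a * (#|G|%:R * K%:R * #|L|%:R) = \sum_(k < K) \sum_(l : L) a * #|G|%:R.
  by rewrite !sum_cst card_ord; ring.
rewrite -big_split; apply: ler_sum => k _ /=; rewrite mulr_suml -big_split.
apply: ler_sum => l _ /=; rewrite big_split /= -mulr_sumr S1 lerD2l -mulr_suml.
by rewrite ler_wpM2r // invr_ge0 ltW.
Qed.

Lemma hcoef_sum (y : 'I_K) : \sum_k `|hcoef k y| <= 2.
Proof.
have KR : (0 : R) < K%:R by rewrite ltr0n.
apply: le_trans (_ : \sum_(k < K) ((k == y)%:R + K%:R^-1) <= _).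
  apply: ler_sum => k _; apply: le_trans (ler_normB _ _) _.
  by rewrite !ger0_norm ?invr_ge0 ?ler0n // eq_sym.
rewrite big_split /= sum_cst card_ord mulfV ?gt_eqF // (bigD1 y) //= eqxx.
by rewrite big1 ?addr0 // => k /negPf ->.
Qed.

Lemma ccoef_sum g x : \sum_k \sum_l `|ccoef g x k l| <= 2.
Proof.
apply: le_trans (hcoef_sum (g x)); apply: ler_sum => k _.
rewrite (bigD1 (f x)) //= /ccoef eqxx mul1r big1 ?addr0 // => l /negPf.
by rewrite eq_sym => ->; rewrite mul0r normr0.
Qed.

Definition tail : R := \sum_x \sum_(k | ~~ typ x k) p x k.
(** The probability that the state, measured in the basis [b], gives an outcome outside [G]. *)
Definition spill : R := \sum_x \sum_k p x k * \sum_(h | ~~ G h) n2 (ip (b h) (e x k)).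

(** What [tmat] misses is of two kinds: atypical eigenvectors, and the replacement of a typical
    eigenvector by its projection. Both are doubled because the centred indicators have total
    variation at most 2. *)
Lemma leak_tnb g a : 0 < a ->
  tnb (leak g) ((a * (#|G|%:R * K%:R * #|L|%:R) + hs g / a) / 2 +
     2 * tail + 4 * u + spill / u).
Proof.
move=> a0.
move=> U s hU s1.
pose v r k l := sl k l (U^~ r).
pose rest r x k l h := n2 (ip (e x h) (v r k l)) - (typ x h)%:R * n2 (ip (e x h) (P (v r k l))).
have split r : Re (quad (leak g) (U^~ r)) =
    \sum_k \sum_l Re (quad (tmat g k l) (P (v r k l))) +
    \sum_k \sum_l \sum_x \sum_h ccoef g x k l * p x h * rest r x k l h.
  rewrite quad_leak raddf_sum -big_split; apply: eq_bigr => k _ /=.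
  rewrite raddf_sum -big_split; apply: eq_bigr => l _ /=.
  rewrite raddf_sum quad_tmat -big_split; apply: eq_bigr => x _ /=.
  rewrite ReM_rc quad_om mulr_sumr -big_split; apply: eq_bigr => h _ /=.
  by rewrite /rest /v; ring.
under eq_bigr => r _ do rewrite split mulrDr.
rewrite big_split /= -!addrA; apply: lerD; first exact: tmat_part.
pose del x h := \sum_(j | ~~ G j) n2 (ip (b j) (e x h)).
(* A gentle measurement estimate: [e + P e] has squared norm at most 4 and [e - P e] has squared
   norm [del], so the weight [u] in [n2_diff_le] gives [2 * u + del / (2 * u)]. *)
have R1 x k l h : \sum_r `|rest r x k l h| <=
    if typ x h then 2 * u + del x h / (2 * u) else 1.
  rewrite /rest; case: ifP => _; last first.
    rewrite -(vn_e1 x h) -(sl_parseval (e x h) k l hU).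
    by apply: ler_sum => r _; rewrite mul0r subr0 ger0_norm ?n2_ge0.
  apply: le_trans (_ : \sum_r (u * n2 (ip (fun t => e x h t + P (e x h) t) (v r k l)) +
     n2 (ip (fun t => e x h t - P (e x h) t) (v r k l)) / u) / 2 <= _).
    apply: ler_sum => r _; rewrite mul1r -proj_adj.
    apply: le_trans (n2_diff_le _ _ u0) _.
    by rewrite ip_addl ip_subl.
  rewrite -mulr_suml big_split /= -mulr_sumr -mulr_suml !sl_parseval // vn_sub_proj // -/(del x h).
  have h4 : vn (fun t => e x h t + P (e x h) t) <= 4.
    apply: le_trans (_ : 2 * (vn (e x h) + vn (P (e x h))) <= _).
      rewrite /vn -big_split mulr_sumr; apply: ler_sum => t _ /=.
      exact: n2_add_le.
    by have := vn_proj_le b_orth G (e x h); rewrite vn_e1; lra.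
  have := ler_wpM2l (ltW u0) h4.
  have -> : del x h / (2 * u) = del x h / u / 2 by rewrite invfM; ring.
  by lra.
apply: le_trans (_ : \sum_r \sum_k \sum_l \sum_x \sum_h `|ccoef g x k l| * p x h * `|rest r x k l h| <= _).
  apply: ler_sum => r _; apply: le_trans (ler_norm _) _; rewrite normrM.
  apply: le_trans (_ : 1 * `|\sum_k \sum_l \sum_x \sum_h ccoef g x k l * p x h * rest r x k l h| <= _).
    by rewrite ler_wpM2r.
  rewrite mul1r; apply: le_trans (ler_norm_sum _ _ _) _; apply: ler_sum => k _.
  apply: le_trans (ler_norm_sum _ _ _) _; apply: ler_sum => l _.
  apply: le_trans (ler_norm_sum _ _ _) _; apply: ler_sum => x _.
  apply: le_trans (ler_norm_sum _ _ _) _; apply: ler_sum => h _.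
  by rewrite !normrM (ger0_norm (p0 x h)).
rewrite exchange_big /=.
under eq_bigr => k _.
  rewrite exchange_big /=.
  under eq_bigr => l _.
    rewrite exchange_big /=.
    under eq_bigr => x _.
      rewrite exchange_big /=.
      under eq_bigr do rewrite -mulr_sumr.
      over.
    over.
  over.
apply: le_trans (_ : \sum_k \sum_l \sum_x `|ccoef g x k l| * \sum_h p x h *
    (if typ x h then 2 * u + del x h / (2 * u) else 1) <= _).
  apply: ler_sum => k _; apply: ler_sum => l _; apply: ler_sum => x _.
  rewrite mulr_sumr; apply: ler_sum => h _; rewrite -mulrA.
  by rewrite ler_wpM2l // ler_wpM2l.
under eq_bigr do rewrite exchange_big /=.
rewrite exchange_big /=.
have del0 x h : 0 <= del x h by apply: sumr_ge0 => j _; exact: n2_ge0.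
apply: le_trans (_ : \sum_x 2 * \sum_h p x h *
    (if typ x h then 2 * u + del x h / (2 * u) else 1) <= _).
  apply: ler_sum => x _; under eq_bigr do rewrite -mulr_suml.
  rewrite -mulr_suml ler_wpM2r ?ccoef_sum //.
  apply: sumr_ge0 => h _; rewrite mulr_ge0 //; case: ifP => // _.
  by rewrite addr_ge0 ?divr_ge0 ?mulr_ge0 // ltW.
rewrite -mulr_sumr.
have -> : 2 * tail + (4 * u + spill / u) =
    2 * \sum_x \sum_h ((~~ typ x h)%:R * p x h + p x h * (2 * u) + p x h * del x h / (2 * u)).
  under [X in _ = 2 * X]eq_bigr do rewrite !big_split /= -!mulr_suml.
  rewrite !big_split /= -!mulr_suml p1 mul1r /spill -/del.
  have -> : \sum_x \sum_h (~~ typ x h)%:R * p x h = tail.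
    rewrite /tail; apply: eq_bigr => x _; rewrite [RHS]big_mkcond.
    by apply: eq_bigr => h _; case: typ; rewrite ?mul1r ?mul0r.
  have un : u != 0 by rewrite gt_eqF.
  by field.
rewrite ler_pM2l //; apply: ler_sum => x _; apply: ler_sum => h _.
case: (typ x h) => /=; first by rewrite mul0r add0r mulrDr [_ * (_ / _)]mulrA.
rewrite mul1r mulr1 -addrA lerDl addr_ge0 //.
  by rewrite !mulr_ge0 // ltW.
by rewrite divr_ge0 ?mulr_ge0 // ltW.
Qed.

(** The mean square of the centred indicator is at most [1 / K], which cancels the sum over keys,
    and only the message [f x] survives. There remains the sum of the squared typical eigenvalues,
    each at most [tau] times the eigenvalue. *)
Lemma hs_avg : avg hs <= tau.
Proof.
have KR : (0 : R) < K%:R by rewrite ltr0n.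
have K0' : (0 < #|'I_K|)%N by rewrite card_ord.
have h0 k : avg (hcoef k) = 0.
  rewrite /avg /hcoef sumrB sum_cst card_ord mulfV ?gt_eqF //.
  rewrite (bigD1 k) //= eqxx big1 ?addr0 ?subrr ?mul0r // => y /negPf -> //.
have h2 k : avg (fun y => hcoef k y ^+ 2) <= K%:R^-1.
  rewrite /avg card_ord -[X in _ <= X]mul1r ler_wpM2r ?invr_ge0 ?ler0n //.
  rewrite /hcoef (eq_bigr (fun y => (y == k)%:R * (1 - 2 / K%:R) + K%:R^-1 ^+ 2)); last first.
    by move=> y _; case: (y == k) => /=; ring.
  rewrite big_split /= -mulr_suml sum_cst card_ord (bigD1 k) //= eqxx.
  rewrite big1 ?addr0 ?mul1r => [|y /negPf -> //].
  rewrite expr2 mulrA mulfV ?gt_eqF // mul1r.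
  have : 0 <= K%:R^-1 :> R by rewrite invr_ge0 ltW.
  by set z := K%:R^-1; lra.
pose a x i j : C := \sum_(h | typ x h) rc (p x h) * (e x h i * (e x h j)^*).
have A1 k l i j : avg (fun g => n2 (tmat g k l i j)) <=
    K%:R^-1 * \sum_x (f x == l)%:R * n2 (a x i j).
  rewrite (@eq_avg _ _ _ (fun g : {ffun X -> 'I_K} =>
     (\sum_x hcoef k (g x) * ((f x == l)%:R * Re (a x i j))) ^+ 2 +
     (\sum_x hcoef k (g x) * ((f x == l)%:R * complex.Im (a x i j))) ^+ 2)); last first.
    move=> g; rewrite /n2 /tmat !raddf_sum; congr (_ ^+ 2 + _ ^+ 2);
      apply: eq_bigr => x _; rewrite /ccoef -/(a x i j).
      by rewrite /= ReM_rc; ring.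
    by rewrite /=; case: (a x i j) => y z /=; ring.
  rewrite avgD !avg_sqr // -mulrDr -big_split /=.
  apply: le_trans (ler_wpM2r _ (h2 k)) _.
    by apply: sumr_ge0 => x _; rewrite addr_ge0 ?sqr_ge0.
  rewrite ler_wpM2l ?invr_ge0 ?ler0n //; apply: ler_sum => x _.
  by rewrite /n2; case: (f x == l); rewrite ?mul1r ?mul0r ?expr0n ?addr0 //=.
have A2 x : \sum_i \sum_j n2 (a x i j) <= tau * \sum_h p x h.
  rewrite exchange_big /=.
  have -> : \sum_j \sum_i n2 (a x i j) =
      \sum_j \sum_h n2 ((typ x h)%:R * rc (p x h) * (e x h j)^*).
    apply: eq_bigr => j _; rewrite -(vn_comb (e_orth x) (fun h => (typ x h)%:R * rc (p x h) * (e x h j)^*)).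
    apply: eq_bigr => i _.
    rewrite /a big_mkcond; congr n2; apply: eq_bigr => h _.
    by case: (typ x h); rewrite ?mul1r ?mul0r //; ring.
  rewrite exchange_big mulr_sumr; apply: ler_sum => h _ /=.
  under eq_bigr do rewrite n2M n2_conj.
  rewrite -mulr_sumr -/(vn _) vn_e1 mulr1 n2M n2_bool n2_rc.
  case: (boolP (typ x h)) => [/typP pt|_]; first by rewrite mul1r expr2 ler_wpM2r.
  by rewrite mul0r mulr_ge0.
rewrite /hs avg_sum.
under eq_bigr => k _.
  rewrite avg_sum; under eq_bigr => l _.
    rewrite avg_sum; under eq_bigr do rewrite avg_sum; over.
  over.
apply: le_trans (_ : \sum_(k < K) K%:R^-1 * \sum_x \sum_i \sum_j n2 (a x i j) <= _).
  apply: ler_sum => k _.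
  apply: le_trans (_ : \sum_l \sum_i \sum_j K%:R^-1 * \sum_x (f x == l)%:R * n2 (a x i j) <= _).
    by apply: ler_sum => l _; apply: ler_sum => i _; apply: ler_sum => j _; exact: A1.
  under eq_bigr do (under eq_bigr do rewrite -mulr_sumr; rewrite -mulr_sumr).
  rewrite -mulr_sumr ler_wpM2l ?invr_ge0 ?ler0n //.
  apply: le_trans (_ : \sum_l \sum_x (f x == l)%:R * (\sum_i \sum_j n2 (a x i j)) <= _).
    apply: ler_sum => l _; under eq_bigr do rewrite exchange_big /=.
    rewrite exchange_big /=; apply: ler_sum => x _; rewrite mulr_sumr.
    by apply: ler_sum => i _; rewrite mulr_sumr.
  rewrite exchange_big /=; apply: ler_sum => x _.
  rewrite -mulr_suml (bigD1 (f x)) //= eqxx big1 ?addr0 ?mul1r // => l /negPf.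
  by rewrite eq_sym => ->.
rewrite sum_cst card_ord mulrA mulfV ?gt_eqF // mul1r.
apply: le_trans (ler_sum _ (fun x _ => A2 x)) _.
by rewrite -mulr_sumr p1 mulr1.
Qed.

Lemma privacy_amplification :
  exists g, tnb (leak g) (5 * u + 2 * tail + spill / u).
Proof.
have c0 : (0 < #|{ffun X -> 'I_K}|)%N by rewrite card_ffun card_ord expn_gt0 K0.
have [g hg] := ex_le_avg hs c0.
(* The weight [u / N] balances the two terms: the dimension is at most [N], and the Hilbert-Schmidt
   part gives at most [N * tau / u], so each is at most [u]. *)
exists g => U s hU s1; have a0 : 0 < u / N by rewrite divr_gt0.
apply: le_trans (leak_tnb g a0 hU s1) _.
have h1 : u / N * (#|G|%:R * K%:R * #|L|%:R) <= u.
  by rewrite mulrAC ler_pdivrMr // ler_pM2l.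
have h2 : hs g / (u / N) <= u.
  have ht := le_trans hg hs_avg.
  rewrite ler_pdivrMr // mulrA ler_pdivlMr // -expr2; apply: le_trans Nu.
  by rewrite mulrC ler_pM2l.
lra.
Qed.

End PrivacyAmplification.

(** * Typicality *)

Section Typicality.
Variable R : realType.

Lemma iid_variance (Z : finType) (n : nat) (r g : Z -> R) :
  \sum_z r z = 1 -> \sum_z r z * g z = 0 ->
  \sum_(z : {ffun 'I_n -> Z}) (\prod_i r (z i)) * (\sum_i g (z i)) ^+ 2 =
  n%:R * \sum_z r z * g z ^+ 2.
Proof.
move=> r1 rg.
transitivity (\sum_(i < n) \sum_(j < n) \sum_(z : {ffun 'I_n -> Z})
   \prod_k (r (z k) * ((if k == i then g (z k) else 1) * (if k == j then g (z k) else 1)))).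
  rewrite [RHS](eq_bigr (fun i => \sum_(z : {ffun 'I_n -> Z}) \sum_(j < n) (\prod_(k < n) r (z k)) * (g (z i) * g (z j)))).
    rewrite exchange_big; apply: eq_bigr => z _ /=.
    rewrite expr2 mulr_suml mulr_sumr; apply: eq_bigr => i _.
    by rewrite mulr_sumr mulr_sumr.
  move=> i _; rewrite exchange_big; apply: eq_bigr => z _ /=; apply: eq_bigr => j _.
  rewrite !big_split /=; congr (_ * (_ * _)).
    by rewrite (bigD1 i) //= eqxx big1 ?mulr1 // => k /negPf ->.
  by rewrite (bigD1 j) //= eqxx big1 ?mulr1 // => k /negPf ->.
have -> : n%:R * \sum_z r z * g z ^+ 2 = \sum_(i < n) \sum_z r z * g z ^+ 2.
  by rewrite sum_cst card_ord.
apply: eq_bigr => i _; rewrite (bigD1 i) //= [X in _ + X]big1 ?addr0.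
  rewrite -(bigA_distr_bigA (fun k z => r z * ((if k == i then g z else 1) * (if k == i then g z else 1)))).
  rewrite (bigD1 i) //= eqxx [X in _ * X]big1 ?mulr1; last first.
    by move=> k /negPf ->; rewrite -[RHS]r1; apply: eq_bigr => z _; rewrite !mulr1.
  by apply: eq_bigr => z _; rewrite expr2.
move=> j /negPf ji.
rewrite -(bigA_distr_bigA (fun k z => r z * ((if k == i then g z else 1) * (if k == j then g z else 1)))).
rewrite (bigD1 i) //= eqxx eq_sym ji; under eq_bigr do rewrite mulr1.
by rewrite rg mul0r.
Qed.

(** Chebyshev's inequality for an event that only has to imply an upward deviation; a sign put into
    [h] provides the other tail. *)
Lemma iid_tail (Z : finType) (n : nat) (r h : Z -> R) (d : R) (c : pred {ffun 'I_n -> Z}) :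
  (0 < n)%N -> 0 < d -> (forall z, 0 <= r z) -> \sum_z r z = 1 ->
  (forall z, c z -> n%:R * d <= \sum_i (h (z i) - \sum_y r y * h y)) ->
  \sum_(z | c z) \prod_i r (z i) <=
  (\sum_z r z * (h z - \sum_y r y * h y) ^+ 2) / (n%:R * d ^+ 2).
Proof.
move=> n0 d0 r0 r1 hc; set mu := \sum_y r y * h y in hc *.
have nR : (0 : R) < n%:R by rewrite ltr0n.
have g0 : \sum_z r z * (h z - mu) = 0.
  under eq_bigr do rewrite mulrBr.
  by rewrite sumrB -mulr_suml r1 mul1r subrr.
have nd : 0 < (n%:R * d) ^+ 2 by rewrite exprn_gt0 // mulr_gt0.
have V := iid_variance n r1 g0.
have P0 (z : {ffun 'I_n -> Z}) : 0 <= \prod_i r (z i) by apply: prodr_ge0.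
rewrite -(ler_pM2l nd).
apply: le_trans (_ : \sum_(z : {ffun 'I_n -> Z}) (\prod_i r (z i)) * (\sum_i (h (z i) - mu)) ^+ 2 <= _).
  rewrite mulr_sumr [X in _ <= X](bigID c) /= -[X in X <= _]addr0; apply: lerD.
    apply: ler_sum => z cz; rewrite mulrC ler_wpM2l //.
    have h1 := hc z cz; have h2 : 0 <= n%:R * d by rewrite mulr_ge0 // ltW.
    by rewrite ler_pXn2r // nnegrE (le_trans h2).
  by apply: sumr_ge0 => z _; rewrite mulr_ge0 ?sqr_ge0.
rewrite V; apply: eq_ler.
by field; rewrite ?gt_eqF.
Qed.

End Typicality.

Section PairSlices.
Variables (J : finType) (n : nat) (B : J -> finType) (T : finType).
Local Notation X1 := {dffun forall j, B j}.
Local Notation Xn := {dffun forall j, {ffun 'I_n -> B j}}.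

Definition pslices (x : Xn) (k : {ffun 'I_n -> T}) : {ffun 'I_n -> X1 * T} :=
  [ffun a => (slice x a, k a)].

Lemma pslices_sum (V : nmodType) (F : {ffun 'I_n -> X1 * T} -> V) (c : pred {ffun 'I_n -> X1 * T}) :
  \sum_x \sum_(k | c (pslices x k)) F (pslices x k) = \sum_(z | c z) F z.
Proof.
rewrite pair_big_dep /= (reindex (fun p : Xn * {ffun 'I_n -> T} => pslices p.1 p.2)) //=.
apply: onW_bij; exists (fun z : {ffun 'I_n -> X1 * T} =>
   (unslices [ffun a => (z a).1], [ffun a => (z a).2])).
  move=> [x k]; congr (_, _) => /=.
    by rewrite -[RHS]slicesK; congr unslices; apply/ffunP => a; rewrite !ffunE.
  by apply/ffunP => a; rewrite !ffunE.
move=> z /=; apply/ffunP => a; rewrite !ffunE [RHS]surjective_pairing; congr (_, _).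
have := unslicesK [ffun a => (z a).1] => /ffunP/(_ a).
by rewrite !ffunE.
Qed.

End PairSlices.

(** * Spectra of the blocks, their n-fold products and equipartition *)

Section Family.
Variable R : realType.
Local Notation C := (R[i]).
Variables (m : nat) (A : 'I_m -> finType) (T : finType).
Local Notation X := {dffun forall j : 'I_m, A j}.
Implicit Types (S : {set 'I_m}) (x y : X) (k l : T).
Local Notation full := [set: 'I_m].

(* The block at [x] of the marginal on [X_S] and the system. *)
Definition omA (om : X -> Op R T) S x : Op R T :=
  fun i j => \sum_(y | S \subset agree x y) om y i j.

(** Eigenbases are a choice; the fourth clause makes it depend only on the class of [x] modulo
    agreement on [S]. In particular the empty set carries a single basis, that of the total state of
    the system. *)
Definition spectral_family (om : X -> Op R T) (f : {set 'I_m} -> X -> T -> T -> C)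
    (q : {set 'I_m} -> X -> T -> R) : Prop :=
  [/\ forall S x k l, ip (f S x k) (f S x l) = (k == l)%:R,
      forall S x k, 0 <= q S x k,
      forall S x i j, omA om S x i j = \sum_k rc (q S x k) * f S x k i * (f S x k j)^*,
      forall S x y, S \subset agree x y -> f S x = f S y /\ q S x = q S y &
      \sum_x \sum_k q full x k = 1].

Lemma omA_full om x : omA om full x = om x.
Proof.
apply/funext => i; apply/funext => j; rewrite /omA (big_pred1 x) // => y /=.
by rewrite agree_setT eq_sym.
Qed.

Lemma exists_family (om : X -> Op R T) : (forall x, psd (om x)) ->
  \sum_x tr (om x) = 1 -> exists f q, spectral_family om f q.
Proof.
move=> pom tom.
have pA S x : psd (omA om S x).
  move=> v; rewrite -/(quad _ _) quad_sum; apply: sumr_ge0 => y _; exact: pom.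
(* The decomposition is chosen as a function of the operator alone, so equal blocks receive equal
   bases. *)
have spX (Y : Op R T) : exists p, psd Y -> is_spec Y p.
  have [pY|nY] := pselect (psd Y).
    by have [p hp] := hermitian_spec (psd_hermitian pY); exists p.
  by exists (fun _ _ => 0, fun=> 0).
have [sp spP] := boolp.choice spX.
exists (fun S x k t => (sp (omA om S x)).1 t k), (fun S x => (sp (omA om S x)).2).
have hs S x := spP _ (pA S x).
split.
- by move=> S x k l; exact: (ip_col _ _ (hs S x).1).
- by move=> S x k; exact: (spec_ge0 _ (pA S x) (hs S x)).
- move=> S x i j; rewrite (hs S x).2; apply: eq_bigr => k _.
  by rewrite [_ * rc _]mulrC.
- move=> S x y Sxy; suff -> : omA om S x = omA om S y by [].
  apply/funext => i; apply/funext => j; apply: eq_bigl => z.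
  apply/idP/idP; last exact: agree_trans.
  by apply: agree_trans; rewrite agreeC.
- apply: rc_inj; rewrite rc1 -tom rc_sum; apply: eq_bigr => x _.
  by rewrite -(tr_spec (hs full x)) omA_full.
Qed.

Variables (om : X -> Op R T) (f : {set 'I_m} -> X -> T -> T -> C) (q : {set 'I_m} -> X -> T -> R).
Hypothesis sf : spectral_family om f q.

Lemma f_orth S x k l : ip (f S x k) (f S x l) = (k == l)%:R.
Proof. by case: sf. Qed.
Lemma q_ge0 S x k : 0 <= q S x k. Proof. by case: sf. Qed.
Lemma q_sum1 : \sum_x \sum_k q full x k = 1. Proof. by case: sf. Qed.
Lemma vn_f S x k : vn (f S x k) = 1.
Proof. by apply: rc_inj; rewrite rc_vn f_orth eqxx. Qed.

Lemma om_q x i j : om x i j = \sum_k rc (q full x k) * f full x k i * (f full x k j)^*.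
Proof. by case: sf => _ _ h _ _; rewrite -h omA_full. Qed.

Lemma quad_omA S x v :
  quad (omA om S x) v = rc (\sum_k q S x k * n2 (ip (f S x k) v)).
Proof.
have E : omA om S x = fun i j => \sum_k rc (q S x k) * (f S x k i * (f S x k j)^*).
  apply/funext => i; apply/funext => j; case: sf => _ _ -> _ _.
  by apply: eq_bigr => k _; rewrite mulrA.
by rewrite E quad_sum rc_sum; apply: eq_bigr => k _; rewrite quadZ quad_rank1 rcM.
Qed.

Lemma quad_om_q x v : quad (om x) v = rc (\sum_k q full x k * n2 (ip (f full x k) v)).
Proof. by rewrite -(omA_full om x) quad_omA. Qed.

Lemma quad_omA_sum S x v :
  \sum_(y | S \subset agree x y) \sum_k q full y k * n2 (ip (f full y k) v) =
  \sum_k q S x k * n2 (ip (f S x k) v).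
Proof.
apply: rc_inj; rewrite -quad_omA /omA quad_sum rc_sum; apply: eq_bigr => y _.
by rewrite -quad_om_q.
Qed.

(* The law of the outcome when [om x] is measured in the eigenbasis of its [S]-block. *)
Definition rw S x k : R := \sum_l q full x l * n2 (ip (f full x l) (f S x k)).

Lemma rw_ge0 S x k : 0 <= rw S x k.
Proof. by apply: sumr_ge0 => l _; rewrite mulr_ge0 ?q_ge0 ?n2_ge0. Qed.

(** [om x] is one of the positive terms that make up the block, so its diagonal entry is at most the
    eigenvalue of the block. *)
Lemma rw_le S x k : rw S x k <= q S x k.
Proof.
have := quad_omA_sum S x (f S x k).
rewrite [X in _ = X](bigD1 k) //= f_orth eqxx (n2_bool R true) mulr1 [X in _ + X]big1 ?addr0; last first.
  by move=> l /negPf lk; rewrite f_orth lk n2_0 mulr0.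
move=> <-; rewrite (bigD1 x) /=; last by rewrite agreexx finset.subsetT.
rewrite lerDl; apply: sumr_ge0 => y _; apply: sumr_ge0 => l _.
by rewrite mulr_ge0 ?q_ge0 ?n2_ge0.
Qed.

Lemma rw_full x k : rw full x k = q full x k.
Proof.
rewrite /rw (bigD1 k) //= f_orth eqxx (n2_bool R true) mulr1 big1 ?addr0 // => l /negPf lk.
by rewrite f_orth lk n2_0 mulr0.
Qed.

Lemma rw_sum S x : \sum_k rw S x k = \sum_k q full x k.
Proof.
rewrite /rw exchange_big; apply: eq_bigr => l _ /=.
rewrite -mulr_sumr; under eq_bigr do rewrite n2_ipC.
by rewrite b_parseval ?vn_f ?mulr1 // => a b; exact: f_orth.
Qed.

Lemma rw_sum1 S : \sum_x \sum_k rw S x k = 1.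
Proof. by rewrite -q_sum1; apply: eq_bigr => x _; exact: rw_sum. Qed.

Lemma tr_omA S x : tr (omA om S x) = rc (\sum_k q S x k).
Proof.
case: sf => _ _ h _ _; rewrite /tr rc_sum; under eq_bigr do rewrite h.
rewrite exchange_big; apply: eq_bigr => k _ /=.
rewrite -[RHS]mulr1 -(rc1 R) -(vn_f S x k) rc_vn /ip mulr_sumr.
by apply: eq_bigr => i _; ring.
Qed.

Lemma tr_family x : tr (om x) = rc (\sum_k q full x k).
Proof. by rewrite -tr_omA omA_full. Qed.

Lemma tr_family1 : \sum_x tr (om x) = 1.
Proof. by under eq_bigr do rewrite tr_family; rewrite -rc_sum q_sum1. Qed.

Lemma pairing_family x (D : Op R T) :
  \sum_b \sum_b' om x b b' * D b' b = \sum_k rc (q full x k) * quad D (f full x k).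
Proof.
transitivity (\sum_b \sum_b' \sum_k rc (q full x k) * ((f full x k b')^* * D b' b * f full x k b)).
  apply: eq_bigr => b _; apply: eq_bigr => b' _; rewrite om_q mulr_suml.
  by apply: eq_bigr => k _; ring.
rewrite exchange_big /=; under eq_bigr do rewrite exchange_big /=.
rewrite exchange_big; apply: eq_bigr => k _ /=; rewrite /quad mulr_sumr.
by apply: eq_bigr => b _; rewrite mulr_sumr.
Qed.

Lemma q_sum_le1 S x : \sum_k q S x k <= 1.
Proof.
have -> : \sum_k q S x k = \sum_(y | S \subset agree x y) \sum_k q full y k.
  apply: rc_inj; rewrite -tr_omA rc_sum /tr /omA exchange_big.
  by apply: eq_bigr => y _ /=; rewrite -tr_family.
rewrite -q_sum1 [X in _ <= X](bigID (fun y => S \subset agree x y)) /= lerDl.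
by apply: sumr_ge0 => y _; apply: sumr_ge0 => k _; exact: q_ge0.
Qed.

End Family.

Lemma forall_prodr (V : pzSemiRingType) (I : finType) (P : pred I) :
  ([forall a, P a])%:R = \prod_a (P a)%:R :> V.
Proof.
case: (boolP [forall a, P a]) => [/forallP h|].
  by rewrite big1 // => a _; rewrite h.
rewrite negb_forall => /existsP[a /negPf h].
(* The ring need not be commutative, so the vanishing factor is met by induction along the list. *)
apply/esym; have : a \in index_enum I by rewrite mem_index_enum.
elim: (index_enum I) => // b s IH; rewrite big_cons in_cons => /orP[/eqP <-|/IH ->].
  by rewrite h mul0r.
by rewrite mulr0.
Qed.

Section ProductFamily.
Variable R : realType.
Local Notation C := (R[i]).
Variables (m : nat) (B : 'I_m -> finType) (T : finType) (n : nat).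
Local Notation X1 := {dffun forall j : 'I_m, B j}.
Local Notation Xn := {dffun forall j : 'I_m, {ffun 'I_n -> B j}}.
Local Notation Tn := {ffun 'I_n -> T}.
Local Notation full := [set: 'I_m].
Variables (om : X1 -> Op R T) (f : {set 'I_m} -> X1 -> T -> T -> C) (q : {set 'I_m} -> X1 -> T -> R).
Hypothesis sf : spectral_family om f q.

Definition om_n (x : Xn) : Op R Tn := fun i j => \prod_a om (slice x a) (i a) (j a).
Definition f_n (S : {set 'I_m}) (x : Xn) (k t : Tn) : C :=
  \prod_a f S (slice x a) (k a) (t a).
Definition q_n (S : {set 'I_m}) (x : Xn) (k : Tn) : R := \prod_a q S (slice x a) (k a).

Lemma ip_prod (u v : 'I_n -> T -> C) :
  ip (fun t : Tn => \prod_a u a (t a)) (fun t : Tn => \prod_a v a (t a)) =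
  \prod_a ip (u a) (v a).
Proof.
rewrite /ip bigA_distr_bigA; apply: eq_bigr => t _.
by rewrite conj_prod -big_split.
Qed.

Lemma agree_slice (S : {set 'I_m}) (x y : Xn) :
  (S \subset agree x y) = [forall a, S \subset agree (slice x a) (slice y a)].
Proof.
apply/idP/forallP => [/fintype.subsetP h a|h].
  by apply/fintype.subsetP => j jS; have := h j jS; rewrite !inE !ffunE => /eqP ->.
apply/fintype.subsetP => j jS; rewrite inE; apply/eqP/ffunP => a.
by have /fintype.subsetP/(_ j jS) := h a; rewrite !inE !ffunE => /eqP.
Qed.

Lemma omA_n (S : {set 'I_m}) x i j :
  omA om_n S x i j = \prod_a omA om S (slice x a) (i a) (j a).
Proof.
rewrite /omA; transitivity (\sum_(y : Xn) \prod_a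
    ((S \subset agree (slice x a) (slice y a))%:R * om (slice y a) (i a) (j a))).
  rewrite big_mkcond; apply: eq_bigr => y _; rewrite big_split /= -forall_prodr -agree_slice.
  by case: ifP; rewrite ?mul1r ?mul0r.
rewrite (slice_distr (fun a z => (S \subset agree (slice x a) z)%:R * om z (i a) (j a))).
apply: eq_bigr => a _; rewrite [RHS]big_mkcond; apply: eq_bigr => y _.
by case: ifP; rewrite ?mul1r ?mul0r.
Qed.

Lemma product_family : spectral_family om_n f_n q_n.
Proof.
case: sf => o q0 hA hd q1; split.
- move=> S x k l.
  transitivity (\prod_a ip (f S (slice x a) (k a)) (f S (slice x a) (l a))).
    exact: ip_prod.
  under eq_bigr do rewrite o.
  rewrite -(forall_prodr _ (fun a => k a == l a)); congr (nat_of_bool _)%:R.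
  apply/forallP/eqP => [h|->//]; by apply/ffunP => a; apply/eqP.
- by move=> S x k; apply: prodr_ge0.
- move=> S x i j; rewrite omA_n; under eq_bigr do rewrite hA.
  rewrite bigA_distr_bigA; apply: eq_bigr => k _.
  by rewrite /f_n /q_n rc_prod conj_prod -!big_split.
- move=> S x y; rewrite agree_slice => /forallP h; split; apply/funext => k.
    by apply/funext => t; apply: eq_bigr => a _; rewrite (hd _ _ _ (h a)).1.
  by apply: eq_bigr => a _; rewrite (hd _ _ _ (h a)).2.
- transitivity (\sum_(x : Xn) \prod_a \sum_k q full (slice x a) k).
    by apply: eq_bigr => x _; rewrite bigA_distr_bigA.
  by rewrite (slice_distr (fun a x => \sum_k q full x k)) big1.
Qed.

Lemma rw_n S x k : rw f_n q_n S x k = \prod_a rw f q S (slice x a) (k a).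
Proof.
rewrite /rw bigA_distr_bigA; apply: eq_bigr => l _.
rewrite /q_n big_split /=; congr (_ * _).
have n2_prod (z : 'I_n -> C) : n2 (\prod_a z a) = \prod_a n2 (z a).
  elim/big_rec2: _ => [|a y1 y2 _ <-]; first exact: (n2_bool R true).
  by rewrite n2M.
by rewrite -n2_prod -ip_prod.
Qed.

(** The entropy in nats of the marginal on [X_S] and the system, written as an expectation over
    pairs [(x, k)]: summed over a class, the weights [rw] add up to the eigenvalue [q]. *)
Definition ent (S : {set 'I_m}) : R := - \sum_x \sum_k rw f q S x k * ln (q S x k).

(** Positive probability forces every factor [q] to be positive. Without this the logarithm of the
    product need not split, since [ln 0] is only a default value. *)
Lemma q_n_ln S x k : 0 < rw f_n q_n S x k ->
  0 < q_n S x k /\ ln (q_n S x k) = \sum_a ln (q S (slice x a) (k a)).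
Proof.
rewrite rw_n => h.
have qp a : 0 < q S (slice x a) (k a).
  rewrite lt_neqAle (q_ge0 sf) andbT eq_sym; apply: contraTneq h => q0.
  have : rw f q S (slice x a) (k a) = 0.
    by apply/eqP; rewrite eq_le (rw_ge0 sf) andbT -q0 (rw_le sf).
  by rewrite (bigD1 a) //= => ->; rewrite mul0r ltxx.
rewrite /q_n; elim/big_rec2: _ => [|a y z _ [h1 h2]]; first by rewrite ltr01 ln1.
by split; [exact: mulr_gt0 | rewrite lnM ?posrE // h2].
Qed.

Definition lvar (S : {set 'I_m}) : R :=
  \sum_x \sum_k rw f q S x k * (ln (q S x k) + ent S) ^+ 2.

(** Measuring each position in its block basis makes the pairs (slice, outcome) independent with law
    [rw]. The sign [sg] lets one proof serve both tails. *)
Lemma aep_tail S (d sg : R) (c : Xn -> pred Tn) : (0 < n)%N -> 0 < d -> sg ^+ 2 = 1 ->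
  (forall x k, c x k -> 0 < rw f_n q_n S x k ->
     n%:R * d <= sg * (ln (q_n S x k) + n%:R * ent S)) ->
  \sum_x \sum_(k | c x k) rw f_n q_n S x k <= lvar S / (n%:R * d ^+ 2).
Proof.
move=> n0 d0 sg1 hc.
pose r (z : X1 * T) := rw f q S z.1 z.2.
pose h (z : X1 * T) := sg * ln (q S z.1 z.2).
have r0 z : 0 <= r z by exact: (rw_ge0 sf).
have r1 : \sum_z r z = 1.
  transitivity (\sum_x \sum_k rw f q S x k); last exact: (rw_sum1 sf S).
  by rewrite [RHS]pair_bigA; apply: eq_bigr.
have mu : \sum_z r z * h z = - (sg * ent S).
  rewrite /ent mulrN opprK pair_bigA /= mulr_sumr; apply: eq_bigr => -[x k] _.
  by rewrite /r /h /= mulrCA.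
pose c' (z : {ffun 'I_n -> X1 * T}) :=
  (0 < \prod_a r (z a)) && (n%:R * d <= \sum_a (h (z a) - \sum_y r y * h y)).
have := @iid_tail R _ n r h d c' n0 d0 r0 r1.
have -> : \sum_z r z * (h z - \sum_y r y * h y) ^+ 2 = lvar S.
  rewrite mu /lvar pair_bigA /=; apply: eq_bigr => -[x k] _.
  rewrite opprK /h /r /= -mulrDr exprMn sg1 mul1r; congr (_ * _ ^+ 2).
move=> /(_ (fun z hz => (andP hz).2)); apply: le_trans.
rewrite -(pslices_sum (fun z => \prod_a r (z a)) c').
apply: ler_sum => x _; rewrite [X in X <= _]big_mkcond [X in _ <= X]big_mkcond.
apply: ler_sum => k _.
have E : \prod_a r (pslices x k a) = rw f_n q_n S x k.
  by rewrite rw_n; apply: eq_bigr => a _; rewrite ffunE.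
rewrite /c' E; have [rp|rn] := ltP 0 (rw f_n q_n S x k); last first.
  rewrite andFb; case: ifP => // _; exact: rn.
case: ifP => cx; last by case: ifP => // _; exact: ltW.
rewrite ifT // andTb; apply: le_trans (hc _ _ cx rp) _.
rewrite (q_n_ln rp).2 mu sumrB sum_cst card_ord; apply: eq_ler.
have -> : \sum_i h (pslices x k i) = sg * \sum_a ln (q S (slice x a) (k a)).
  by rewrite mulr_sumr; apply: eq_bigr => a _; rewrite ffunE.
ring.
Qed.

Lemma aep_low S (d : R) : (0 < n)%N -> 0 < d ->
  \sum_x \sum_(k | expR (- (n%:R * (ent S - d))) < q_n S x k) rw f_n q_n S x k <=
  lvar S / (n%:R * d ^+ 2).
Proof.
move=> n0 d0; apply: (@aep_tail S d 1) => //; first by rewrite expr1n.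
move=> x k h /q_n_ln[qp _]; rewrite mul1r.
have : - (n%:R * (ent S - d)) < ln (q_n S x k) by rewrite -ltr_expR lnK.
lra.
Qed.

Lemma aep_high S (d : R) : (0 < n)%N -> 0 < d ->
  \sum_x \sum_(k | q_n S x k < expR (- (n%:R * (ent S + d)))) rw f_n q_n S x k <=
  lvar S / (n%:R * d ^+ 2).
Proof.
move=> n0 d0; apply: (@aep_tail S d (-1)) => //; first by rewrite sqrrN expr1n.
move=> x k h /q_n_ln[qp _]; rewrite mulN1r.
have : ln (q_n S x k) < - (n%:R * (ent S + d)) by rewrite -ltr_expR lnK.
lra.
Qed.

End ProductFamily.

(** * Random binning *)

Section RandomBinning.
Variable R : realType.
Local Notation C := (R[i]).
Local Notation Re := (@complex.Re R).
Variables (m : nat) (A : 'I_m -> finType) (T : finType).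
Local Notation X := {dffun forall j : 'I_m, A j}.
Local Notation full := [set: 'I_m].
Local Notation M := (#|{set 'I_m}|%:R : R).
Variables (om : X -> Op R T) (f : {set 'I_m} -> X -> T -> T -> C) (q : {set 'I_m} -> X -> T -> R).
Hypothesis sf : spectral_family om f q.
Variables (N : 'I_m -> nat) (j : 'I_m) (theta : {set 'I_m} -> R) (ty u : R).
Hypothesis N0 : forall i, (0 < N i)%N.
Hypothesis ty0 : 0 < ty.
Hypothesis u01 : 0 < u <= 1.
Hypothesis theta0 : forall S, 0 <= theta S.
Local Notation code := {dffun forall i : 'I_m, {ffun A i -> 'I_(N i)}}.
Local Notation label := {dffun forall i : 'I_m, 'I_(N i)}.
Implicit Types (S : {set 'I_m}) (x y : X) (k l : T) (F : code).

Definition enc F x : label := @finfun _ (fun i => 'I_(N i)) (fun i => F i (x i)).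
Definition typical x k := ty <= q full x k.
Definition big_ev S x : pred T := fun k => theta S < q S x k.
(** Player [j] knows its own string, so every competing candidate agrees with the truth at [j];
    agreement everywhere would be the same tuple. *)
Definition relevant S := (j \in S) && (S != full).
Definition wv S x k : T -> C :=
  fun t => (relevant S)%:R * proj (f S x) (big_ev S x) (f full x k) t.
Definition cand F (a : A j) (lab : label) : seq (X * T) :=
  [seq z <- enum {: X * T} | [&& typical z.1 z.2, z.1 j == a & enc F z.1 == lab]].
Definition resid S x k : T -> C := fun t => f full x k t - wv S x k t.
Definition clash F (z y : X * T) : R :=
  [&& typical y.1 y.2, y.1 j == z.1 j, enc F y.1 == enc F z.1 & y != z]%:R *
  n2 (ip (resid (agree y.1 z.1) y.1 y.2) (f full z.1 z.2)).

Definition atyp : R := \sum_x \sum_(k | ~~ typical x k) q full x k.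
Definition evict : R := \sum_(S | relevant S) \sum_x \sum_(k | big_ev S x k) rw f q S x k.
Definition confusion F : R := \sum_x \sum_k q full x k * \sum_y clash F (x, k) y.
Definition err F : R :=
  atyp + (8 + 18 * M) * u + (2 * M ^+ 2 * evict + 6 * confusion F) / u ^+ 3.

(** On average, the squared norm cut off by [W_S] is the probability that measuring in the
    eigenbasis of the [S]-block hits too large an eigenvalue. *)
Lemma wv_sum : \sum_x \sum_k q full x k * \sum_S vn (wv S x k) = evict.
Proof.
rewrite /evict; under eq_bigr do under eq_bigr do rewrite mulr_sumr.
under eq_bigr do rewrite exchange_big /=.
rewrite exchange_big [RHS]big_mkcond; apply: eq_bigr => S _ /=.
case: (boolP (relevant S)) => rS; last first.
  apply: big1 => x _; apply: big1 => k _.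
  by rewrite /wv (negPf rS) vnZ n2_0 mul0r mulr0.
apply: eq_bigr => x _.
under eq_bigr => k _.
  rewrite /wv rS vnZ (n2_bool R true) mul1r vn_proj; last by move=> a b; exact: (f_orth sf).
  rewrite mulr_sumr.
  over.
rewrite exchange_big; apply: eq_bigr => l _ /=.
by apply: eq_bigr => k _; rewrite n2_ipC.
Qed.

Lemma clash_ge0 F z (y : X * T) : 0 <= clash F z y.
Proof. by rewrite mulr_ge0 ?ler0n ?n2_ge0. Qed.

(** One instance of [decoder] for each string and label the player may see. An atypical pair is not
    on the list of candidates and is charged an error of at most 1. *)
Lemma decode_code (K : finType) (k0 : K) F (g : X -> K) :
  exists D : A j -> label -> K -> Op R T, (forall a lab, povm (D a lab)) /\
  \sum_x \sum_k q full x k * (1 - Re (quad (D (x j) (enc F x) (g x)) (f full x k))) <= err F.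
Proof.
have uz a lab : uniq (cand F a lab) by rewrite filter_uniq ?enum_uniq.
have e_orth x k l : ip (f full x k) (f full x l) = (k == l)%:R by exact: (f_orth sf).
have ex (p : A j * label) := decoder k0 wv g e_orth u01 (uz p.1 p.2).
have [D hD] := boolp.choice ex.
exists (fun a lab => D (a, lab)); split=> [a lab|]; first by case: (hD (a, lab)).
have u0 : 0 < u by case/andP: u01.
have u30 : 0 <= (u ^+ 3)^-1 by rewrite invr_ge0 exprn_ge0 // ltW.
have pt x k : 1 - Re (quad (D (x j, enc F x) (g x)) (f full x k)) <=
   (~~ typical x k)%:R + ((8 + 18 * M) * u +
   (2 * M ^+ 2 * (\sum_S vn (wv S x k)) + 6 * \sum_y clash F (x, k) y) / u ^+ 3).
  have r0 : 0 <= (8 + 18 * M) * u + (2 * M ^+ 2 * (\sum_S vn (wv S x k)) + 6 * \sum_y clash F (x, k) y) / u ^+ 3.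
    rewrite addr_ge0 ?mulr_ge0 ?addr_ge0 ?mulr_ge0 ?exprn_ge0 ?ler0n //; try exact: ltW.
      by apply: sumr_ge0 => S _; exact: vn_ge0.
    by apply: sumr_ge0 => y _; exact: clash_ge0.
  case: (boolP (typical x k)) => tx /=; last first.
    rewrite -[X in X <= _]addr0 lerD // lerBlDr lerDl.
    have [[pD _] _] := hD (x j, enc F x).
    by have /le_Re := pD (g x) (f full x k).
  rewrite add0r; have [_ /(_ (x, k)) h] := hD (x j, enc F x).
  apply: le_trans (h _) _.
    by rewrite mem_filter mem_enum /= tx !eqxx.
  rewrite lerD2l ler_wpM2r // lerD2l ler_pM2l //.
  rewrite /cand big_filter_cond big_enum_cond /= big_mkcond /=.
  apply: ler_sum => y _; rewrite /clash /= -!andbA.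
  by case: ifP => _; rewrite ?mul1r ?mul0r.
apply: le_trans (_ : \sum_x \sum_k q full x k * ((~~ typical x k)%:R + ((8 + 18 * M) * u +
   (2 * M ^+ 2 * (\sum_S vn (wv S x k)) + 6 * \sum_y clash F (x, k) y) / u ^+ 3)) <= _).
  by apply: ler_sum => x _; apply: ler_sum => k _; rewrite ler_wpM2l ?(q_ge0 sf).
have -> : err F = atyp + (\sum_x \sum_k q full x k) * ((8 + 18 * M) * u) +
    (2 * M ^+ 2 * evict + 6 * confusion F) / u ^+ 3.
  by rewrite (q_sum1 sf) mul1r.
rewrite -wv_sum /confusion /atyp !mulr_sumr mulr_suml -!big_split mulr_suml -big_split.
apply: ler_sum => x _ /=; rewrite !mulr_sumr mulr_suml -!big_split mulr_suml.
rewrite [X in _ <= X + _ + _]big_mkcond -!big_split; apply: ler_sum => k _ /=.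
apply: eq_ler.
by case: (typical x k) => /=; ring.
Qed.

Lemma typical_count : \sum_(z : X * T) (typical z.1 z.2)%:R <= ty^-1.
Proof.
rewrite -[X in _ <= X]mul1r ler_pdivlMr //.
apply: le_trans (_ : \sum_x \sum_k q full x k <= _); last by rewrite (q_sum1 sf).
rewrite pair_bigA mulr_suml /=; apply: ler_sum => z _; rewrite /typical.
by case: (leP ty (q full z.1 z.2)) => h; rewrite ?mul1r ?mul0r ?(q_ge0 sf).
Qed.

(** The left side is the expectation of the [S]-block in the residual vector, which has no component
    on eigenvalues above [theta S]. *)
Lemma resid_bound S y l : relevant S ->
  \sum_k q S y k * n2 (ip (f S y k) (resid S y l)) <= theta S.
Proof.
move=> rS; have o a b : ip (f S y a) (f S y b) = (a == b)%:R by exact: (f_orth sf).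
have E k : ip (f S y k) (resid S y l) = (~~ big_ev S y k)%:R * ip (f S y k) (f full y l).
  rewrite -(ip_b_sub_proj o); congr ip; apply/funext => t.
  by rewrite /resid /wv rS mul1r.
apply: le_trans (_ : \sum_k theta S * n2 (ip (f S y k) (f full y l)) <= _).
  apply: ler_sum => k _; rewrite E n2M n2_bool /big_ev; case: ltP => h /=.
    by rewrite mul0r mulr0 mulr_ge0 ?n2_ge0.
  by rewrite mul1r ler_wpM2r ?n2_ge0.
by rewrite -mulr_sumr (b_parseval o) (vn_f sf) mulr1.
Qed.

(** The bins contribute the collision probability, the residual contributes [theta S], and [1 / ty]
    counts the typical candidates. Agreement exactly on [S] is relaxed to agreement at least on [S],
    so that the sum over the true tuples assembles the whole block. *)
Lemma confusion_avg : avg confusion <=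
  (\sum_(S | relevant S) theta S * \prod_(i in ~: S) (N i)%:R^-1) / ty.
Proof.
pose w S : R := \prod_(i in ~: S) (N i)%:R^-1.
have w0 S : 0 <= w S by apply: prodr_ge0 => i _; rewrite invr_ge0 ler0n.
pose t (z y : X * T) S := (typical y.1 y.2)%:R * ((S \subset agree y.1 z.1)%:R *
  (w S * n2 (ip (resid S y.1 y.2) (f full z.1 z.2)))).
have t0 z (y : X * T) S : 0 <= t z y S by rewrite !mulr_ge0 ?ler0n ?n2_ge0.
have ac z (y : X * T) : avg (fun F => clash F z y) <= \sum_(S | relevant S) t z y S.
  case: (boolP [&& typical y.1 y.2, y.1 j == z.1 j & y != z]) => [/and3P[ty1 yj yz]|h]; last first.
    rewrite (@eq_avg _ _ _ (fun=> 0)); last first.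
      move=> F; rewrite /clash; move: h; case: typical => //=; rewrite ?mul0r //.
      by case: (_ == _) => //=; rewrite ?mul0r //; case: (y != z); rewrite ?andbF ?mul0r.
    by rewrite /avg big1 // mul0r sumr_ge0.
  rewrite (@eq_avg _ _ _ (fun F => n2 (ip (resid (agree y.1 z.1) y.1 y.2) (f full z.1 z.2)) *
      ([forall i, F i (y.1 i) == F i (z.1 i)])%:R)); last first.
    move=> F; rewrite /clash ty1 yj yz /= andbT mulrC; congr (_ * (nat_of_bool _)%:R).
    apply/eqP/forallP => [/ffunP h i|h]; first by have := h i; rewrite !ffunE => ->.
    by apply/ffunP => i; rewrite !ffunE; apply/eqP.
  rewrite avgZ (@avg_codes R m A N _ y.1 z.1 N0 erefl) -/(w _).
  (* The tuples are equal and the eigenvectors differ. Nothing is cut off for the full set, so the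
     overlap is that of two orthogonal eigenvectors. *)
  have [E|ne] := eqVneq (agree y.1 z.1) full.
    have xy : y.1 = z.1 by apply/eqP; rewrite -agree_setT E.
    suff -> : ip (resid (agree y.1 z.1) y.1 y.2) (f full z.1 z.2) = 0.
      by rewrite n2_0 mul0r sumr_ge0.
    rewrite E ip_subl -xy (f_orth sf) /wv ip_Zl /relevant eqxx andbF conj0 mul0r subr0.
    case: eqP => // kl; case/negP: yz; move: xy kl; clear.
    by case: y z => [a b] [c d] /= -> ->.
  have rS : relevant (agree y.1 z.1) by rewrite /relevant ne inE yj.
  rewrite (bigD1 (agree y.1 z.1)) //= -[X in X <= _]addr0 lerD ?sumr_ge0 //.
  by rewrite /t ty1 fintype.subxx !mul1r mulrC.
rewrite /confusion avg_sum.
apply: le_trans (_ : \sum_x \sum_k q full x k * \sum_y \sum_(S | relevant S) t (x, k) y S <= _).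
  apply: ler_sum => x _; rewrite avg_sum; apply: ler_sum => k _.
  rewrite avgZ avg_sum ler_wpM2l ?(q_ge0 sf) //.
  by apply: ler_sum => y _; exact: ac.
(* The sums are exchanged: for a fixed candidate [y], the true pairs that agree with [y] on [S]
   build up the [S]-block at [y], to which [resid_bound] applies. *)
apply: le_trans (_ : \sum_(S | relevant S) \sum_(y : X * T) (typical y.1 y.2)%:R * (w S * theta S) <= _).
  under eq_bigr do under eq_bigr do rewrite mulr_sumr.
  under eq_bigr do rewrite exchange_big /=.
  rewrite exchange_big /=.
  under eq_bigr do under eq_bigr do under eq_bigr do rewrite mulr_sumr.
  under eq_bigr do under eq_bigr do rewrite exchange_big /=.
  under eq_bigr do rewrite exchange_big /=.
  rewrite exchange_big /=; apply: ler_sum => S rS; apply: ler_sum => y _.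
  apply: le_trans (_ : (typical y.1 y.2)%:R * (w S * \sum_(x | S \subset agree y.1 x)
     \sum_k q full x k * n2 (ip (f full x k) (resid S y.1 y.2))) <= _); last first.
    by rewrite (quad_omA_sum sf) ler_wpM2l ?ler0n // ler_wpM2l // resid_bound.
  rewrite [X in _ * (_ * X)]big_mkcond !mulr_sumr; apply: ler_sum => x _ /=.
  case: ifP => hS; last first.
    by rewrite big1 ?mulr0 // => k _; rewrite /t /= hS mul0r !mulr0.
  rewrite !mulr_sumr; apply: ler_sum => k _; rewrite /t /= hS n2_ipC.
  by rewrite mul1r mulrCA [X in _ <= _ * X]mulrCA.
rewrite mulr_suml; apply: ler_sum => S _; rewrite -mulr_suml mulrC -/(w S).
rewrite [theta S * _]mulrC ler_wpM2l ?typical_count // mulr_ge0 //.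
Qed.

End RandomBinning.

(** * Completely positive maps and the protocol *)

Section Psd.
Variable R : realType.
Local Notation C := (R[i]).
Local Notation Re := (@complex.Re R).
Implicit Types T S : finType.

Lemma psd_root T (X : Op R T) : psd X ->
  exists V : T -> T -> C, forall i j, X i j = \sum_y V y i * (V y j)^*.
Proof.
move=> pX; have [p hp] := hermitian_spec (psd_hermitian pX).
exists (fun k i => rc (Num.sqrt (p.2 k)) * p.1 i k) => i j.
rewrite hp.2; apply: eq_bigr => k _.
rewrite conjM conj_rc -{1}(sqr_sqrtr (spec_ge0 k pX hp)) expr2 rcM; ring.
Qed.

Lemma psd_gram T (Y : finType) (X : Op R T) (V : Y -> T -> C) :
  (forall i j, X i j = \sum_y V y i * (V y j)^*) -> psd X.
Proof.
move=> hX v; rewrite -/(quad X v).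
have -> : X = fun i j => \sum_y V y i * (V y j)^*.
  by apply/funext => i; apply/funext => j.
rewrite quad_sum; apply: sumr_ge0 => y _.
by rewrite quad_rank1 -(rc0 R) le_rc n2_ge0.
Qed.

Lemma psd_pull T S (h : S -> T) (X : Op R T) : psd X -> psd (fun i j => X (h i) (h j)).
Proof.
by move=> /psd_root[V hV]; apply: (@psd_gram _ _ _ (fun y i => V y (h i))) => i j; exact: hV.
Qed.

Lemma psd_hadamard T (X Y : Op R T) : psd X -> psd Y -> psd (fun i j => X i j * Y i j).
Proof.
move=> /psd_root[V hV] /psd_root[W hW].
apply: (@psd_gram _ (T * T)%type _ (fun y i => V y.1 i * W y.2 i)) => i j.
rewrite hV hW big_distrl /=; under eq_bigr do rewrite big_distrr /=.
by rewrite pair_bigA; apply: eq_bigr => y _ /=; rewrite conjM; ring.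
Qed.

(** Compression by the all-ones vector on the summed index. *)
Lemma psd_contract T S (X : Op R (S * T)%type) : psd X ->
  psd (fun i j => \sum_a \sum_a' X (a, i) (a', j)).
Proof.
move=> /psd_root[V hV].
apply: (@psd_gram _ _ _ (fun y i => \sum_a V y (a, i))) => i j.
under eq_bigr do under eq_bigr do rewrite hV.
under eq_bigr do rewrite exchange_big /=.
rewrite exchange_big; apply: eq_bigr => y _ /=.
by rewrite conj_sum big_distrl; apply: eq_bigr => a _; rewrite big_distrr.
Qed.

Lemma psd_sum T (I : finType) (P : pred I) (X : I -> Op R T) :
  (forall k, P k -> psd (X k)) -> psd (fun i j => \sum_(k | P k) X k i j).
Proof.
move=> h v; rewrite -/(quad _ _) quad_sum; apply: sumr_ge0 => k Pk; exact: h.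
Qed.

Lemma psd_rank1 T (c : T -> C) : psd (fun i j => c i * (c j)^*).
Proof. by apply: (@psd_gram _ unit _ (fun _ => c)) => i j; rewrite big_const card_unit /= addr0. Qed.

Lemma psd_ind T (c : pred T) : psd (fun i j : T => (c i && c j)%:R : C).
Proof.
have := psd_rank1 (fun i => (c i)%:R : C); congr psd.
by apply/funext => i; apply/funext => j; rewrite conj_nat; case: (c i); case: (c j);
  rewrite ?mul1r ?mul0r.
Qed.

Lemma psd_eq T S (h : T -> S) : psd (fun i j : T => (h i == h j)%:R : C).
Proof.
apply: (@psd_gram _ S _ (fun y i => (h i == y)%:R)) => i j.
rewrite (bigD1 (h i)) //= eqxx conj_nat mul1r big1 ?addr0 1?eq_sym // => y /negPf.
by rewrite eq_sym => ->; rewrite mul0r.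
Qed.

Lemma psd_tensor (I : finType) (T : I -> finType) (X : forall j, Op R (T j)) :
  (forall j, psd (X j)) ->
  psd (fun p q : {dffun forall j, T j} => \prod_j X j (p j) (q j)).
Proof.
move=> pX.
pose V j := projT1 (cid (psd_root (pX j))).
have hV j i i' : X j i i' = \sum_y V j y i * (V j y i')^*.
  by rewrite /V; case: cid.
pose W (y p : {dffun forall j, T j}) : C := \prod_j V j (y j) (p j).
apply: (@psd_gram _ _ _ W) => p q; rewrite /W.
under eq_bigr do rewrite hV.
rewrite -(dffun_distr (fun j y => V j y (p j) * (V j y (q j))^*)).
by apply: eq_bigr => y _; rewrite conj_prod big_split.
Qed.

Lemma psd_conj T (X : Op R T) : psd X -> psd (fun i j => X j i).
Proof.
move=> /psd_root[V hV]; apply: (@psd_gram _ _ _ (fun y i => (V y i)^*)) => i j.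
by rewrite hV; apply: eq_bigr => y _; rewrite conjK mulrC.
Qed.

Lemma psd_diag_ge0 T (X : Op R T) i : psd X -> 0 <= X i i.
Proof.
move=> /psd_root[V ->]; apply: sumr_ge0 => y _.
by rewrite mulrC -rc_n2 -(rc0 R) le_rc n2_ge0.
Qed.

Lemma tr_ge0 T (X : Op R T) : psd X -> 0 <= tr X.
Proof. by move=> pX; apply: sumr_ge0 => i _; exact: psd_diag_ge0. Qed.

Definition choi (S S' : finType) (F : Map R S S') : Op R (S * S')%type :=
  fun p q => F (matunit R p.1 q.1) p.2 q.2.

(** The Choi matrix is the image of the unnormalised maximally entangled operator. The input is an
    ordinal because the ancilla in [completely_positive] is one and has to be a copy of it. *)
Lemma choi_psd (d : nat) (S' : finType) (F : Map R 'I_d S') :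
  completely_positive F -> psd (choi F).
Proof.
move=> [_ cp].
have pY : psd (fun p q : 'I_d * 'I_d => ((p.1 == p.2) && (q.1 == q.2))%:R : C).
  exact: (psd_ind (fun p : 'I_d * 'I_d => p.1 == p.2)).
have := psd_pull (fun p : 'I_d * S' => (p.2, p.1)) (cp d _ pY).
by [].
Qed.

Definition map_of_choi (S S' : finType) (Ch : Op R (S * S')%type) : Map R S S' :=
  fun Y b b' => \sum_a \sum_a' Y a a' * Ch (a, b) (a', b').

(** The amplified map is an entrywise product with the Choi matrix followed by a contraction of the
    input indices, and both operations preserve positivity. *)
Lemma cp_of_choi (S S' : finType) (Ch : Op R (S * S')%type) :
  psd Ch -> completely_positive (map_of_choi Ch).
Proof.
move=> pC; split=> [a X Y i j|r Y pY].
  rewrite /map_of_choi mulr_sumr -big_split; apply: eq_bigr => k _ /=.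
  by rewrite mulr_sumr -big_split; apply: eq_bigr => l _ /=; ring.
have p1 := psd_pull (fun z : S * (S' * 'I_r) => (z.1, z.2.2)) pY.
have p2 := psd_pull (fun z : S * (S' * 'I_r) => (z.1, z.2.1)) pC.
exact: (psd_contract (psd_hadamard p1 p2)).
Qed.

Lemma map_of_choi_unit (S S' : finType) (Ch : Op R (S * S')%type) a a' b b' :
  map_of_choi Ch (matunit R a a') b b' = Ch (a, b) (a', b').
Proof.
rewrite /map_of_choi (bigD1 a) //= [X in _ + X]big1 ?addr0; last first.
  by move=> c /negPf ca; apply: big1 => c' _; rewrite /matunit ca mul0r.
rewrite (bigD1 a') //= [X in _ + X]big1 ?addr0 /matunit ?eqxx ?mul1r // => c /negPf ca.
by rewrite ca andbF mul0r.
Qed.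

Lemma apply_multi_psd (m : nat) (S S' : 'I_m -> finType) (E : finType)
    (F : forall j, Map R (S j) (S' j)) (X : Op R ({dffun forall j, S j} * E)%type) :
  (forall j, psd (choi (F j))) -> psd X -> psd (apply_multi F X).
Proof.
move=> pF pX.
pose h (z : {dffun forall j, S j} * ({dffun forall j, S' j} * E)) :
    {dffun forall j, S j * S' j}%type :=
  @finfun _ (fun j => (S j * S' j)%type) (fun j => (z.1 j, z.2.1 j)).
have p1 := psd_pull (fun z : {dffun forall j, S j} * ({dffun forall j, S' j} * E) => (z.1, z.2.2)) pX.
have p2 := psd_pull h (psd_tensor pF).
have := psd_contract (psd_hadamard p1 p2); congr psd.
apply/funext => p; apply/funext => q; apply: eq_bigr => a _; apply: eq_bigr => a' _.
by congr (_ * _); apply: eq_bigr => j _; rewrite /choi /h !ffunE.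
Qed.

Lemma tnbD T (X Y : Op R T) b c : tnb X b -> tnb Y c -> tnb (fun i j => X i j + Y i j) (b + c).
Proof.
move=> hX hY U s hU hs; under eq_bigr do rewrite quadD raddfD mulrDr.
by rewrite big_split lerD ?hX ?hY.
Qed.

Lemma sum_quad T (X : Op R T) U : unitary U -> \sum_k quad X (U^~ k) = tr X.
Proof.
move=> hU; rewrite /quad exchange_big; apply: eq_bigr => i _ /=.
rewrite exchange_big (bigD1 i) //= [X in _ + X]big1 ?addr0.
  rewrite (eq_bigr (fun k => X i i * (U i k * (U i k)^*))); last by move=> k _; ring.
  by rewrite -mulr_sumr hU eqxx mulr1.
move=> j /negPf ji; rewrite (eq_bigr (fun k => X i j * (U j k * (U i k)^*))); last by move=> k _; ring.
by rewrite -mulr_sumr hU ji mulr0.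
Qed.

Lemma tnb_psd T (X : Op R T) : psd X -> tnb X (Re (tr X)).
Proof.
move=> pX U s hU hs; rewrite -(sum_quad X hU) raddf_sum; apply: ler_sum => k _ /=.
have q0 : 0 <= Re (quad X (U^~ k)) by have := le_Re (pX (U^~ k)).
rewrite -[X in _ <= X]mul1r ler_wpM2r //; exact: le_trans (ler_norm _) (hs k).
Qed.

Lemma tnbN T (X : Op R T) b : tnb X b -> tnb (fun i j => - X i j) b.
Proof.
move=> hX U s hU hs; have hs' k : `|- s k| <= 1 by rewrite normrN.
apply: le_trans (hX U _ hU hs'); apply: eq_ler.
apply: eq_bigr => k _; rewrite mulNr -mulrN -raddfN; congr (_ * Re _).
rewrite /quad -sumrN; apply: eq_bigr => i _; rewrite -sumrN; apply: eq_bigr => j _ /=.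
by rewrite mulrN mulNr.
Qed.

End Psd.

Lemma dffun_eq_prod (V : pzSemiRingType) (I : finType) (T : I -> finType)
    (x y : {dffun forall j, T j}) : (x == y)%:R = \prod_j (x j == y j)%:R :> V.
Proof.
rewrite -(forall_prodr _ (fun j => x j == y j)); congr (nat_of_bool _)%:R.
apply/eqP/forallP => [-> //|h]; by apply/ffunP => j; apply/eqP.
Qed.

Lemma slice_distr2 (V : comPzSemiRingType) (J : finType) (n : nat) (B : J -> finType)
   (G : 'I_n -> {dffun forall j, B j} -> {dffun forall j, B j} -> V) :
  \sum_(x : {dffun forall j, {ffun 'I_n -> B j}}) \sum_(y : {dffun forall j, {ffun 'I_n -> B j}})
     \prod_i G i (slice x i) (slice y i) =
  \prod_i \sum_x \sum_y G i x y.
Proof.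
rewrite -(slice_distr (fun i x => \sum_y G i x y)); apply: eq_bigr => x _.
by rewrite -(slice_distr (fun i y => G i (slice x i) y)).
Qed.

Section Blocks.
Variable R : realType.
Local Notation C := (R[i]).

Lemma psd_blocks (T S U : finType) (h : T -> S) (g : T -> U) (X : S -> Op R U) :
  (forall x, psd (X x)) -> psd (fun i j => (h i == h j)%:R * X (h i) (g i) (g j)).
Proof.
move=> pX.
have p x : true -> psd (fun i j => ((h i == x) && (h j == x))%:R * X x (g i) (g j)).
  move=> _; apply: psd_hadamard; [exact: (@psd_ind R T (fun i => h i == x)) | exact: psd_pull].
have := psd_sum p; congr psd; apply/funext => i; apply/funext => j.
rewrite (bigD1 (h i)) //= eqxx /= big1 ?addr0 1?eq_sym // => x /negPf.
by rewrite eq_sym => ->; rewrite mul0r.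
Qed.

Variables (m : nat) (dA : 'I_m -> nat) (dE : nat).
Variable rho : Op R ({dffun forall j : 'I_m, 'I_(dA j)} * 'I_dE)%type.
Variables (dX dA' : 'I_m -> nat).
Variable F : forall j : 'I_m, 'I_(dX j) -> Map R 'I_(dA j) 'I_(dA' j).
Hypothesis hrho : is_state rho.
Hypothesis hF : forall j : 'I_m, instrument (@F j).
Variable n : nat.

Local Notation X1 := {dffun forall j : 'I_m, 'I_(dX j)}.
Local Notation B1 := {dffun forall j : 'I_m, 'I_(dA' j)}.
Local Notation Xn := {dffun forall j : 'I_m, {ffun 'I_n -> 'I_(dX j)}}.
Local Notation Bn := {dffun forall j : 'I_m, {ffun 'I_n -> 'I_(dA' j)}}.
Local Notation En := {ffun 'I_n -> 'I_dE}.

Definition post (x : X1) : Op R (B1 * 'I_dE)%type := apply_multi (fun j => F (x j)) rho.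
Definition post_n (x : Xn) : Op R (Bn * En)%type := fun p q =>
  \prod_i post (slice x i) (slice p.1 i, p.2 i) (slice q.1 i, q.2 i).

Lemma post_psd x : psd (post x).
Proof.
by apply: apply_multi_psd; [move=> j; apply: choi_psd; case: (hF j) | case: hrho].
Qed.

Lemma post_n_psd x : psd (post_n x).
Proof.
pose h (p : Bn * En) : {dffun forall i : 'I_n, B1 * 'I_dE}%type :=
  [ffun i => (slice p.1 i, p.2 i)].
have := psd_pull h (psd_tensor (fun i => post_psd (slice x i))); congr psd.
apply/funext => p; apply/funext => q; apply: eq_bigr => i _.
by rewrite /h !ffunE.
Qed.

Definition choi_n j (x : {ffun 'I_n -> 'I_(dX j)}) :
    Op R ({ffun 'I_n -> 'I_(dA j)} * {ffun 'I_n -> 'I_(dA' j)})%type :=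
  fun p q => \prod_i F (x i) (matunit R (p.1 i) (q.1 i)) (p.2 i) (q.2 i).

Lemma choi_n_psd j (x : {ffun 'I_n -> 'I_(dX j)}) : psd (choi_n x).
Proof.
pose h (p : {ffun 'I_n -> 'I_(dA j)} * {ffun 'I_n -> 'I_(dA' j)}) :
    {dffun forall i : 'I_n, 'I_(dA j) * 'I_(dA' j)}%type := [ffun i => (p.1 i, p.2 i)].
have pc i : psd (choi (F (x i))) by apply: choi_psd; case: (hF j).
have := psd_pull h (psd_tensor pc); congr psd.
apply/funext => p; apply/funext => q; apply: eq_bigr => i _.
by rewrite /h !ffunE.
Qed.

Lemma choi_n_trace j c c' :
  \sum_(x : {ffun 'I_n -> 'I_(dX j)}) \sum_a choi_n x (c, a) (c', a) = (c == c')%:R.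
Proof.
transitivity (\prod_(i < n) \sum_(x : 'I_(dX j)) \sum_a F x (matunit R (c i) (c' i)) a a).
  rewrite bigA_distr_bigA; apply: eq_bigr => x _.
  by rewrite bigA_distr_bigA.
transitivity (\prod_(i < n) (c i == c' i)%:R : C); last by rewrite -dffun_eq_prod.
apply: eq_bigr => i _; have [_ tp] := hF j.
transitivity (tr (matunit R (c i) (c' i))); last first.
  rewrite /tr /matunit (bigD1 (c i)) //= eqxx /= big1 ?addr0 // => t /negPf -> //.
by rewrite -tp /tr exchange_big.
Qed.

Lemma post_nE (x : Xn) (a : Bn) (e : En) (a' : Bn) (e' : En) :
  \sum_(c : {dffun forall j : 'I_m, {ffun 'I_n -> 'I_(dA j)}})
  \sum_(c' : {dffun forall j : 'I_m, {ffun 'I_n -> 'I_(dA j)}})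
    @rho_n R m dA dE rho n (c, e) (c', e') *
    \prod_j choi_n (x j) (c j, a j) (c' j, a' j) = post_n x (a, e) (a', e').
Proof.
rewrite /post_n /post /apply_multi /=.
rewrite -(slice_distr2 (fun i c c' => rho (c, e i) (c', e' i) *
   \prod_j F (slice x i j) (matunit R (c j) (c' j)) (slice a i j) (slice a' i j))).
apply: eq_bigr => c _; apply: eq_bigr => c' _.
rewrite big_split /=; congr (_ * _); rewrite exchange_big /=.
by apply: eq_bigr => j _; apply: eq_bigr => i _; rewrite !ffunE.
Qed.

Variables (N : 'I_m -> nat) (K : nat).
Local Notation label := {dffun forall i : 'I_m, 'I_(N i)}.
Variable cd : {dffun forall i : 'I_m, {ffun {ffun 'I_n -> 'I_(dX i)} -> 'I_(N i)}}.
Variable D : forall j : 'I_m, {ffun 'I_n -> 'I_(dX j)} -> label -> 'I_K ->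
  Op R {ffun 'I_n -> 'I_(dA' j)}.
Hypothesis hD : forall j x l, povm (@D j x l).
Local Notation O j := ({ffun 'I_n -> 'I_(dX j)} * {ffun 'I_n -> 'I_(dA' j)})%type.

(* The output register keeps the outcome string next to the quantum output; the
   map is given by its Choi matrix, cut down to the strings in bin [l]. *)
Definition binning_inst j (l : 'I_(N j)) : Map R {ffun 'I_n -> 'I_(dA j)} 'I_#|{: O j}| :=
  map_of_choi (fun p q =>
    ((enum_val p.2).1 == (enum_val q.2).1)%:R *
    ((cd j (enum_val p.2).1 == l)%:R * choi_n (enum_val p.2).1
       (p.1, (enum_val p.2).2) (q.1, (enum_val q.2).2))).

(** Reads the stored outcome string and applies the measurement that belongs to it. The output space
    of a protocol is an ordinal, hence the passage through [enum_val]. *)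
Definition block_dec j (l : label) (k : 'I_K) : Op R 'I_#|{: O j}| := fun b b' =>
  ((enum_val b).1 == (enum_val b').1)%:R * D (enum_val b).1 l k (enum_val b).2 (enum_val b').2.

Definition binning_protocol : protocol R dA n :=
  @Protocol R m dA n N (fun j => #|{: O j}|) K binning_inst block_dec.

Lemma block_dec_povm j l : povm (@block_dec j l).
Proof.
split=> [k|b b'].
  exact: (psd_blocks (fun b : 'I_#|{: O j}| => (enum_val b).1) (fun b => (enum_val b).2)
     (fun x => (hD x l).1 k)).
rewrite -mulr_sumr (hD _ l).2 /idop -(inj_eq enum_val_inj).
by case: (enum_val b) (enum_val b') => [x a] [x' a'] /=; rewrite -natrM mulnb xpair_eqE.
Qed.

Lemma binning_inst_instrument j : instrument (@binning_inst j).
Proof.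
split=> [l|X].
  apply: cp_of_choi.
  pose Y x : Op R ({ffun 'I_n -> 'I_(dA j)} * {ffun 'I_n -> 'I_(dA' j)})%type :=
    fun p q => (cd j x == l)%:R * choi_n x p q.
  have pY x : psd (Y x).
    move=> v; rewrite -/(quad _ _) quadZ mulr_ge0 ?ler0n //; exact: choi_n_psd.
  exact: (psd_blocks (fun p : {ffun 'I_n -> 'I_(dA j)} * 'I_#|{: O j}| => (enum_val p.2).1)
           (fun p => (p.1, (enum_val p.2).2)) pY).
rewrite /tr /binning_inst /map_of_choi.
transitivity (\sum_c \sum_c' X c c' * \sum_(o : O j) choi_n o.1 (c, o.2) (c', o.2)).
  under eq_bigr do rewrite exchange_big /=.
  rewrite exchange_big; apply: eq_bigr => c _ /=.
  under eq_bigr do rewrite exchange_big /=.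
  rewrite exchange_big; apply: eq_bigr => c' _ /=.
  rewrite [in RHS](reindex (@enum_val _ {: O j})) /=; last exact/onW_bij/enum_val_bij.
  rewrite mulr_sumr; apply: eq_bigr => b _; rewrite -mulr_sumr; congr (_ * _).
  under eq_bigr do rewrite eqxx mul1r.
  rewrite -mulr_suml (bigD1 (cd j (enum_val b).1)) //= eqxx big1 ?addr0 ?mul1r // => l /negPf.
  by rewrite eq_sym => ->.
apply: eq_bigr => c _; rewrite (bigD1 c) //= [X in _ + X]big1 ?addr0.
  by rewrite -(pair_bigA _ (fun x a => choi_n x (c, a) (c, a))) choi_n_trace eqxx mulr1.
move=> c' /negPf cc; rewrite -(pair_bigA _ (fun x a => choi_n x (c, a) (c', a))) choi_n_trace.
by rewrite eq_sym cc mulr0.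
Qed.

Lemma binning_valid : valid_protocol binning_protocol.
Proof. by split=> [j|j l]; [exact: binning_inst_instrument | exact: block_dec_povm]. Qed.

Definition emb (x : Xn) (a : Bn) : {dffun forall j : 'I_m, 'I_#|{: O j}|} :=
  @finfun _ (fun j => 'I_#|{: O j}|) (fun j => enum_rank ((x j, a j) : O j)).

Lemma emb_sum (V : nmodType) (G : {dffun forall j : 'I_m, 'I_#|{: O j}|} -> V) :
  \sum_b G b = \sum_x \sum_a G (emb x a).
Proof.
rewrite pair_bigA /= (reindex (fun p : Xn * Bn => emb p.1 p.2)) //.
apply: onW_bij; exists (fun b : {dffun forall j : 'I_m, 'I_#|{: O j}|} => (
  @finfun _ (fun j => {ffun 'I_n -> 'I_(dX j)}) (fun j => (enum_val (b j)).1),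
  @finfun _ (fun j => {ffun 'I_n -> 'I_(dA' j)}) (fun j => (enum_val (b j)).2))).
  by move=> [x a]; congr (_, _); apply/ffunP => j; rewrite !ffunE /= enum_rankK.
by move=> b; apply/ffunP => j; rewrite !ffunE /= -surjective_pairing enum_valK.
Qed.

Lemma enum_val_emb x a j : enum_val (emb x a j) = (x j, a j).
Proof. by rewrite ffunE enum_rankK. Qed.

Definition enc_n (x : Xn) : label := @enc m (fun j => {ffun 'I_n -> 'I_(dX j)}) N cd x.

(** The unnormalised state of the eavesdropper when the outcome strings are [x] and the players
    output the keys [k]. *)
Definition joint_op (x : Xn) (k : {ffun 'I_m -> 'I_K}) : Op R En := fun e e' =>
  \sum_a \sum_a' post_n x (a, e) (a', e') *
     \prod_j D (x j) (enc_n x) (k j) (a' j) (a j).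

(** The stored strings are classical, so terms with different strings in row and column vanish, and
    each string determines its label. *)
Lemma sigmaE k l e e' :
  @sigma R m dA dE n binning_protocol rho k l e e' =
  \sum_x (enc_n x == l)%:R * joint_op x k e e'.
Proof.
have M y a y' a' : apply_multi (fun j => binning_inst (l j)) (@rho_n R m dA dE rho n)
     (emb y a, e) (emb y' a', e') =
   (y == y')%:R * ((enc_n y == l)%:R * post_n y (a, e) (a', e')).
  rewrite /apply_multi /=.
  transitivity (\sum_c \sum_c' ((y == y')%:R * (enc_n y == l)%:R) *
     (@rho_n R m dA dE rho n (c, e) (c', e') * \prod_j choi_n (y j) (c j, a j) (c' j, a' j))).
    apply: eq_bigr => c _; apply: eq_bigr => c' _.
    under eq_bigr => j _ do rewrite /binning_inst map_of_choi_unit /= !enum_val_emb /=.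
    rewrite !big_split /= -dffun_eq_prod.
    rewrite (_ : \prod_(j < m) (cd j (y j) == l j)%:R = (enc_n y == l)%:R :> C).
      by ring.
    by rewrite dffun_eq_prod; apply: eq_bigr => j _; rewrite ffunE.
  under eq_bigr do rewrite -mulr_sumr.
  rewrite -mulr_sumr -mulrA; case: eqVneq => [_|_]; last by rewrite !mul0r.
  by rewrite post_nE.
rewrite /sigma /= emb_sum; apply: eq_bigr => y _.
rewrite /joint_op mulr_sumr; apply: eq_bigr => a _.
rewrite emb_sum (bigD1 y) //= [X in _ + X]big1 ?addr0; last first.
  by move=> y' /negPf yy; apply: big1 => a' _; rewrite M eq_sym yy !mul0r.
rewrite mulr_sumr; apply: eq_bigr => a' _; rewrite M eqxx mul1r.
case: (eqVneq (enc_n y) l) => [<-|_]; last by rewrite !mul0r.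
rewrite !mul1r; congr (_ * _); apply: eq_bigr => j _.
by rewrite /block_dec !enum_val_emb /= eqxx mul1r.
Qed.

Lemma joint_op_psd x k : psd (joint_op x k).
Proof.
have pt : psd (fun p q : Bn => \prod_j D (x j) (enc_n x) (k j) (q j) (p j)).
  apply: (psd_conj (X := fun p q : Bn => \prod_j D (x j) (enc_n x) (k j) (p j) (q j))).
  exact: (psd_tensor (X := fun j => D (x j) (enc_n x) (k j)) (fun j => (hD (x j) (enc_n x)).1 (k j))).
exact: (psd_contract (psd_hadamard (post_n_psd x) (psd_pull (fun p : Bn * En => p.1) pt))).
Qed.

Definition eve_op (x : Xn) : Op R En := fun e e' => \sum_a post_n x (a, e) (a, e').

Lemma joint_op_sum x e e' : \sum_k joint_op x k e e' = eve_op x e e'.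
Proof.
rewrite /joint_op exchange_big; apply: eq_bigr => a _ /=.
rewrite exchange_big (bigD1 a) //= [X in _ + X]big1 ?addr0.
  rewrite -mulr_sumr -(bigA_distr_bigA (fun j k => D (x j) (enc_n x) k (a j) (a j))).
  by rewrite big1 ?mulr1 // => j _; rewrite (hD (x j) (enc_n x)).2 /idop eqxx.
move=> a' ne; rewrite -mulr_sumr -(bigA_distr_bigA (fun j k => D (x j) (enc_n x) k (a' j) (a j))).
under eq_bigr do rewrite (hD _ _).2 /idop.
by rewrite -dffun_eq_prod (negPf ne) mulr0.
Qed.

Definition player_op j (x : Xn) : Op R {ffun 'I_n -> 'I_(dA' j)} := fun b b' =>
  \sum_(a : Bn) \sum_(a' : Bn) \sum_e
   (((a j == b) && (a' j == b')) && [forall i, (i == j) || (a i == a' i)])%:R *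
   post_n x (a, e) (a', e).

(** Summed over their keys, the measurements of the other players become identities, and these carry
    out the partial trace down to player [j]. *)
Lemma joint_op_marg j x kap :
  \sum_(k : {ffun 'I_m -> 'I_K} | k j == kap) tr (joint_op x k) =
  \sum_b \sum_b' @player_op j x b b' * D (x j) (enc_n x) kap b' b.
Proof.
have Dk (a a' : Bn) : \sum_(k : {ffun 'I_m -> 'I_K} | k j == kap)
     \prod_i D (x i) (enc_n x) (k i) (a' i) (a i) =
   [forall i, (i == j) || (a i == a' i)]%:R * D (x j) (enc_n x) kap (a' j) (a j).
  pose G i k := (if i == j then (k == kap)%:R else 1) * D (x i) (enc_n x) k (a' i) (a i).
  transitivity (\sum_(k : {ffun 'I_m -> 'I_K}) \prod_i G i (k i)).
    rewrite big_mkcond; apply: eq_bigr => k _; rewrite /G big_split /=.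
    rewrite -big_mkcond /= big_pred1_eq.
    by case: (k j == kap); rewrite ?mul1r ?mul0r.
  rewrite -(bigA_distr_bigA G) forall_prodr (bigD1 j) //= [in RHS](bigD1 j) //= eqxx /= mul1r mulrC.
  congr (_ * _).
    apply: eq_bigr => i /negPf ij; rewrite /G ij /=; under eq_bigr do rewrite mul1r.
    by rewrite (hD _ _).2 /idop eq_sym.
  rewrite /G eqxx (bigD1 kap) //= eqxx mul1r big1 ?addr0 // => k /negPf ->.
  by rewrite mul0r.
rewrite /tr exchange_big /=.
transitivity (\sum_e \sum_(a : Bn) \sum_(a' : Bn) post_n x (a, e) (a', e) *
   ([forall i, (i == j) || (a i == a' i)]%:R * D (x j) (enc_n x) kap (a' j) (a j))).
  apply: eq_bigr => e _; rewrite /joint_op exchange_big; apply: eq_bigr => a _ /=.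
  by rewrite exchange_big; apply: eq_bigr => a' _ /=; rewrite -mulr_sumr Dk.
rewrite exchange_big /=.
transitivity (\sum_(a : Bn) \sum_b \sum_b' \sum_(a' : Bn) \sum_e
   (((a j == b) && (a' j == b')) && [forall i, (i == j) || (a i == a' i)])%:R *
   post_n x (a, e) (a', e) * D (x j) (enc_n x) kap b' b).
  apply: eq_bigr => a _; rewrite (bigD1 (a j)) //= [X in _ + X]big1 ?addr0; last first.
    move=> b /negPf ba; apply: big1 => b' _; apply: big1 => a' _; apply: big1 => e _.
    by rewrite eq_sym ba /= !mul0r.
  rewrite [LHS]exchange_big [RHS]exchange_big; apply: eq_bigr => a' _ /=.
  rewrite (bigD1 (a' j)) //= [X in _ + X]big1 ?addr0; last first.
    move=> b /negPf ba; apply: big1 => e _.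
    by rewrite eqxx eq_sym ba /= !mul0r.
  by apply: eq_bigr => e _; rewrite !eqxx /=; ring.
rewrite exchange_big; apply: eq_bigr => b _ /=.
rewrite exchange_big; apply: eq_bigr => b' _ /=.
rewrite /player_op mulr_suml; apply: eq_bigr => a _.
by rewrite mulr_suml; apply: eq_bigr => a' _; rewrite mulr_suml.
Qed.

End Blocks.

(** * From decoders and a key function to a good protocol *)

Section GoodProtocol.
Variable R : realType.
Local Notation C := (R[i]).
Local Notation Re := (@complex.Re R).
Variables (m : nat) (dA : 'I_m -> nat) (dE : nat).
Variable rho : Op R ({dffun forall j : 'I_m, 'I_(dA j)} * 'I_dE)%type.
Variables (dX dA' : 'I_m -> nat).
Variable F : forall j : 'I_m, 'I_(dX j) -> Map R 'I_(dA j) 'I_(dA' j).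
Hypothesis hrho : is_state rho.
Hypothesis hF : forall j : 'I_m, instrument (@F j).
Variable n : nat.
Local Notation Xn := {dffun forall j : 'I_m, {ffun 'I_n -> 'I_(dX j)}}.
Local Notation En := {ffun 'I_n -> 'I_dE}.
Variables (N : 'I_m -> nat) (K : nat).
Local Notation label := {dffun forall i : 'I_m, 'I_(N i)}.
Variable cd : {dffun forall i : 'I_m, {ffun {ffun 'I_n -> 'I_(dX i)} -> 'I_(N i)}}.
Variable D : forall j : 'I_m, {ffun 'I_n -> 'I_(dX j)} -> label -> 'I_K ->
  Op R {ffun 'I_n -> 'I_(dA' j)}.
Hypothesis hD : forall j x l, povm (@D j x l).
Variable g : {ffun Xn -> 'I_K}.
Variables (j1 : 'I_m) (er : 'I_m -> R) (b eps : R).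
Hypothesis K0 : (0 < K)%N.
Local Notation eve := (@eve_op R m dA dE rho dX dA' F n).
Local Notation J := (joint_op rho F cd D).
Local Notation encx := (@enc_n m dX n N cd).
Hypothesis eve1 : \sum_(x : Xn) tr (eve x) = 1.
Hypothesis decode_ok : forall j, \sum_(x : Xn) (tr (eve x) -
  \sum_b \sum_b' @player_op R m dA dE rho dX dA' F n j x b b' *
     D (x j) (encx x) (g x) b' b) <= rc (er j).
Hypothesis leak_ok : tnb (leak eve encx g) b.
Hypothesis eps1 : \sum_j er j <= eps.
Hypothesis eps2 : b + 2 * er j1 <= 2 * eps.

Local Notation PP := (binning_protocol F cd D).
Let t (x : Xn) (k : {ffun 'I_m -> 'I_K}) : C := tr (J x k).

Lemma t_ge0 x k : 0 <= t x k.
Proof. by apply: tr_ge0; exact: joint_op_psd. Qed.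

Lemma t_sum x : \sum_k t x k = tr (eve x).
Proof.
rewrite /t /tr exchange_big; apply: eq_bigr => e _ /=.
exact: joint_op_sum.
Qed.

Lemma t_miss j : \sum_x \sum_(k : {ffun 'I_m -> 'I_K} | k j != g x) t x k <= rc (er j).
Proof.
apply: le_trans (decode_ok j); apply: ler_sum => x _.
rewrite -t_sum -(joint_op_marg rho F cd hD j x (g x)).
by rewrite [X in _ <= X - _](bigID (fun k : {ffun 'I_m -> 'I_K} => k j == g x)) /= addrC addrK.
Qed.

Lemma prob_agreeE :
  @prob_agree R m dA dE n PP rho =
  \sum_(k : {ffun 'I_m -> 'I_K} | [forall i, forall j, k i == k j]) \sum_x t x k.
Proof.
apply: eq_bigr => k _; rewrite /tr.
under eq_bigr do under eq_bigr do rewrite sigmaE.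
under eq_bigr do rewrite exchange_big /=.
rewrite exchange_big; apply: eq_bigr => x _ /=.
rewrite (bigD1 (encx x)) //= [X in _ + X]big1 ?addr0.
  by rewrite /t /tr; apply: eq_bigr => e _; rewrite eqxx mul1r.
by move=> l /negPf; rewrite eq_sym => lx; apply: big1 => e _; rewrite lx mul0r.
Qed.

(** Agreement is implied by every player finding [g x]; a union bound over the players controls the
    complement. *)
Lemma prob_agree_ge : rc (1 - eps) <= @prob_agree R m dA dE n PP rho.
Proof.
rewrite prob_agreeE exchange_big /=.
pose cst (x : Xn) : {ffun 'I_m -> 'I_K} := [ffun _ => g x].
apply: le_trans (_ : \sum_x t x (cst x) <= _); last first.
  apply: ler_sum => x _; rewrite (bigD1 (cst x)) /=.
    by rewrite lerDl; apply: sumr_ge0 => k _; exact: t_ge0.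
  by apply/forallP => i; apply/forallP => j; rewrite !ffunE.
apply: le_trans (_ : \sum_x (tr (eve x) - \sum_j \sum_(k : {ffun 'I_m -> 'I_K} | k j != g x) t x k) <= _).
  rewrite sumrB eve1 rcB rc1 lerD2l lerN2 exchange_big /=.
  apply: le_trans (ler_sum _ (fun j _ => t_miss j)) _.
  by rewrite -rc_sum le_rc.
apply: ler_sum => x _; rewrite lerBlDr -t_sum (bigD1 (cst x)) //= lerD2l.
rewrite [X in X <= _]big_mkcond /=.
under [X in _ <= X]eq_bigr do rewrite big_mkcond.
rewrite [X in _ <= X]exchange_big /=; apply: ler_sum => k _.
case: ifP => [kx|_]; last by apply: sumr_ge0 => j _; case: ifP => // _; exact: t_ge0.
have [j hj] : exists j, k j != g x.
  apply/existsP; apply: contraNT kx => /existsPn h.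
  by apply/eqP/ffunP => j; rewrite ffunE; apply/eqP; have := h j; rewrite negbK.
rewrite (bigD1 j) //= hj lerDl; apply: sumr_ge0 => i _.
by case: ifP => // _; exact: t_ge0.
Qed.

Definition theta (x : Xn) (kap : 'I_K) : Op R En :=
  fun e e' => \sum_(k : {ffun 'I_m -> 'I_K} | k j1 == kap) J x k e e'.

Lemma theta_psd x kap : psd (theta x kap).
Proof. by apply: psd_sum => k _; exact: joint_op_psd. Qed.

Lemma theta_sum x e e' : \sum_kap theta x kap e e' = eve x e e'.
Proof.
by rewrite -(joint_op_sum rho F cd hD) /theta (partition_big (fun k : {ffun 'I_m -> 'I_K} => k j1) predT).
Qed.

Lemma tr_theta x kap : tr (theta x kap) = \sum_(k : {ffun 'I_m -> 'I_K} | k j1 == kap) t x k.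
Proof. by rewrite /tr /theta exchange_big. Qed.

Lemma theta_miss : \sum_x \sum_(kap | kap != g x) tr (theta x kap) <= rc (er j1).
Proof.
apply: le_trans (t_miss j1); apply: ler_sum => x _.
rewrite [X in _ <= X](partition_big (fun k : {ffun 'I_m -> 'I_K} => k j1) (fun kap => kap != g x)) //=.
apply: ler_sum => kap kx; rewrite tr_theta; apply: eq_ler.
by apply: eq_bigl => k; case: eqP => [->|]; rewrite ?kx ?andbF.
Qed.

Definition tau_st : Op R (label * En)%type := fun p q =>
  (p.1 == q.1)%:R * \sum_x (encx x == p.1)%:R * eve x p.2 q.2.

Lemma eve_psd (x : Xn) : psd (eve x).
Proof.
apply: psd_sum => a _.
exact: (psd_pull (fun e : En => (a, e)) (post_n_psd hrho hF x)).
Qed.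

Lemma psd_scale_bool (T : finType) (c : bool) (X : Op R T) :
  psd X -> psd (fun i j => c%:R * X i j).
Proof. by move=> pX v; rewrite -/(quad _ _) quadZ mulr_ge0 ?ler0n //; exact: pX. Qed.

Lemma tau_state : is_state tau_st.
Proof.
split.
  apply: (psd_blocks (fun p : label * En => p.1) (fun p => p.2)
    (X := fun l e e' => \sum_x (encx x == l)%:R * eve x e e')) => l.
  by apply: psd_sum => x _; apply: psd_scale_bool; exact: eve_psd.
rewrite -eve1 /tr -(pair_bigA _ (fun l e => tau_st (l, e) (l, e))) /= exchange_big /=.
rewrite [RHS]exchange_big; apply: eq_bigr => e _ /=.
under eq_bigr do rewrite /tau_st /= eqxx mul1r.
rewrite exchange_big; apply: eq_bigr => x _ /=.
rewrite (bigD1 (encx x)) //= eqxx mul1r big1 ?addr0 // => l /negPf.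
by rewrite eq_sym => ->; rewrite mul0r.
Qed.

Definition block_op (Y : Xn -> 'I_K -> Op R En) : Op R ('I_K * (label * En))%type :=
  fun r s => ((r.1 == s.1) && (r.2.1 == s.2.1))%:R *
    \sum_x (encx x == r.2.1)%:R * Y x r.1 r.2.2 s.2.2.

Lemma block_op_tnb Y : (forall x kap, psd (Y x kap)) ->
  tnb (block_op Y) (Re (\sum_x \sum_kap tr (Y x kap))).
Proof.
move=> pY.
have pB : psd (block_op Y).
  have := @psd_blocks R _ _ _ (fun r : 'I_K * (label * En) => (r.1, r.2.1)) (fun r => r.2.2)
    (fun c e e' => \sum_x (encx x == c.2)%:R * Y x c.1 e e').
  move=> /(_ _); move=> h; have := h (fun c => psd_sum (fun x _ => psd_scale_bool _ (pY x c.1))).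
  by congr psd; apply/funext => r; apply/funext => s; rewrite /block_op xpair_eqE.
have -> : \sum_x \sum_kap tr (Y x kap) = tr (block_op Y); last exact: tnb_psd.
rewrite /tr sum_triple exchange_big; apply: eq_bigr => kap _ /=.
rewrite exchange_big /= [RHS]exchange_big; apply: eq_bigr => e _ /=.
under [RHS]eq_bigr do rewrite /block_op /= !eqxx mul1r.
rewrite [RHS]exchange_big; apply: eq_bigr => x _ /=.
rewrite (bigD1 (encx x)) //= eqxx mul1r big1 ?addr0 // => l /negPf.
by rewrite eq_sym => ->; rewrite mul0r.
Qed.

(** The key of player 1 is decoded, not computed from [x]. [excess] is the mass on wrong keys and
    [deficit] the mass missing at the right one; summed over strings and keys, both have trace equal
    to the decoding error of player 1. *)
Definition excess x kap : Op R En := fun e e' => (kap != g x)%:R * theta x kap e e'.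
Definition deficit x kap : Op R En := fun e e' =>
  (kap == g x)%:R * \sum_(kap' | kap' != kap) theta x kap' e e'.

Lemma Omega1_split (r s : 'I_K * (label * En)) :
  @Omega1 R m dA dE n PP j1 rho r s - @unif_tensor R m dA dE n PP tau_st r s =
  leak eve encx g r s + (block_op excess r s + - block_op deficit r s).
Proof.
rewrite /Omega1 /unif_tensor /leak /block_op /tau_st.
case: r s => [kap [l e]] [kap' [l' e']] /=.
case: eqVneq => /= [_|_]; last by rewrite !mul0r !subr0 ?add0r.
case: eqVneq => /= [_|_]; last by rewrite !mul0r mulr0 !subr0 ?add0r.
rewrite !mul1r.
under eq_bigr do rewrite sigmaE.
rewrite exchange_big /= mulr_sumr -!sumrN -!big_split /=; apply: eq_bigr => x _.
rewrite -mulr_sumr -/(theta x kap e e').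
rewrite /ccoef /hcoef; case: (encx x == l); rewrite ?mul0r ?mulr0 ?mul1r ?subr0 ?oppr0 ?addr0 //.
rewrite /excess /deficit -(theta_sum x e e') (bigD1 kap) //=.
rewrite [g x == kap]eq_sym rcB rc_nat -(rc_nat R K) -(rmorphV (@rc R)) /=; last first.
  by rewrite unitfE pnatr_eq0 -lt0n.
by case: (kap == g x) => /=; ring.
Qed.

Lemma binning_good : @good_protocol R m dA dE n PP j1 rho eps.
Proof.
split; first exact: binning_valid.
split; first exact: prob_agree_ge.
exists tau_st; split; first exact: tau_state.
have hm : Re (\sum_x \sum_(kap | kap != g x) tr (theta x kap)) <= er j1.
  exact: (le_Re theta_miss).
have E1 : tnb (block_op excess) (er j1).
  have pe x kap : psd (excess x kap) by apply: psd_scale_bool; exact: theta_psd.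
  move=> U s hU hs; apply: le_trans (block_op_tnb pe hU hs) _.
  apply: le_trans hm; apply: eq_ler.
  congr Re; apply: eq_bigr => x _; rewrite [RHS]big_mkcond; apply: eq_bigr => kap _.
  rewrite /tr /excess -mulr_sumr -/(tr _).
  by case: (kap != g x); rewrite ?mul1r ?mul0r.
have E2 : tnb (block_op deficit) (er j1).
  have pe x kap : psd (deficit x kap).
    by apply: psd_scale_bool; apply: psd_sum => k _; exact: theta_psd.
  move=> U s hU hs; apply: le_trans (block_op_tnb pe hU hs) _.
  apply: le_trans hm; apply: eq_ler.
  congr Re; apply: eq_bigr => x _; rewrite (bigD1 (g x)) //= [X in _ + X]big1 ?addr0.
    rewrite /tr /deficit; under [LHS]eq_bigr do rewrite eqxx mul1r.
    by rewrite exchange_big.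
  by move=> kap /negPf h; apply: big1 => e _; rewrite /deficit h mul0r.
have er0 : 0 <= er j1.
  apply: le_trans hm; apply: (@le_Re R 0); apply: sumr_ge0 => x _.
  by apply: sumr_ge0 => k _; apply: tr_ge0; exact: theta_psd.
(* Testing [leak_ok] with all weights zero. *)
have b0 : 0 <= b.
  have := leak_ok (U := @idop R _) (s := fun=> 0).
  under eq_bigr do rewrite mul0r; rewrite big1 //; apply.
    move=> i j; rewrite /idop (bigD1 j) //= eqxx conj1 mulr1 big1 ?addr0 // => k /negPf.
    by rewrite eq_sym => ->; rewrite conj0 mulr0.
  by move=> k; rewrite normr0.
have := trnorm_le (addr_ge0 b0 (addr_ge0 er0 er0)) (tnbD leak_ok (tnbD E1 (tnbN E2))).
rewrite ler_pdivrMr //.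
set X1 := (X in trnorm X <= _ -> _); set X2 := (X in _ -> trnorm X <= _).
have -> : X1 = X2 by apply/funext => r; apply/funext => s; rewrite /X1 /X2 Omega1_split.
by move=> h; apply: le_trans h _; move: eps2; lra.
Qed.

End GoodProtocol.

(** * Single-letter operators of the players and the eavesdropper *)

Section SingleLetter.
Variable R : realType.
Local Notation C := (R[i]).
Variables (m : nat) (dA : 'I_m -> nat) (dE : nat).
Variable rho : Op R ({dffun forall j : 'I_m, 'I_(dA j)} * 'I_dE)%type.
Variables (dX dA' : 'I_m -> nat).
Variable F : forall j : 'I_m, 'I_(dX j) -> Map R 'I_(dA j) 'I_(dA' j).
Hypothesis hrho : is_state rho.
Hypothesis hF : forall j : 'I_m, instrument (@F j).

Local Notation X1 := {dffun forall j : 'I_m, 'I_(dX j)}.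
Local Notation B1 := {dffun forall j : 'I_m, 'I_(dA' j)}.
Local Notation post1 := (@post R m dA dE rho dX dA' F).

Definition coincide j (b b' : 'I_(dA' j)) (a a' : B1) : bool :=
  ((a j == b) && (a' j == b')) && [forall i, (i == j) || (a i == a' i)].

Definition player1 j (x : X1) : Op R 'I_(dA' j) := fun b b' =>
  \sum_(a : B1) \sum_(a' : B1) \sum_e (coincide b b' a a')%:R * post1 x (a, e) (a', e).
Definition eve1 (x : X1) : Op R 'I_dE := fun e e' => \sum_(a : B1) post1 x (a, e) (a, e').

Lemma eve1_psd x : psd (eve1 x).
Proof.
apply: psd_sum => a _.
exact: (psd_pull (fun e : 'I_dE => (a, e)) (post_psd hrho hF x)).
Qed.

(** The indicator [coincide] is an entrywise product of a rank one kernel at [j] and a tensor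
    product of identity kernels at the other players; multiplied with [post] and contracted it stays
    positive. *)
Lemma player1_psd j x : psd (@player1 j x).
Proof.
have pt : psd (fun a a' : B1 => \prod_i ((i == j) || (a i == a' i))%:R : C).
  apply: (@psd_tensor R _ (fun i => 'I_(dA' i)) (fun i u v => ((i == j) || (u == v))%:R)) => i.
  case: (i == j) => /=; last exact: (@psd_eq R 'I_(dA' i) 'I_(dA' i) id).
  exact: (@psd_ind R _ xpredT).
have pe (e : 'I_dE) : psd (fun b b' : 'I_(dA' j) => \sum_(a : B1) \sum_(a' : B1)
    (coincide b b' a a')%:R * post1 x (a, e) (a', e)).
  have p1 := @psd_ind R (B1 * 'I_(dA' j))%type (fun p => p.1 j == p.2).
  have p2 := psd_pull (fun p : B1 * 'I_(dA' j) => p.1) pt.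
  have p3 := psd_pull (fun p : B1 * 'I_(dA' j) => (p.1, e)) (post_psd hrho hF x).
  have := psd_contract (psd_hadamard (psd_hadamard p1 p2) p3); congr psd.
  apply/funext => b; apply/funext => b'; apply: eq_bigr => a _; apply: eq_bigr => a' _.
  by rewrite /coincide -forall_prodr -natrM mulnb.
have := psd_sum (fun e (_ : xpredT e) => pe e); congr psd.
apply/funext => b; apply/funext => b'; rewrite /player1 exchange_big.
by apply: eq_bigr => a _ /=; rewrite exchange_big.
Qed.

Lemma post_trace : \sum_x tr (post1 x) = 1.
Proof.
have [_ <-] := hrho.
have -> : tr rho = \sum_c \sum_e rho (c, e) (c, e).
  by rewrite /tr pair_bigA; apply: eq_bigr => -[].
transitivity (\sum_x \sum_(a : B1) \sum_(e : 'I_dE) post1 x (a, e) (a, e)).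
  by apply: eq_bigr => x _; rewrite pair_bigA; apply: eq_bigr => -[].
under eq_bigr do rewrite exchange_big /=.
rewrite exchange_big [RHS]exchange_big; apply: eq_bigr => e _ /=.
transitivity (\sum_(c : {dffun forall j : 'I_m, 'I_(dA j)}) \sum_c' rho (c, e) (c', e) *
   \sum_(x : X1) \sum_(a : B1) \prod_j F (x j) (matunit R (c j) (c' j)) (a j) (a j)).
  rewrite /post /apply_multi /=.
  under eq_bigr do rewrite exchange_big /=.
  rewrite exchange_big; apply: eq_bigr => c _ /=.
  under eq_bigr do rewrite exchange_big /=.
  rewrite exchange_big; apply: eq_bigr => c' _ /=.
  by rewrite mulr_sumr; apply: eq_bigr => x _; rewrite mulr_sumr.
have TP (c c' : {dffun forall j : 'I_m, 'I_(dA j)}) : \sum_(x : X1) \sum_(a : B1) \prod_j F (x j) (matunit R (c j) (c' j)) (a j) (a j) =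
    (c == c')%:R.
  rewrite dffun_eq_prod.
  transitivity (\sum_(x : X1) \prod_j \sum_a F (x j) (matunit R (c j) (c' j)) a a).
    by apply: eq_bigr => x _; rewrite -(dffun_distr (fun j a => F (x j) (matunit R (c j) (c' j)) a a)).
  rewrite (@dffun_distr _ _ (fun j => 'I_(dX j)) (fun j x => \sum_a F x (matunit R (c j) (c' j)) a a)).
  apply: eq_bigr => j _; have [_ tp] := hF j.
  transitivity (tr (matunit R (c j) (c' j))); last first.
    rewrite /tr /matunit (bigD1 (c j)) //= eqxx /= big1 ?addr0 // => s /negPf -> //.
  by rewrite -tp /tr exchange_big.
apply: eq_bigr => c _; rewrite (bigD1 c) //= TP eqxx mulr1 big1 ?addr0 // => c' /negPf cc.
by rewrite TP eq_sym cc mulr0.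
Qed.

Lemma eve1_trace : \sum_x tr (eve1 x) = 1.
Proof.
rewrite -post_trace; apply: eq_bigr => x _; rewrite /tr /eve1 exchange_big pair_bigA.
by apply: eq_bigr => -[].
Qed.

Lemma player1_trace j : \sum_x tr (@player1 j x) = 1.
Proof.
rewrite -post_trace; apply: eq_bigr => x _; rewrite /tr /player1.
rewrite exchange_big -[RHS](pair_bigA _ (fun a e => post1 x (a, e) (a, e))).
apply: eq_bigr => a _ /=; rewrite exchange_big (bigD1 a) //= [X in _ + X]big1 ?addr0.
  rewrite exchange_big; apply: eq_bigr => e _ /=.
  rewrite (bigD1 (a j)) //= big1 ?addr0.
    rewrite /coincide !eqxx /= (_ : [forall i, _] = true) ?mul1r //.
    by apply/forallP => i; rewrite eqxx orbT.
  by move=> b /negPf ba; rewrite /coincide eq_sym ba /= mul0r.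
move=> a' ne; apply: big1 => b _; apply: big1 => e _.
rewrite /coincide; case: (boolP (_ && _)) => [/andP[/andP[/eqP h1 /eqP h2] /forallP h]|_]; last by rewrite mul0r.
case/negP: ne; apply/eqP/ffunP => i; have := h i.
by case: eqP => [->|_] /=; [rewrite h1 h2 | move=> /eqP ->].
Qed.

Variable n : nat.
Local Notation Xn := {dffun forall j : 'I_m, {ffun 'I_n -> 'I_(dX j)}}.

Lemma eve_op_n (x : Xn) : eve_op rho F x = om_n eve1 x.
Proof.
apply/funext => e; apply/funext => e'; rewrite /eve_op /om_n /eve1.
by rewrite -(slice_distr (fun i a => post1 (slice x i) (a, e i) (a, e' i))).
Qed.

Lemma player_op_n j (x : Xn) : @player_op R m dA dE rho dX dA' F n j x = om_n (@player1 j) x.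
Proof.
apply/funext => b; apply/funext => b'; rewrite /player_op /om_n /player1.
transitivity (\prod_i \sum_a \sum_a' (coincide (b i) (b' i) a a')%:R *
    \sum_e post1 (slice x i) (a, e) (a', e)); last first.
  by apply: eq_bigr => i _; apply: eq_bigr => a _; apply: eq_bigr => a' _; rewrite mulr_sumr.
rewrite -(slice_distr2 (fun i a a' => (coincide (b i) (b' i) a a')%:R *
    \sum_e post1 (slice x i) (a, e) (a', e))).
apply: eq_bigr => a _; apply: eq_bigr => a' _.
rewrite big_split /= -mulr_sumr bigA_distr_bigA; congr (_ * _).
rewrite -(forall_prodr _ (fun i => coincide (b i) (b' i) (slice a i) (slice a' i))).
congr (nat_of_bool _)%:R; apply/idP/forallP => [/andP[/andP[/eqP h1 /eqP h2] /forallP h] i|h].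
  rewrite /coincide !ffunE h1 h2 !eqxx /=; apply/forallP => k; rewrite !ffunE.
  by have := h k; case: eqP => //= _ /eqP ->.
apply/andP; split; [apply/andP; split; apply/eqP/ffunP => i|apply/forallP => k].
- by have /andP[/andP[/eqP <- _] _] := h i; rewrite ffunE.
- by have /andP[/andP[_ /eqP <-] _] := h i; rewrite ffunE.
- have [//|ne] := eqVneq k j; apply/eqP/ffunP => i.
  have /andP[_ /forallP/(_ k)] := h i.
  by rewrite !ffunE (negPf ne) => /eqP.
Qed.

End SingleLetter.

(** * Entropies of the single-letter state *)

Section Registers.
Variables (m : nat) (dX dA' : 'I_m -> nat) (dE : nat).
Local Notation X1 := {dffun forall j : 'I_m, 'I_(dX j)}.
Local Notation B1 := {dffun forall j : 'I_m, 'I_(dA' j)}.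
Local Notation FT := {dffun forall k : Lab m, Sys dX dA' dE k}.
Implicit Types (K : {set Lab m}) (t u : FT).

Definition tx t : X1 := @finfun _ (fun j : 'I_m => 'I_(dX j)) (fun j => t (LX j)).
Definition ta t : B1 := @finfun _ (fun j : 'I_m => 'I_(dA' j)) (fun j => t (LA j)).
Definition te t : 'I_dE := t (LE m).
Definition mkreg (x : X1) (a : B1) (e : 'I_dE) : FT :=
  @finfun _ (fun k => Finite.sort (Sys dX dA' dE k)) (fun k => match k return Sys dX dA' dE k with
    | inl (inl j) => x j | inl (inr j) => a j | inr _ => e end).

Lemma tx_mkreg x a e : tx (mkreg x a e) = x.
Proof. by apply/ffunP => j; rewrite !ffunE. Qed.
Lemma ta_mkreg x a e : ta (mkreg x a e) = a.
Proof. by apply/ffunP => j; rewrite !ffunE. Qed.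
Lemma te_mkreg x a e : te (mkreg x a e) = e.
Proof. by rewrite /te ffunE. Qed.
Lemma mkregK t : mkreg (tx t) (ta t) (te t) = t.
Proof. by apply/ffunP => -[[j|j]|[]]; rewrite !ffunE. Qed.

Lemma sum_reg (V : nmodType) (G : FT -> V) :
  \sum_t G t = \sum_x \sum_a \sum_e G (mkreg x a e).
Proof.
rewrite pair_bigA pair_bigA /= (reindex (fun p : X1 * B1 * 'I_dE => mkreg p.1.1 p.1.2 p.2)) //.
apply: onW_bij; exists (fun t => (tx t, ta t, te t)) => [[[x a] e]|t] /=.
  by rewrite tx_mkreg ta_mkreg te_mkreg.
exact: mkregK.
Qed.

Lemma restr_eq K t u : (restr K t == restr K u) = [forall k, (k \in K) ==> (t k == u k)].
Proof.
apply/eqP/forallP => [h k|h].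
  apply/implyP => kK; apply/eqP.
  by have := congr1 (fun g : {dffun forall s : {l : Lab m | l \in K}, Sys dX dA' dE (val s)} => g (Sub k kK)) h; rewrite !ffunE.
by apply/ffunP => s; rewrite !ffunE; apply/eqP; exact: (implyP (h (val s)) (valP s)).
Qed.

(** The labels outside [K] are filled from [t0]. *)
Lemma restr_lift K (t0 : FT) (a : {dffun forall s : {l : Lab m | l \in K}, Sys dX dA' dE (val s)}) :
  exists t, restr K t = a.
Proof.
exists (@finfun _ (fun k => Finite.sort (Sys dX dA' dE k)) (fun k =>
  match @idP (k \in K) with ReflectT h => a (Sub k h) | ReflectF _ => t0 k end)).
apply/ffunP => -[k hk]; rewrite !ffunE /=.
case: {-}_ / idP => [h|]; last by move/(_ hk).
by rewrite (bool_irrelevance hk h).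
Qed.

Section Label.
Variable l : Lab m.
Hypothesis lX : forall j, l != LX j.

Lemma setreg (t0 : FT) (x : X1) (s : Sys dX dA' dE l) :
  exists t, tx t = x /\ t l = s.
Proof.
exists (@finfun _ (fun k => Finite.sort (Sys dX dA' dE k)) (fun k =>
  match l =P k with
  | ReflectT h => ecast k (Sys dX dA' dE k) h s
  | ReflectF _ => match k return Sys dX dA' dE k with
    | inl (inl j) => x j | k' => t0 k' end end)).
split.
  apply/ffunP => j; rewrite !ffunE /=.
  by case: eqP => // h; move: (lX j); rewrite {1}h eqxx.
by rewrite ffunE; case: eqP => // h; rewrite eq_axiomK.
Qed.

Lemma restr_XS (J : {set 'I_m}) t u :
  (restr (XS J :|: [set l]) t == restr (XS J :|: [set l]) u) =
  (J \subset agree (tx t) (tx u)) && (t l == u l).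
Proof.
rewrite restr_eq; apply/forallP/andP => [h|[/fintype.subsetP hJ hl] k].
  split; last by have := h l; rewrite !inE eqxx orbT.
  apply/fintype.subsetP => j jJ; rewrite inE !ffunE.
  by have := h (LX j); rewrite !inE imset_f.
apply/implyP; rewrite !inE => /orP[/imsetP[j jJ ->]|/eqP -> //].
by have := hJ j jJ; rewrite inE !ffunE.
Qed.

Definition offl t u : bool :=
  [forall k, [|| k \in XS [set: 'I_m], k == l | t k == u k]].

(** Once the [X] registers agree, the condition no longer depends on [J]; this is why one reduced
    operator serves the marginals for all [J]. *)
Lemma restr_off (J : {set 'I_m}) t u : tx t = tx u ->
  (restr (~: (XS J :|: [set l])) t == restr (~: (XS J :|: [set l])) u) = offl t u.
Proof.
move=> tu; rewrite restr_eq; apply/forallP/forallP => h k; have := h k.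
  rewrite !inE negb_or; case: (boolP (k == l)) => //= kl; first by rewrite orbT.
  rewrite andbT; case: (boolP (k \in XS J)) => //= [/imsetP[j _ ->] _|_ ->].
    by rewrite imset_f ?inE.
  by rewrite orbT.
case/or3P => [/imsetP[j _ ->]|/eqP ->|/eqP ->]; last by rewrite eqxx implybT.
  move/ffunP/(_ j): tu; rewrite !ffunE => ->; by rewrite eqxx implybT.
by rewrite !inE eqxx orbT.
Qed.

Variable R : realType.
Variable w : Op R FT.
Hypothesis blk : forall t u, tx t != tx u -> w t u = 0.

Definition redop (x : X1) : Op R (Sys dX dA' dE l) := fun s s' =>
  \sum_t \sum_u ([&& tx t == x, tx u == x, t l == s, u l == s' & offl t u])%:R * w t u.

(** [w] is block diagonal in the [X] registers, so the traced double sum runs over a common string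
    [y], and the [y] that agree with the given string on [J] add up to the block. *)
Lemma marg_redop (J : {set 'I_m}) t0 u0 :
  @marg _ _ _ (XS J :|: [set l]) w (restr _ t0) (restr _ u0) =
  (J \subset agree (tx t0) (tx u0))%:R * omA redop J (tx t0) (t0 l) (u0 l).
Proof.
rewrite /marg /omA mulr_sumr.
transitivity (\sum_t \sum_u \sum_(y | J \subset agree (tx t0) y)
    (J \subset agree (tx t0) (tx u0))%:R *
    (([&& tx t == y, tx u == y, t l == t0 l, u l == u0 l & offl t u])%:R * w t u)); last first.
  under eq_bigr do rewrite exchange_big /=.
  rewrite exchange_big; apply: eq_bigr => y _ /=.
  rewrite /redop mulr_sumr; apply: eq_bigr => t _; by rewrite mulr_sumr.
apply: eq_bigr => t _; apply: eq_bigr => u _.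
have [tu|/blk ->] := eqVneq (tx t) (tx u); last first.
  by rewrite mulr0 big1 // => y _; rewrite !mulr0.
rewrite restr_off // !restr_XS -tu.
rewrite -mulr_sumr -mulr_suml mulrA; congr (_ * _).
rewrite -natr_sum -natrM; congr _%:R.
have -> : (\sum_(y | J \subset agree (tx t0) y) [&& tx t == y, tx t == y, t l == t0 l, u l == u0 l & offl t u])%N
   = (J \subset agree (tx t0) (tx t)) && [&& t l == t0 l, u l == u0 l & offl t u] :> nat.
  rewrite big_mkcond (bigD1 (tx t)) //= big1 ?addn0 => [|y /negPf yt].
    by rewrite eqxx /=; case: (J \subset _).
  by rewrite eq_sym yt /=; case: ifP.
rewrite mulnb; congr nat_of_bool.
rewrite agreeC (agreeC (tx t)).
case: (boolP (J \subset agree (tx t0) (tx t))) => /= h; last by rewrite andbF.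
have -> : J \subset agree (tx t0) (tx u0) = (J \subset agree (tx u0) (tx t)).
  apply/idP/idP => h'; last by apply: (agree_trans h); rewrite agreeC.
  by apply: agree_trans h; rewrite agreeC.
by case: (t l == _) => /=; rewrite ?andbF // andbA.
Qed.

End Label.

End Registers.

Section MarginalEntropy.
Variable R : realType.
Local Notation C := (R[i]).
Variables (m : nat) (dX dA' : 'I_m -> nat) (dE : nat).
Local Notation X1 := {dffun forall j : 'I_m, 'I_(dX j)}.
Local Notation FT := {dffun forall k : Lab m, Sys dX dA' dE k}.
Variable l : Lab m.
Hypothesis lX : forall j, l != LX j.
Variable w : Op R FT.
Hypothesis blk : forall t u : FT, tx t != tx u -> w t u = 0.
Variable t0 : FT.
Local Notation T := (Sys dX dA' dE l).
Variables (f : {set 'I_m} -> X1 -> T -> T -> C) (q : {set 'I_m} -> X1 -> T -> R).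
Hypothesis sf : spectral_family (redop w) f q.
Variable J : {set 'I_m}.
Local Notation K := (XS J :|: [set l]).
Local Notation MT := {dffun forall s : {k : Lab m | k \in K}, Sys dX dA' dE (val s)}.

Lemma frame_complete S x i j : \sum_k f S x k i * (f S x k j)^* = (i == j)%:R.
Proof.
have o k k' : ip (f S x k) (f S x k') = (k == k')%:R by exact: (f_orth sf).
have U : unitary (fun k i => (f S x k i)^*).
  move=> k k'; rewrite -o /ip; apply: eq_bigr => t _; by rewrite conjK.
by rewrite -(unitary_cols U i j); apply: eq_bigr => k _; rewrite conjK.
Qed.

(** The eigenvectors of the blocks, placed at the class of [x], form an overcomplete frame: each
    occurs once for every [x] in the class. Weighting by the inverse class size restores
    completeness without choosing representatives, and [spec_sum_frame] reads off the entropy;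
    [ln 2] changes nats to bits. *)
Lemma entropy_redop : entropy (@marg _ _ _ K w) = ent f q J / ln 2.
Proof.
have [lift liftK] := boolp.choice (fun a : MT => restr_lift t0 a).
have [mk mkP] := boolp.choice (fun p : X1 * T => setreg lX t0 p.1 p.2).
have liftE (t : FT) : J \subset agree (tx (lift (restr K t))) (tx t) /\ lift (restr K t) l = t l.
  by have /eqP := liftK (restr K t); rewrite restr_XS => /andP[-> /eqP ->].
pose tl (a : MT) := tx (lift a).
have sum_cls x (G : T -> C) :
    \sum_(a : MT) (J \subset agree x (tl a))%:R * G (lift a l) = \sum_s G s.
  rewrite (eq_bigr (fun a => if J \subset agree x (tl a) then G (lift a l) else 0)); last first.
    by move=> a _; case: ifP => _; rewrite ?mul1r ?mul0r.
  rewrite -big_mkcond (reindex_onto (fun s => restr K (mk (x, s))) (fun a => lift a l)) /=.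
    apply: eq_big => [s|s _]; last by rewrite (liftE _).2 (mkP (x, s)).2.
    rewrite (liftE _).2 (mkP (x, s)).2 eqxx andbT /tl agreeC.
    by have := (liftE (mk (x, s))).1; rewrite (mkP (x, s)).1.
  move=> a ha; rewrite -[RHS]liftK; apply/eqP; rewrite restr_XS (mkP (x, lift a l)).1.
  by rewrite ha (mkP (x, lift a l)).2 eqxx.
have margE a b : @marg _ _ _ K w a b =
    (J \subset agree (tl a) (tl b))%:R * omA (redop w) J (tl a) (lift a l) (lift b l).
  by rewrite -{1}(liftK a) -{1}(liftK b) marg_redop.
pose c (x : X1) : R := (#|cls J x|)%:R^-1.
have c_cls x y : J \subset agree x y -> c x = c y by rewrite -cls_eq => /eqP h; rewrite /c h.
have c_sum x : \sum_(y | J \subset agree x y) c y = 1.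
  rewrite (eq_bigr (fun=> c x)) => [|y h]; last by rewrite (c_cls _ _ h).
  rewrite sumr_const (eq_card (_ : _ =i cls J x)); last by move=> y; rewrite !inE.
  rewrite -mulr_natr mulVf // pnatr_eq0 -lt0n; apply/card_gt0P; exists x.
  by rewrite inE agreexx finset.subsetT.
(* This turns the class weights into the law [rw]: summed over the class, the diagonal entries of
   the [om y] in the eigenbasis of the block give its eigenvalue. *)
have q_rw x k : q J x k = \sum_(y | J \subset agree x y) rw f q J y k.
  transitivity (\sum_i q J x i * n2 (ip (f J x i) (f J x k))).
    rewrite (bigD1 k) //= (f_orth sf) eqxx (n2_bool R true) mulr1 big1 ?addr0 // => i /negPf ik.
    by rewrite (f_orth sf) ik n2_0 mulr0.
  rewrite -(quad_omA_sum sf); apply: eq_bigr => y h; rewrite /rw.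
  by case: sf => _ _ _ /(_ J x y h) [-> _] _.
pose F (z : X1 * T) (a : MT) : C := (J \subset agree z.1 (tl a))%:R * f J z.1 z.2 (lift a l).
rewrite /entropy (@spec_sum_frame _ _ _ _ _ (fun z => c z.1) F (fun z => q J z.1 z.2)).
- transitivity (- (\sum_x \sum_k (\sum_(y | J \subset agree x y) c x * (rw f q J y k * ln (q J y k)))) / ln 2).
    rewrite -sumrN mulr_suml -(pair_bigA _ (fun x k => c x * - (q J x k * log2 (q J x k)))).
    apply: eq_bigr => x _; rewrite -sumrN mulr_suml; apply: eq_bigr => k _ /=.
    rewrite mulrN /log2 [in RHS]mulNr; congr (- _).
    rewrite {1}q_rw !mulr_suml mulr_sumr; apply: eq_bigr => y h.
    case: sf => _ _ _ /(_ J x y h) [_ <-] _; ring.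
  rewrite /ent; congr (- _ / _).
  transitivity (\sum_y \sum_k \sum_(x | J \subset agree y x) c x * (rw f q J y k * ln (q J y k))).
    rewrite exchange_big [RHS]exchange_big; apply: eq_bigr => k _ /=.
    rewrite (exchange_big_dep xpredT) //=; apply: eq_bigr => y _.
    by apply: eq_bigl => x; rewrite agreeC.
  by apply: eq_bigr => y _; apply: eq_bigr => k _; rewrite -mulr_suml c_sum mul1r.
- move=> a b; rewrite !margE agreeC conjM conj_nat.
  case: (boolP (J \subset agree (tl a) (tl b))) => h; last by rewrite !mul0r.
  rewrite !mul1r; case: sf => _ _ oE /(_ J _ _ h) [fE qE] _.
  rewrite !oE conj_sum; apply: eq_bigr => k _.
  by rewrite -fE -qE !conjM conjK conj_rc; ring.
- move=> a b.
  rewrite -(pair_bigA _ (fun x k => rc (c x) * F (x, k) a * (F (x, k) b)^*)) /=.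
  transitivity (\sum_x rc (c x) * ((J \subset agree x (tl a)) && (J \subset agree x (tl b)))%:R
      * (lift a l == lift b l)%:R).
    apply: eq_bigr => x _; rewrite -(frame_complete J x) mulr_sumr; apply: eq_bigr => k _.
    by rewrite /F /= conjM conj_nat -mulnb natrM; ring.
  have -> : (a == b) = (J \subset agree (tl a) (tl b)) && (lift a l == lift b l).
    by rewrite -restr_XS !liftK.
  rewrite -mulnb natrM -mulr_suml; congr (_ * _).
  case: (boolP (J \subset agree (tl a) (tl b))) => h.
    transitivity (rc (\sum_(x | J \subset agree (tl a) x) c x)); last by rewrite c_sum rc1.
    rewrite rc_sum [in RHS]big_mkcond; apply: eq_bigr => x _.
    rewrite agreeC; case: (boolP (J \subset agree (tl a) x)) => /= h'; last by rewrite mulr0.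
    by rewrite agreeC in h'; rewrite (agree_trans h' h) mulr1.
  apply: big1 => x _; case: (boolP (_ && _)) => [/andP[h1 h2]|]; last by rewrite mulr0.
  by case/negP: h; apply: agree_trans h2; rewrite agreeC.
- move=> [x k]; apply: rc_inj; have o : ip (f J x k) (f J x k) = 1 by rewrite (f_orth sf) eqxx.
  rewrite rc1 rc_vn -o.
  rewrite /ip -(sum_cls x (fun s => (f J x k s)^* * f J x k s)); apply: eq_bigr => a _.
  by rewrite /F /=; case: (_ \subset _); rewrite ?mul1r ?mul0r ?mulr0.
- move=> [x k] a; rewrite /F /=.
  transitivity (\sum_b (J \subset agree x (tl b))%:R *
     ((J \subset agree x (tl a))%:R * omA (redop w) J x (lift a l) (lift b l) * f J x k (lift b l))).
    apply: eq_bigr => b _; rewrite margE.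
    case: (boolP (J \subset agree x (tl a))) => h; last first.
      case: (boolP (J \subset agree x (tl b))) => h'; last by rewrite !mul0r mulr0.
      suff /negPf -> : ~~ (J \subset agree (tl a) (tl b)) by rewrite !mul0r mulr0.
      by apply: contra h => h; apply: (agree_trans h'); rewrite agreeC.
    have -> : J \subset agree (tl a) (tl b) = (J \subset agree x (tl b)).
      by apply/idP/idP => h'; [apply: (agree_trans h) | apply: agree_trans h'; rewrite agreeC].
    have -> : omA (redop w) J (tl a) = omA (redop w) J x :> Op R T.
      case: sf => _ _ oE /(_ J _ _ h) [fE qE] _.
      by apply/funext => i; apply/funext => j; rewrite !oE -fE -qE.
    by case: (J \subset _); rewrite ?mul1r ?mul0r.
  rewrite (sum_cls x (fun s => (J \subset agree x (tl a))%:R * omA (redop w) J x (lift a l) s * f J x k s)).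
  under eq_bigr do rewrite -mulrA.
  rewrite -mulr_sumr mulrCA; congr (_ * _).
  case: sf => o _ oE _ _; under eq_bigr do rewrite oE mulr_suml.
  rewrite exchange_big (bigD1 k) //= [X in _ + X]big1 ?addr0 => [|i /negPf ik].
    transitivity (rc (q J x k) * f J x k (lift a l) * ip (f J x k) (f J x k)).
      by rewrite /ip mulr_sumr; apply: eq_bigr => s _; ring.
    by rewrite o eqxx mulr1.
  transitivity (rc (q J x i) * f J x i (lift a l) * ip (f J x i) (f J x k)).
    by rewrite /ip mulr_sumr; apply: eq_bigr => s _; ring.
  by rewrite o ik mulr0.
Qed.

End MarginalEntropy.

Section OmegaEntropy.
Variable R : realType.
Local Notation C := (R[i]).
Variables (m : nat) (dA : 'I_m -> nat) (dE : nat).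
Variable rho : Op R ({dffun forall j : 'I_m, 'I_(dA j)} * 'I_dE)%type.
Variables (dX dA' : 'I_m -> nat).
Variable F : forall j : 'I_m, 'I_(dX j) -> Map R 'I_(dA j) 'I_(dA' j).
Hypothesis hrho : is_state rho.
Hypothesis hF : forall j : 'I_m, instrument (@F j).
Local Notation X1 := {dffun forall j : 'I_m, 'I_(dX j)}.
Local Notation FT := {dffun forall k : Lab m, Sys dX dA' dE k}.
Local Notation w := (@omega R m dA dX dA' dE rho F).
Local Notation post1 := (@post R m dA dE rho dX dA' F).

Lemma omegaE (t u : FT) :
  w t u = (tx t == tx u)%:R * post1 (tx t) (ta t, te t) (ta u, te u).
Proof.
rewrite /omega; congr (_ * _).
  rewrite dffun_eq_prod forall_prodr; apply: eq_bigr => j _; by rewrite !ffunE.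
apply: eq_bigr => c _; apply: eq_bigr => c' _; congr (_ * _).
by apply: eq_bigr => j _; rewrite !ffunE.
Qed.

Lemma omega_blk (t u : FT) : tx t != tx u -> w t u = 0.
Proof. by rewrite omegaE => /negPf ->; rewrite mul0r. Qed.

Lemma redop_omega (l : Lab m) x s s' :
  @redop m dX dA' dE l R w x s s' = \sum_a \sum_e \sum_a' \sum_e'
   ([&& mkreg x a e l == s, mkreg x a' e' l == s' & offl l (mkreg x a e) (mkreg x a' e' : FT)])%:R *
   post1 x (a, e) (a', e').
Proof.
rewrite /redop sum_reg (bigD1 x) //= [X in _ + X]big1 ?addr0; last first.
  move=> y /negPf yx; apply: big1 => a _; apply: big1 => e _; apply: big1 => u _.
  by rewrite tx_mkreg yx mul0r.
apply: eq_bigr => a _; apply: eq_bigr => e _.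
rewrite sum_reg (bigD1 x) //= [X in _ + X]big1 ?addr0; last first.
  move=> y /negPf yx; apply: big1 => a' _; apply: big1 => e' _.
  by rewrite tx_mkreg eqxx tx_mkreg yx mul0r.
apply: eq_bigr => a' _; apply: eq_bigr => e' _.
by rewrite omegaE !tx_mkreg !ta_mkreg !te_mkreg eqxx mul1r.
Qed.

Lemma redop_player j x : @redop m dX dA' dE (LA j) R w x = @player1 R m dA dE rho dX dA' F j x.
Proof.
apply/funext => s; apply/funext => s'; rewrite redop_omega /player1.
apply: eq_bigr => a _; rewrite exchange_big; apply: eq_bigr => a' _ /=.
rewrite exchange_big; apply: eq_bigr => e _ /=.
rewrite (bigD1 e) //= [X in _ + X]big1 ?addr0.
  congr ((nat_of_bool _)%:R * _); rewrite !ffunE /coincide -andbA; congr [&& _, _ & _].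
  apply/forallP/forallP => h.
    move=> i; have := h (LA i); rewrite !ffunE.
    case/or3P => [/imsetP[]//|/eqP[->]|->]; by rewrite ?eqxx ?orbT.
  case=> [[i|i]|[]]; rewrite !ffunE ?eqxx ?orbT //.
  by have /orP[/eqP ->|->] := h i; rewrite ?eqxx ?orbT.
move=> e' ne; rewrite (_ : offl _ _ _ = false) ?andbF ?mul0r //.
apply/negbTE/forallPn; exists (LE m); rewrite !ffunE !negb_or ne /= andbT.
by apply/imsetP => -[].
Qed.

Lemma redop_eve x : @redop m dX dA' dE (LE m) R w x = eve1 rho F x.
Proof.
apply/funext => s; apply/funext => s'; rewrite redop_omega /eve1.
apply: eq_bigr => a _; under eq_bigr do rewrite exchange_big /=.
rewrite (bigD1 s) //= [X in _ + X]big1 ?addr0; last first.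
  move=> e /negPf es; apply: big1 => e' _; apply: big1 => a' _.
  by rewrite !ffunE es mul0r.
rewrite (bigD1 s') //= [X in _ + X]big1 ?addr0; last first.
  move=> e /negPf es; apply: big1 => a' _.
  by rewrite !ffunE es andbF mul0r.
rewrite (bigD1 a) //= [X in _ + X]big1 ?addr0.
  rewrite !ffunE !eqxx /= (_ : offl _ _ _ = true) ?mul1r //.
  by apply/forallP => -[[i|i]|[]]; rewrite !ffunE ?eqxx ?orbT // imset_f ?inE.
move=> a' ne; rewrite (_ : offl _ _ _ = false) ?andbF ?mul0r //.
apply/negbTE/forallPn; have : ~~ [forall i, a' i == a i].
  by apply: contra ne => /forallP h; apply/eqP/ffunP => i; exact/eqP/h.
case/forallPn => i hi; exists (LA i); rewrite !ffunE !negb_or /= eq_sym hi andbT.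
by apply/imsetP => -[].
Qed.

(** An empty register would make the total trace 0 instead of 1. *)
Lemma reg_inhabited : exists t : FT, True.
Proof.
case: (pickP (fun=> true) : pick_spec (fun _ : FT => true) _) => [t _|h]; first by exists t.
exfalso; have : (0 : C) = 1; last by move/eqP; rewrite eq_sym oner_eq0.
rewrite -(post_trace hrho hF) big1 // => x _; rewrite /tr big1 // => -[a e] _.
by have := h (mkreg x a e).
Qed.

Section Player.
Variable j : 'I_m.
Variables (f : {set 'I_m} -> X1 -> 'I_(dA' j) -> 'I_(dA' j) -> C)
  (q : {set 'I_m} -> X1 -> 'I_(dA' j) -> R).
Hypothesis sf : spectral_family (@player1 R m dA dE rho dX dA' F j) f q.

Lemma condS_player (J : {set 'I_m}) :
  condS (XS J) (XS (~: J) :|: [set LA j]) w =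
  (ent f q [set: 'I_m] - ent f q (~: J)) / ln 2.
Proof.
have [t0 _] := reg_inhabited.
have lX i : LA j != LX i by [].
have sf' : spectral_family (@redop m dX dA' dE (LA j) R w) f q.
  by have -> : @redop m dX dA' dE (LA j) R w = @player1 R m dA dE rho dX dA' F j
    by apply/funext => x; exact: redop_player.
rewrite /condS finset.setUA -imsetU finset.setUCr.
rewrite (entropy_redop lX omega_blk t0 sf' [set: 'I_m]).
by rewrite (entropy_redop lX omega_blk t0 sf' (~: J)) mulrBl.
Qed.
End Player.

Section Eve.
Variables (f : {set 'I_m} -> X1 -> 'I_dE -> 'I_dE -> C) (q : {set 'I_m} -> X1 -> 'I_dE -> R).
Hypothesis sf : spectral_family (eve1 rho F) f q.

(** Conditioning on [E] alone is the case of the empty set, whose block is the total state of the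
    eavesdropper. *)
Lemma condS_eve :
  condS (XS [set: 'I_m]) [set LE m] w = (ent f q [set: 'I_m] - ent f q finset.set0) / ln 2.
Proof.
have [t0 _] := reg_inhabited.
have lX i : LE m != LX i by [].
have sf' : spectral_family (@redop m dX dA' dE (LE m) R w) f q.
  by have -> : @redop m dX dA' dE (LE m) R w = eve1 rho F
    by apply/funext => x; exact: redop_eve.
rewrite /condS (entropy_redop lX omega_blk t0 sf' [set: 'I_m]).
have E0 := entropy_redop lX omega_blk t0 sf' finset.set0.
by rewrite /XS imset0 finset.set0U in E0; rewrite E0 mulrBl.
Qed.
End Eve.

End OmegaEntropy.

(** * Rates *)

Section FiniteBlocklength.
Variable R : realType.
Local Notation C := (R[i]).
Local Notation Re := (@complex.Re R).
Variables (m : nat) (dA : 'I_m -> nat) (dE : nat).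
Variable rho : Op R ({dffun forall j : 'I_m, 'I_(dA j)} * 'I_dE)%type.
Variables (dX dA' : 'I_m -> nat).
Variable F : forall j : 'I_m, 'I_(dX j) -> Map R 'I_(dA j) 'I_(dA' j).
Hypothesis hrho : is_state rho.
Hypothesis hF : forall j : 'I_m, instrument (@F j).
Local Notation X1 := {dffun forall j : 'I_m, 'I_(dX j)}.
Local Notation full := [set: 'I_m].
Local Notation M := (#|{set 'I_m}|%:R : R).
Variables (pf : forall j, {set 'I_m} -> X1 -> 'I_(dA' j) -> 'I_(dA' j) -> C)
  (pq : forall j, {set 'I_m} -> X1 -> 'I_(dA' j) -> R).
Hypothesis psf : forall j,
  spectral_family (@player1 R m dA dE rho dX dA' F j) (@pf j) (@pq j).
Variables (gf : {set 'I_m} -> X1 -> 'I_dE -> 'I_dE -> C) (gq : {set 'I_m} -> X1 -> 'I_dE -> R).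
Hypothesis esf : spectral_family (eve1 rho F) gf gq.

(** One constant above all the variances, so that a single Chebyshev bound [v] serves every player,
    every set and the eavesdropper. *)
Definition total_lvar : R :=
  \sum_j \sum_S lvar (@pf j) (@pq j) S + \sum_S lvar gf gq S.

Lemma lvar_ge0 (A : 'I_m -> finType) (T : finType) (om : {dffun forall j, A j} -> Op R T) f q S :
  spectral_family om f q -> 0 <= lvar f q S.
Proof.
move=> sf; apply: sumr_ge0 => x _; apply: sumr_ge0 => k _.
by rewrite mulr_ge0 ?sqr_ge0 // (rw_ge0 sf).
Qed.

Lemma total_lvar_ge0 : 0 <= total_lvar.
Proof.
apply: addr_ge0; last by apply: sumr_ge0 => S _; apply: lvar_ge0 esf.
by apply: sumr_ge0 => j _; apply: sumr_ge0 => S _; apply: lvar_ge0 (psf j).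
Qed.

Lemma lvar_player_total j : \sum_S lvar (@pf j) (@pq j) S <= total_lvar.
Proof.
rewrite /total_lvar (bigD1 j) //= -addrA lerDl addr_ge0 //.
  by apply: sumr_ge0 => i _; apply: sumr_ge0 => S _; apply: lvar_ge0 (psf i).
by apply: sumr_ge0 => S _; apply: lvar_ge0 esf.
Qed.

Lemma lvar_eve_total S : lvar gf gq S <= total_lvar.
Proof.
rewrite /total_lvar addrC (bigD1 S) //= -addrA lerDl addr_ge0 //.
  by apply: sumr_ge0 => i _; apply: lvar_ge0 esf.
by apply: sumr_ge0 => j _; apply: sumr_ge0 => i _; apply: lvar_ge0 (psf j).
Qed.

Variables (n : nat) (d u c : R) (N : 'I_m -> nat) (K : nat) (j1 : 'I_m).
Hypothesis n0 : (0 < n)%N.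
Hypothesis d0 : 0 < d.
Hypothesis u01 : 0 < u <= 1.
Hypothesis N0 : forall i, (0 < N i)%N.
Hypothesis K0 : (0 < K)%N.
Hypothesis c0 : 0 <= c.
Hypothesis binning_rate : forall j (S : {set 'I_m}), j \in S -> S != full ->
  expR (n%:R * (ent (@pf j) (@pq j) full - ent (@pf j) (@pq j) S + 2 * d)) *
  \prod_(i in ~: S) (N i)%:R^-1 <= c.
Hypothesis key_rate :
  expR (n%:R * (ent gf gq finset.set0 - ent gf gq full + 2 * d)) * K%:R * \prod_i (N i)%:R <= u ^+ 2.
Local Notation v := (total_lvar / (n%:R * d ^+ 2)).
Local Notation Xn := {dffun forall j : 'I_m, {ffun 'I_n -> 'I_(dX j)}}.
Local Notation code := {dffun forall i : 'I_m, {ffun {ffun 'I_n -> 'I_(dX i)} -> 'I_(N i)}}.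
Local Notation label := {dffun forall i : 'I_m, 'I_(N i)}.
Local Notation pqn j := (q_n (n := n) (@pq j)).
Local Notation pfn j := (f_n (n := n) (@pf j)).
Local Notation eqn := (q_n (n := n) gq).
Local Notation efn := (f_n (n := n) gf).
Local Notation ty j := (expR (- (n%:R * (ent (@pf j) (@pq j) full + d)))).
Local Notation theta j := (fun S => expR (- (n%:R * (ent (@pf j) (@pq j) S - d)))).

Let psn j := product_family n (psf j).
Let esn := product_family n esf.

Lemma v_ge0 : 0 <= v.
Proof. by rewrite divr_ge0 ?total_lvar_ge0 // mulr_ge0 ?ler0n ?sqr_ge0. Qed.

Lemma lvar_v (l : R) : l <= total_lvar -> l / (n%:R * d ^+ 2) <= v.
Proof. by move=> h; rewrite ler_pM2r // invr_gt0 mulr_gt0 ?ltr0n ?exprn_gt0. Qed.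

Lemma atyp_le j : atyp (pqn j) (ty j) <= v.
Proof.
have lS : lvar (@pf j) (@pq j) full <= total_lvar.
  apply: le_trans (lvar_player_total j); rewrite (bigD1 full) //= lerDl.
  by apply: sumr_ge0 => S _; apply: lvar_ge0 (psf j).
apply: le_trans (lvar_v lS); apply: le_trans (aep_high (psf j) full n0 d0).
apply: eq_ler; apply: eq_bigr => x _.
apply: eq_big => [k|k _]; first by rewrite /typical -ltNge.
by rewrite (rw_full (psn j)).
Qed.

Lemma evict_le j : evict (pfn j) (pqn j) j (theta j) <= v.
Proof.
apply: le_trans (lvar_v (lvar_player_total j)).
rewrite mulr_suml [X in X <= _]big_mkcond; apply: ler_sum => S _ /=.
case: ifP => _; first exact: (aep_low (psf j) S n0 d0).
by rewrite divr_ge0 ?(lvar_ge0 _ (psf j)) // mulr_ge0 ?ler0n ?sqr_ge0.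
Qed.

Lemma confusion_ge0 j (cd : code) : 0 <= confusion (pfn j) (pqn j) j (theta j) (ty j) cd.
Proof.
apply: sumr_ge0 => x _; apply: sumr_ge0 => k _; rewrite mulr_ge0 ?(q_ge0 (psn j)) //.
by apply: sumr_ge0 => y _; rewrite mulr_ge0 ?ler0n ?n2_ge0.
Qed.

(** Averaging the sum of the confusions over the players yields one code for all; [M] bounds the
    number of sets. In [binning_rate], one [d] comes from the count of typical pairs and the other
    from the eigenvalue threshold. *)
Lemma good_code : exists cd : code, forall j,
  confusion (pfn j) (pqn j) j (theta j) (ty j) cd <= m%:R * M * c.
Proof.
have code0 : (0 < #|{: code}|)%N.
  by apply/card_gt0P; exists (@finfun _ (fun i => {ffun {ffun 'I_n -> 'I_(dX i)} -> 'I_(N i)})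
    (fun i => [ffun=> Ordinal (N0 i)])).
have [cd hcd] := ex_le_avg (fun cd : code =>
   \sum_j confusion (pfn j) (pqn j) j (theta j) (ty j) cd) code0.
exists cd => j; apply: le_trans (_ : \sum_j confusion (pfn j) (pqn j) j (theta j) (ty j) cd <= _).
  by rewrite (bigD1 j) //= lerDl; apply: sumr_ge0 => i _; exact: confusion_ge0.
apply: le_trans hcd _; rewrite avg_sum -mulrA.
have -> : m%:R * (M * c) = \sum_(i < m) M * c by rewrite sum_cst card_ord.
apply: ler_sum => i _.
apply: le_trans (confusion_avg (psn i) i N0 (expR_gt0 _) (fun S => expR_ge0 _)) _.
rewrite -sum_cst mulr_suml big_mkcond; apply: ler_sum => S _ /=.
case: ifP => [/andP[iS Sf]|_ //].
apply: le_trans (binning_rate iS Sf).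
rewrite mulrAC -expRN opprK -expRD ler_wpM2r //.
  by rewrite prodr_ge0 // => k _; rewrite invr_ge0 ler0n.
by rewrite ler_expR; apply: eq_ler; ring.
Qed.

Lemma typical_tail :
  tail (eqn full) (fun x k => eqn full x k <= expR (- (n%:R * (ent gf gq full - d)))) <= v.
Proof.
apply: le_trans (lvar_v (lvar_eve_total full)); apply: le_trans (aep_low esf full n0 d0).
apply: eq_ler; apply: eq_bigr => x _.
apply: eq_big => [k|k _]; first by rewrite -ltNge.
by rewrite (rw_full esn).
Qed.

Variable x0 : Xn.
Local Notation G := (fun h => expR (- (n%:R * (ent gf gq finset.set0 + d))) <= eqn finset.set0 x0 h).

(** All strings agree on the empty set, so the basis at the arbitrary reference string [x0] is an
    eigenbasis of the total state of the eavesdropper, and the spill is the upper tail of its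
    entropy. *)
Lemma spill_le : spill (efn full) (eqn full) (efn finset.set0 x0) G <= v.
Proof.
apply: le_trans (lvar_v (lvar_eve_total finset.set0)).
apply: le_trans (aep_high esf finset.set0 n0 d0).
apply: eq_ler; apply: eq_bigr => x _.
have [fE qE] : efn finset.set0 x = efn finset.set0 x0 /\ eqn finset.set0 x = eqn finset.set0 x0.
  by case: esn => _ _ _ h _; apply: h; exact: finset.sub0set.
under eq_bigr do rewrite mulr_sumr.
rewrite exchange_big /= qE; apply: eq_big => [k|k _]; first by rewrite -ltNge.
by rewrite /rw fE; apply: eq_bigr => h _; rewrite n2_ipC.
Qed.

Lemma card_typical : #|G|%:R <= expR (n%:R * (ent gf gq finset.set0 + d)).
Proof.
rewrite -[X in _ <= X]mul1r -[X in _ <= _ * X]invrK -expRN ler_pdivlMr ?expR_gt0 //.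
apply: le_trans (q_sum_le1 esn finset.set0 x0).
rewrite (bigID G) /= -[X in X <= _]addr0 lerD //; last first.
  by apply: sumr_ge0 => k _; exact: (q_ge0 esn).
rewrite [X in X <= _]mulr_natl -sumr_const.
exact: (@ler_sum _ _ _ G).
Qed.

(** The error adds the decoding errors of all [m] players, for agreement, to the leakage bound, for
    secrecy. *)
Lemma good_binning : exists P : protocol R dA n,
  [/\ nlab P = N, nkey P = K &
   good_protocol P j1 rho (m%:R * (v + (8 + 18 * M) * u +
      (2 * M ^+ 2 * v + 6 * (m%:R * M * c)) / u ^+ 3) + (5 * u + 2 * v + v / u))].
Proof.
have [u0 u1] := andP u01.
have [cd hcd] := good_code.
pose tau : R := expR (- (n%:R * (ent gf gq full - d))).
pose Nt : R := expR (n%:R * (ent gf gq finset.set0 + d)) * K%:R * \prod_i (N i)%:R.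
have Nt0 : 0 < Nt.
  by rewrite !mulr_gt0 ?expR_gt0 ?ltr0n // prodr_gt0 // => i _; rewrite ltr0n.
have cardL : #|{: label}|%:R = \prod_i (N i)%:R :> R.
  rewrite -natr_prod card_dep_ffun foldrE big_map big_enum /=.
  by under eq_bigr do rewrite card_ord.
have GN : #|G|%:R * K%:R * #|{: label}|%:R <= Nt.
  rewrite cardL ler_wpM2r ?prodr_ge0 //.
  by rewrite ler_wpM2r ?ler0n //; exact: card_typical.
have Nu : Nt * tau <= u ^+ 2.
  apply: le_trans key_rate; rewrite /Nt /tau mulrAC (mulrAC _ _ (expR _)) -expRD.
  apply: eq_ler; congr (expR _ * _ * _); ring.
(* The key function is chosen for the code already fixed, whose label plays the role of the message
   function; the decoders below are built for this [g]. *)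
have [g hg] := privacy_amplification (e := efn full) (p := eqn full) (om := om_n (eve1 rho F)) (b := efn finset.set0 x0)
   (enc_n cd) K0 (om_q esn) (f_orth esn full) (f_orth esn finset.set0 x0) (q_ge0 esn full)
   (q_sum1 esn) (fun x k h => h) (expR_ge0 _) u0 Nt0 GN Nu.
have hD j : {D | (forall a lab, povm (D a lab)) /\ 
    \sum_x \sum_k pqn j full x k * (1 - Re (quad (D (x j) (enc cd x) (g x)) (pfn j full x k))) <=
     err (pfn j) (pqn j) j (theta j) (ty j) u cd}.
  by apply: cid; exact: (decode_code (psn j) j (theta j) (ty j) u01 (Ordinal K0) cd g).
pose D j := sval (hD j).
have pD j x l : povm (@D j x l) by have [h _] := svalP (hD j); exact: h.
exists (binning_protocol F cd D); split=> //.
set er : R := v + _ + _.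
have v0 := v_ge0.
have er0 : 0 <= er.
  rewrite /er !addr_ge0 // ?divr_ge0 ?exprn_ge0 ?(ltW u0) //.
    by rewrite mulr_ge0 ?(ltW u0) // addr_ge0 // mulr_ge0 ?ler0n.
  by apply: addr_ge0; apply: mulr_ge0 => //; rewrite !mulr_ge0 ?exprn_ge0 ?ler0n.
have b0 : 0 <= 5 * u + 2 * v + v / u.
  by apply: addr_ge0; [apply: addr_ge0; apply: mulr_ge0|apply: divr_ge0]; rewrite // ltW.
apply: (@binning_good R m dA dE rho dX dA' F hrho hF n N K cd D pD g j1 (fun=> er) (5 * u + 2 * v + v / u)) => //.
- by under eq_bigr do rewrite eve_op_n; exact: (tr_family1 esn).
- move=> j; under eq_bigr do rewrite eve_op_n player_op_n (pairing_family (psn j)).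
  rewrite sumrB (tr_family1 esn).
  have [_ hj] := svalP (hD j).
  apply: le_trans (_ : rc (err (pfn j) (pqn j) j (theta j) (ty j) u cd) <= _).
    apply: le_trans (_ : rc (\sum_x \sum_k pqn j full x k *
        (1 - Re (quad (D j (x j) (enc cd x) (g x)) (pfn j full x k)))) <= _); last by rewrite le_rc.
    apply: eq_ler.
    under [in RHS]eq_bigr do under eq_bigr do rewrite mulrBr mulr1.
    under [in RHS]eq_bigr do rewrite sumrB.
    rewrite sumrB (q_sum1 (psn j)) rcB rc1; congr (_ - _).
    rewrite rc_sum; apply: eq_bigr => x _; rewrite rc_sum; apply: eq_bigr => k _.
    by rewrite rcM -ge0_rcRe //; exact: (pD j _ _).1.
  rewrite le_rc /err /er; apply: lerD; first by rewrite lerD2r; exact: atyp_le.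
  rewrite ler_pM2r ?invr_gt0 ?exprn_gt0 //; apply: lerD.
    by rewrite ler_wpM2l ?evict_le // mulr_ge0 ?exprn_ge0 ?ler0n.
  by rewrite ler_wpM2l ?hcd.
- rewrite (_ : @eve_op R m dA dE rho dX dA' F n = om_n (eve1 rho F)); last by apply/funext => x; exact: eve_op_n.
  move=> U s hU s1; apply: le_trans (hg U s hU s1) _.
  apply: lerD; first by rewrite lerD2l ler_wpM2l ?typical_tail.
  by rewrite ler_pM2r ?invr_gt0 ?spill_le.
- by rewrite sum_cst card_ord lerDl.
(* The player [j1] witnesses that [m] is positive. *)
- have m1 : er <= m%:R * er.
    by rewrite ler_peMl // ler1n; exact: leq_ltn_trans (leq0n j1) (ltn_ord j1).
  by move: m1 b0; set b := 5 * u + _ + _; lra.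
Qed.

End FiniteBlocklength.

(** * From finite block length to achievable rates *)

Section Achievability.
Variable R : realType.

Lemma good_protocol_le m (dA : 'I_m -> nat) dE n (P : protocol R dA n) j1
    (rho : Op R ({dffun forall j : 'I_m, 'I_(dA j)} * 'I_dE)%type) (eps eps' : R) :
  eps <= eps' -> good_protocol P j1 rho eps -> good_protocol P j1 rho eps'.
Proof.
move=> le [vP [agr [tau [st h]]]]; split=> //; split.
  by apply: le_trans agr; rewrite le_rc lerD2l lerN2.
by exists tau; split=> //; apply: le_trans h le.
Qed.

Definition codesize (n : nat) (r : R) : nat := Num.trunc (expR (n%:R * r)).

Lemma codesize_gt0 n r : 0 <= r -> (0 < codesize n r)%N.
Proof. by move=> r0; rewrite truncn_gt0 -expR0 ler_expR mulr_ge0 ?ler0n. Qed.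

Lemma codesize_le n r : (codesize n r)%:R <= expR (n%:R * r).
Proof. by rewrite truncn_le expR_ge0. Qed.

(** Truncation loses less than 1 and the result is at least 1, so at least half remains; in bits per
    copy this costs [1 / n]. *)
Lemma codesize_ge n r : 0 <= r -> expR (n%:R * r) / 2 <= (codesize n r)%:R.
Proof.
move=> r0; have := truncnS_gt (expR (n%:R * r)); rewrite -/(codesize n r) -natr1.
have : (1 : R) <= (codesize n r)%:R by rewrite ler1n codesize_gt0.
lra.
Qed.

Lemma rate_cvg (r : R) : 0 <= r ->
  ((fun n : nat => log2 (codesize n r)%:R / n%:R : R) @ \oo --> r / ln 2)%classic.
Proof.
move=> r0; have l2 : (0 : R) < ln 2 by rewrite ln_gt0 // ltr1n.
have inv0 : ((fun n : nat => (n%:R : R)^-1) @ \oo --> (0 : R))%classic.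
  by rewrite -cvg_shiftS; exact: cvg_harmonic.
have lo : ((fun n : nat => r / ln 2 - (n%:R : R)^-1) @ \oo --> r / ln 2)%classic.
  by have := cvgB (cvg_cst (r / ln 2)) inv0; rewrite subr0; exact.
apply: (squeeze_cvgr _ lo (cvg_cst _)); near=> n.
have n0 : (0 : R) < n%:R by rewrite ltr0n; near: n; exact: nbhs_infty_gt.
have K0 : (0 : R) < (codesize n r)%:R by rewrite ltr0n codesize_gt0.
rewrite /log2; apply/andP; split.
  have := codesize_ge n r0; rewrite -ler_ln ?posrE ?divr_gt0 ?expR_gt0 //.
  rewrite lnM ?posrE ?expR_gt0 ?invr_gt0 // lnV ?posrE // expRK => h.
  rewrite -(ler_pM2r (mulr_gt0 l2 n0)).
  have -> : (r / ln 2 - n%:R^-1) * (ln 2 * n%:R) = n%:R * r - ln 2 by field; rewrite ?gt_eqF.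
  have -> : ln (codesize n r)%:R / ln 2 / n%:R * (ln 2 * n%:R) = ln (codesize n r)%:R :> R
    by field; rewrite ?gt_eqF.
  exact: h.
have := codesize_le n r; rewrite -ler_ln ?posrE ?expR_gt0 // expRK => h.
by rewrite mulrAC ler_pM2r ?invr_gt0 // ler_pdivrMr // mulrC.
Unshelve. all: by end_near.
Qed.

End Achievability.

Section Achievable.
Variable R : realType.
Local Notation C := (R[i]).
Variables (m : nat) (dA : 'I_m -> nat) (dE : nat).
Variable rho : Op R ({dffun forall j : 'I_m, 'I_(dA j)} * 'I_dE)%type.
Variables (dX dA' : 'I_m -> nat).
Variable F : forall j : 'I_m, 'I_(dX j) -> Map R 'I_(dA j) 'I_(dA' j).
Hypothesis hrho : is_state rho.
Hypothesis hF : forall j : 'I_m, instrument (@F j).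
Local Notation X1 := {dffun forall j : 'I_m, 'I_(dX j)}.
Local Notation full := [set: 'I_m].
Local Notation M := (#|{set 'I_m}|%:R : R).
Variables (pf : forall j, {set 'I_m} -> X1 -> 'I_(dA' j) -> 'I_(dA' j) -> C)
  (pq : forall j, {set 'I_m} -> X1 -> 'I_(dA' j) -> R).
Hypothesis psf : forall j,
  spectral_family (@player1 R m dA dE rho dX dA' F j) (@pf j) (@pq j).
Variables (gf : {set 'I_m} -> X1 -> 'I_dE -> 'I_dE -> C) (gq : {set 'I_m} -> X1 -> 'I_dE -> R).
Hypothesis esf : spectral_family (eve1 rho F) gf gq.
Variable j1 : 'I_m.

(* Fills in the block lengths that are too short for the binning protocol. *)
Lemma trivial_good n eps : 0 <= eps -> exists P : protocol R dA n,
  [/\ forall j, nlab P j = 1%N, nkey P = 1%N & good_protocol P j1 rho eps].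
Proof.
move=> e0; pose N (_ : 'I_m) := 1%N.
pose cd : {dffun forall i : 'I_m, {ffun {ffun 'I_n -> 'I_(dX i)} -> 'I_(N i)}} :=
  @finfun _ (fun i => {ffun {ffun 'I_n -> 'I_(dX i)} -> 'I_(N i)}) (fun i => [ffun=> ord0]).
pose D j (_ : {ffun 'I_n -> 'I_(dX j)}) (_ : {dffun forall i : 'I_m, 'I_(N i)}) (_ : 'I_1) :=
  @idop R {ffun 'I_n -> 'I_(dA' j)}.
have pD j x l : povm (@D j x l).
  split=> [k|a b]; last by rewrite big_ord1.
  exact: (@psd_eq R _ _ id).
exists (binning_protocol F cd D); split=> //.
have esn := product_family n esf; have psn j := product_family n (psf j).
apply: (@binning_good R m dA dE rho dX dA' F hrho hF n N 1 cd D pD [ffun=> ord0] j1 (fun=> 0) 0) => //.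
- by under eq_bigr do rewrite eve_op_n; exact: (tr_family1 esn).
- move=> j; rewrite sumrB; under eq_bigr do rewrite eve_op_n.
  rewrite (tr_family1 esn) -(tr_family1 (psn j)) -sumrB rc0 big1 // => x _.
  apply/eqP; rewrite subr_eq0; apply/eqP; rewrite /tr; apply: eq_bigr => b _.
  rewrite (bigD1 b) //= big1 ?addr0 => [|b' /negPf bb].
    by rewrite player_op_n /D /idop eqxx mulr1.
  by rewrite /D /idop bb mulr0.
- move=> U s hU s1; rewrite big1 // => k _; suff -> : quad (leak (eve_op rho F (n:=n)) (enc_n cd) [ffun=> ord0]) (U^~ k) = 0.
    by rewrite /= mulr0.
  rewrite /quad big1 // => a _; rewrite big1 // => b _; rewrite /leak big1 ?mulr0 ?mul0r // => x _.
  by rewrite /ccoef /hcoef !ord1 eqxx invr1 subrr mulr0 rc0 mul0r.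
- by rewrite big1.
- by rewrite mulr0 addr0 mulr_ge0.
Qed.

Lemma zero_achievable : achievable j1 rho 0.
Proof.
pose P n := sval (cid (@trivial_good n 0 (lexx 0))).
have hP n := svalP (cid (@trivial_good n 0 (lexx 0))).
exists (fun=> 0), (fun=> 0), P; split; first exact: cvg_cst.
split; first by move=> n; case: (hP n).
split=> [n j|]; first by have [-> _ _] := hP n; rewrite mulr0 powRr0.
rewrite (_ : (fun n => _) = fun=> 0); first exact: cvg_cst.
by apply/funext => n; have [_ -> _] := hP n; rewrite /log2 ln1 !mul0r.
Qed.

Variables (d kap : R) (rr : 'I_m -> R).
Hypothesis d0 : 0 < d.
Hypothesis kap0 : 0 <= kap.
Hypothesis rr0 : forall i, 0 <= rr i.
Hypothesis decode_rate : forall j (S : {set 'I_m}), j \in S -> S != full ->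
  ent (@pf j) (@pq j) full - ent (@pf j) (@pq j) S + 3 * d <= \sum_(i in ~: S) rr i.
Hypothesis secret_rate :
  ent gf gq finset.set0 - ent gf gq full + kap + \sum_i rr i + 3 * d <= 0.

Definition err_const : R :=
  let v := total_lvar pf pq gf gq / d ^+ 2 in
  m%:R * (v + (8 + 18 * M) + (2 * M ^+ 2 * v + 6 * (m%:R * M * (2 ^+ m / d)))) + (5 + 2 * v + v).

Lemma err_const_ge0 : 0 <= err_const.
Proof.
have v0 : 0 <= total_lvar pf pq gf gq / d ^+ 2.
  by rewrite divr_ge0 ?exprn_ge0 ?(total_lvar_ge0 psf esf) // ltW.
have d1 : 0 <= 2 ^+ m / d by rewrite divr_ge0 ?exprn_ge0 // ltW.
rewrite /err_const /=.
move: v0 d1; move: (total_lvar pf pq gf gq / d ^+ 2) (2 ^+ m / d) => v D v0 d1.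
rewrite !(addr_ge0, mulr_ge0, ler0n, exprn_ge0) //.
Qed.

Lemma expRN_le (x : R) : 0 < x -> expR (- x) <= x^-1.
Proof.
move=> x0; rewrite expRN lef_pV2 ?posrE ?expR_gt0 //.
by apply: le_trans (expR_ge1Dx x); rewrite lerDr.
Qed.

(** Of the slack [3 * d] in the rates, [2 * d] pays for typicality and the rest gives
    [expR (- n d)], at most [u^4 / d]. The factor [2 ^ m] accounts for the truncated code sizes, and
    [u^2 <= d] brings the key condition below [u^2]. *)
Lemma good_at n u : (0 < n)%N -> 0 < u <= 1 -> n%:R^-1 = u ^+ 4 -> u ^+ 2 <= d ->
  exists P : protocol R dA n,
  [/\ forall j, nlab P j = codesize n (rr j), nkey P = codesize n kap &
    good_protocol P j1 rho (err_const * u)].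
Proof.
move=> n0 u01 nu ud; have [u0 u1] := andP u01.
have nR : (0 : R) < n%:R by rewrite ltr0n.
(* The crude bound [1 / (n d)] suffices, because the Chebyshev errors are already of order
   [1 / n]. *)
have nd : expR (- (n%:R * d)) <= d^-1 * u ^+ 4.
  by rewrite -nu -invfM mulrC; apply: expRN_le; rewrite mulr_gt0.
have N0 i := codesize_gt0 n (rr0 i); have K0 := codesize_gt0 n kap0.
have br j (S : {set 'I_m}) : j \in S -> S != full ->
    expR (n%:R * (ent (@pf j) (@pq j) full - ent (@pf j) (@pq j) S + 2 * d)) *
    \prod_(i in ~: S) (codesize n (rr i))%:R^-1 <= 2 ^+ m / d * u ^+ 4.
  move=> jS Sf; have h := decode_rate jS Sf.
  apply: le_trans (_ : expR (n%:R * (\sum_(i in ~: S) rr i - d)) *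
     (2 ^+ m * expR (- (n%:R * \sum_(i in ~: S) rr i))) <= _).
    apply: ler_pM.
    - exact: expR_ge0.
    - by apply: prodr_ge0 => i _; rewrite invr_ge0 ler0n.
    - by rewrite ler_expR ler_pM2l //; lra.
    rewrite mulr_sumr -sumrN expR_sum.
    apply: le_trans (_ : \prod_(i in ~: S) (2 * expR (- (n%:R * rr i))) <= _).
      apply: ler_prod => i _; rewrite invr_ge0 ler0n /=.
      have Np : (0 : R) < (codesize n (rr i))%:R by rewrite ltr0n.
      rewrite -[X in _ <= X]invrK lef_pV2 ?posrE ?invr_gt0 ?mulr_gt0 ?expR_gt0 //.
      by rewrite invfM -expRN opprK mulrC; exact: codesize_ge.
    rewrite big_split /= prodr_const; apply: ler_wpM2r.
      by apply: prodr_ge0 => i _; exact: expR_ge0.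
    by rewrite ler_eXn2l ?ltr1n // -[X in (_ <= X)%N]card_ord max_card.
  rewrite mulrCA -expRD -mulrA ler_pM2l ?exprn_gt0 //.
  by apply: le_trans nd; rewrite ler_expR; apply: eq_ler; ring.
have kr : expR (n%:R * (ent gf gq finset.set0 - ent gf gq full + 2 * d)) *
    (codesize n kap)%:R * \prod_i (codesize n (rr i))%:R <= u ^+ 2.
  apply: le_trans (_ : expR (n%:R * (ent gf gq finset.set0 - ent gf gq full + 2 * d)) *
    expR (n%:R * kap) * expR (n%:R * \sum_i rr i) <= _).
    apply: ler_pM; rewrite ?mulr_ge0 ?expR_ge0 ?prodr_ge0 ?ler0n //.
      by rewrite ler_wpM2l ?expR_ge0 ?codesize_le.
    rewrite mulr_sumr expR_sum; apply: ler_prod => i _.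
    by rewrite ler0n codesize_le.
  rewrite -!expRD; apply: le_trans (_ : expR (- (n%:R * d)) <= _).
    by rewrite ler_expR -!mulrDr -mulrN ler_pM2l //; move: secret_rate; set t := \sum_i _; lra.
  apply: le_trans nd _; rewrite mulrC ler_pdivrMr // (_ : 4 = 2 + 2)%N // exprD.
  by rewrite ler_pM2l ?exprn_gt0.
have c0 : 0 <= 2 ^+ m / d * u ^+ 4 by rewrite !mulr_ge0 ?exprn_ge0 ?invr_ge0 // ltW.
have [x0 _] : exists x : {dffun forall j : 'I_m, {ffun 'I_n -> 'I_(dX j)}}, True.
  case: (pickP (fun _ : {dffun forall j : 'I_m, {ffun 'I_n -> 'I_(dX j)}} => true)) => [x _|h].
    by exists x.
  exfalso; have := tr_family1 (product_family n esf).
  rewrite big1 => [/eqP|x _]; first by rewrite eq_sym oner_eq0.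
  by have := h x.
have [P [hN hK hP]] := good_binning hrho hF psf esf j1 n0 d0 u01 N0 K0 c0 br kr x0.
exists P; split=> //; first by move=> j; rewrite hN.
apply: good_protocol_le hP; rewrite /err_const.
have -> : total_lvar pf pq gf gq / (n%:R * d ^+ 2) = total_lvar pf pq gf gq / d ^+ 2 * u ^+ 4.
  by rewrite -nu invfM mulrA mulrAC.
have : 0 <= total_lvar pf pq gf gq / d ^+ 2.
  by rewrite divr_ge0 ?exprn_ge0 ?(total_lvar_ge0 psf esf) // ltW.
have : 0 <= m%:R :> R by rewrite ler0n.
set v := total_lvar _ _ _ _ / _; set D := 2 ^+ m / d; set A := 8 + _; set B := M ^+ 2.
move: (M) (m%:R : R) => M' m' m0 v0.
have u4 : v * u ^+ 4 <= v * u.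
  by rewrite ler_wpM2l // -[X in _ <= X]mulr1 exprS ler_wpM2l ?(ltW u0) // exprn_ile1 // ltW.
have u3 : v * u ^+ 3 <= v * u.
  by rewrite ler_wpM2l // -[X in _ <= X]mulr1 exprS ler_wpM2l ?(ltW u0) // exprn_ile1 // ltW.
have -> : (2 * B * (v * u ^+ 4) + 6 * (m' * M' * (D * u ^+ 4))) / u ^+ 3 =
    (2 * B * v + 6 * (m' * M' * D)) * u by field; rewrite gt_eqF.
have -> : v * u ^+ 4 / u = v * u ^+ 3 by field; rewrite gt_eqF.
rewrite [X in _ <= X]mulrDl; apply: lerD; last by lra.
rewrite -[X in _ <= X]mulrA; apply: ler_wpM2l => //.
by rewrite [X in _ <= X]mulrDl [X in _ <= X + _]mulrDl !lerD2r.
Qed.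

Lemma key_rate_achievable : achievable j1 rho (kap / ln 2).
Proof.
have l2 : (0 : R) < ln 2 by rewrite ln_gt0 // ltr1n.
(* [u n = n^(-1/4)] balances the two error contributions [u] and [1 / (n u^3)]. *)
pose s n : R := Num.sqrt n%:R^-1; pose u n : R := Num.sqrt (s n).
have s0 : (s @ \oo --> (0 : R))%classic.
  have inv0 : ((fun n : nat => (n%:R : R)^-1) @ \oo --> (0 : R))%classic.
    by rewrite -cvg_shiftS; exact: cvg_harmonic.
  by have := cvg_comp _ _ inv0 (@sqrt_continuous R 0); rewrite sqrtr0; exact.
have us : (u @ \oo --> (0 : R))%classic.
  by have := cvg_comp _ _ s0 (@sqrt_continuous R 0); rewrite sqrtr0; exact.
have u2 n : u n ^+ 2 = s n by rewrite sqr_sqrtr ?sqrtr_ge0.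
have u4 n : u n ^+ 4 = n%:R^-1.
  by rewrite (exprM _ 2 2) u2 sqr_sqrtr // invr_ge0 ler0n.
have ex n : exists P : protocol R dA n, [/\ good_protocol P j1 rho (err_const * u n),
    forall j, (nlab P j)%:R <= 2 `^ (n%:R * (rr j / ln 2)) &
    (0 < n)%N -> s n <= d -> nkey P = codesize n kap].
  have pow j : (2 : R) `^ (n%:R * (rr j / ln 2)) = expR (n%:R * rr j).
    by rewrite /powR gt_eqF // mulrA divfK ?gt_eqF.
  have [/andP[n0 sd]|h] := boolP ((0 < n)%N && (s n <= d)).
    have u01 : 0 < u n <= 1.
      rewrite !sqrtr_gt0 invr_gt0 ltr0n n0 /= -sqrtr1 ler_wsqrtr // -sqrtr1 ler_wsqrtr //.
      by rewrite invf_le1 ?ltr0n // ler1n.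
    have [P [hN hK hP]] := good_at n0 u01 (esym (u4 n)) (eq_ind_r (fun x => x <= d) sd (u2 n)).
    by exists P; split=> // j; rewrite hN pow codesize_le.
  have [|P [hN hK hP]] := @trivial_good n (err_const * u n).
    by rewrite mulr_ge0 ?sqrtr_ge0 ?err_const_ge0.
  exists P; split=> // [j|n0 sd]; last by rewrite n0 sd in h.
  by rewrite hN pow -expR0 ler_expR mulr_ge0 ?ler0n.
pose P n := sval (cid (ex n)); have hP n := svalP (cid (ex n)).
exists (fun j => rr j / ln 2), (fun n => err_const * u n), P; split.
  by have := cvgM (cvg_cst err_const) us; rewrite mulr0; exact.
split; first by move=> n; case: (hP n).
split; first by move=> n; case: (hP n).
apply: cvg_trans (rate_cvg kap0); apply: near_eq_cvg; near=> n.
have [_ _ ->] := hP n => //; near: n; first exact: nbhs_infty_gt.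
by apply: (cvgr_le _ s0).
Unshelve. all: by end_near.
Qed.

End Achievable.

Section Rates.
Variable R : realType.
Variables (m : nat) (dA : 'I_m -> nat) (dE : nat).
Variable rho : Op R ({dffun forall j : 'I_m, 'I_(dA j)} * 'I_dE)%type.
Variables (dX dA' : 'I_m -> nat).
Variable F : forall j : 'I_m, 'I_(dX j) -> Map R 'I_(dA j) 'I_(dA' j).
Hypothesis hrho : is_state rho.
Hypothesis hF : forall j : 'I_m, instrument (@F j).
Variable j1 : 'I_m.
Local Notation w := (@omega R m dA dX dA' dE rho F).
Local Notation S := (condS (XS [set: 'I_m]) [set LE m] w).

Lemma player_families : exists fq : forall j : 'I_m,
    ({set 'I_m} -> {dffun forall j : 'I_m, 'I_(dX j)} -> 'I_(dA' j) -> 'I_(dA' j) -> R[i]) *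
    ({set 'I_m} -> {dffun forall j : 'I_m, 'I_(dX j)} -> 'I_(dA' j) -> R),
  forall j, spectral_family (@player1 R m dA dE rho dX dA' F j) (fq j).1 (fq j).2.
Proof.
have ex j : exists fq : ({set 'I_m} -> {dffun forall j : 'I_m, 'I_(dX j)} -> 'I_(dA' j) -> 'I_(dA' j) -> R[i]) *
    ({set 'I_m} -> {dffun forall j : 'I_m, 'I_(dX j)} -> 'I_(dA' j) -> R),
    spectral_family (@player1 R m dA dE rho dX dA' F j) fq.1 fq.2.
  have [f [q sf]] := exists_family (@player1_psd R m dA dE rho dX dA' F hrho hF j)
    (player1_trace hrho hF j).
  by exists (f, q).
by exists (fun j => sval (cid (ex j))) => j; exact: svalP (cid (ex j)).
Qed.

Lemma eve_family : exists f q, spectral_family (eve1 rho F) f q.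
Proof. exact: exists_family (eve1_psd hrho hF) (eve1_trace hrho hF). Qed.

Lemma rate_achievable (Rt : 'I_m -> R) (r : R) :
  Rcq w Rt -> 0 <= r -> r < S - \sum_i Rt i -> achievable j1 rho r.
Proof.
move=> [Rt0 hR] r0 rS.
have l2 : (0 : R) < ln 2 by rewrite ln_gt0 // ltr1n.
have [fq psf] := player_families; have [gf [gq esf]] := eve_family.
have SE : S * ln 2 = ent gf gq [set: 'I_m] - ent gf gq finset.set0.
  by rewrite (condS_eve hrho hF esf) divfK ?gt_eqF.
pose gap : R := (S - \sum_i Rt i - r) * ln 2.
have gap0 : 0 < gap by rewrite mulr_gt0 // subr_gt0.
have m3 : (0 : R) < 3 * m%:R + 3 by rewrite ltr_wpDl ?mulr_ge0 ?ler0n.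
(* Raising each of the [m] rates by [3 * d] uses [3 * d * m] of the gap, and the secrecy condition
   uses another [3 * d]. *)
pose d := gap / (3 * m%:R + 3).
have d0 : 0 < d by rewrite divr_gt0.
have gd : gap = 3 * d * m%:R + 3 * d by rewrite /d; field; rewrite gt_eqF.
have := @key_rate_achievable R m dA dE rho dX dA' F hrho hF _ _ psf gf gq esf j1 d (r * ln 2)
  (fun i => Rt i * ln 2 + 3 * d) d0 (mulr_ge0 r0 (ltW l2)).
rewrite mulfK ?gt_eqF //; apply.
- by move=> i; apply: addr_ge0; apply: mulr_ge0 => //; exact: ltW.
- move=> j T jT Tf; have := hR j (~: T); rewrite inE jT => /(_ isT).
  rewrite (condS_player hrho hF (psf j)) finset.setCK ler_pdivrMr // mulr_suml big_split /= => h.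
  (* The complement of [T] is not empty, so at least one of the added [3 * d] is available. *)
  apply: lerD => //; rewrite sumr_const -[X in _ <= X]mulr_natr -[X in X <= _]mulr1.
  apply: ler_wpM2l; first by apply: mulr_ge0 => //; exact: ltW.
  rewrite ler1n card_gt0; apply: contra Tf => /eqP h0.
  by rewrite -(finset.setCK T) h0 finset.setC0.
- rewrite big_split /= sum_cst card_ord -mulr_suml.
  have E : gap = S * ln 2 - (\sum_i Rt i) * ln 2 - r * ln 2 by rewrite /gap; ring.
  by move: E gd; rewrite SE; lra.
Qed.

Lemma Kni_ge0 : (0 <= Kni j1 rho)%E.
Proof.
have [fq psf] := player_families; have [gf [gq esf]] := eve_family.
apply: ereal_sup_ubound; exists 0 => //.
exact: (@zero_achievable R m dA dE rho dX dA' F hrho hF _ _ psf gf gq esf j1).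
Qed.

(** For every [e > 0], either the rate lowered by [e] is positive and achievable, or it is at most 0
    and the trivial protocol already does as well. *)
Lemma Kni_ge_rate (Rt : 'I_m -> R) :
  Rcq w Rt -> ((S - \sum_i Rt i)%:E <= Kni j1 rho)%E.
Proof.
move=> hR; apply/lee_addgt0Pr => e e0.
have [h|h] := lerP (S - \sum_i Rt i - e) 0.
  by rewrite -[X in (X <= _)%E]add0e leeD ?Kni_ge0 // lee_fin; lra.
apply: le_trans (_ : ((S - \sum_i Rt i - e)%:E + e%:E <= _)%E).
  by rewrite -EFinD subrK.
rewrite leeD2r //; apply: ereal_sup_ubound; exists (S - \sum_i Rt i - e) => //.
by apply: rate_achievable hR (ltW h) _; rewrite ltrBlDr ltrDl.
Qed.

End Rates.

Theorem theorem1 (R : realType) (m : nat) (hm : (0 < m)%N)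
  (dA : 'I_m -> nat) (dE : nat)
  (rho : Op R ({dffun forall j : 'I_m, 'I_(dA j)} * 'I_dE)%type)
  (hrho : is_state rho)
  (dX dA' : 'I_m -> nat)
  (F : forall j : 'I_m, 'I_(dX j) -> Map R 'I_(dA j) 'I_(dA' j))
  (hF : forall j : 'I_m, instrument (F j)) :
  let w := omega rho F in
  ((condS (XS [set: 'I_m]) [set LE m] w)%:E - RCO w
     <= Kni (Ordinal hm) rho)%E.
Proof.
cbv zeta; set w := omega rho F; set S := condS _ _ _; set k := Kni _ _.
have k0 : (0 <= k)%E by exact: (@Kni_ge0 R m dA dE rho dX dA' F hrho hF).
have hk Rt : Rcq w Rt -> ((S - \sum_i Rt i)%:E <= k)%E by exact: (@Kni_ge_rate R m dA dE rho dX dA' F hrho hF).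
move: k k0 hk => [k| |] //; last first.
  by move=> _ _; rewrite leey.
move=> k0 hk.
(* The bound for each single rate tuple makes [S - k] a lower bound of the set whose infimum is
   [RCO w]. *)
have lb : ((S - k)%:E <= RCO w)%E.
  apply/ereal_infP => _ [Rt hR <-]; have := hk Rt hR.
  by rewrite !lee_fin; lra.
(* An infinite infimum, that is an empty region, makes the left side minus infinity; minus infinity
   is excluded by [lb]. *)
move: lb; case: (RCO w) => [c| |] //; last by rewrite leNye.
by rewrite -EFinB !lee_fin; lra.
Qed.
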